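(* For each integer $n\ge 4$, $$\frac1n< V_n<\frac{2}{n+1},\qquad\text{where } V_n=\sup_{f\in\mathcal{K}}\big(|a_n(f)|-|a_{n+1}(f)|\big).$$
   Context: $\mathbb{D}$ is the open unit disk. $\mathcal{K}$ is the class of analytic univalent functions $f(z)=z+\sum_{n\ge2}a_n(f)z^n$ on $\mathbb{D}$ whose image $f(\mathbb{D})$ is convex. *)

(* Defs.v *)
From Stdlib Require Import Reals.
Open Scope R_scope.

Definition Cx : Type := (R * R)%type.
Definition C0 : Cx := (0, 0).
Definition C1 : Cx := (1, 0).
Definition Cadd (u v : Cx) : Cx := (fst u + fst v, snd u + snd v).
Definition Cmul (u v : Cx) : Cx :=
  (fst u * fst v - snd u * snd v, fst u * snd v + snd u * fst v).
Definition Cscale (t : R) (u : Cx) : Cx := (t * fst u, t * snd u).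
Definition Cmod (u : Cx) : R := sqrt (fst u ^ 2 + snd u ^ 2).
Fixpoint Cpow (z : Cx) (k : nat) : Cx :=
  match k with O => C1 | S k' => Cmul z (Cpow z k') end.

Definition in_disk (z : Cx) : Prop := Cmod z < 1.

Fixpoint psum (a : nat -> Cx) (z : Cx) (N : nat) : Cx :=
  match N with
  | O => Cmul (a O) (Cpow z O)
  | S N' => Cadd (psum a z N') (Cmul (a N) (Cpow z N))
  end.

Definition series_to (a : nat -> Cx) (z w : Cx) : Prop :=
  Un_cv (fun N => fst (psum a z N)) (fst w) /\
  Un_cv (fun N => snd (psum a z N)) (snd w).

(* Class K, described through the Taylor coefficient sequence a of f:
   f(z) = z + sum_{n>=2} a_n z^n is analytic on the disk (the series converges
   at every point of D), univalent (injective on D), and f(D) is convex. *)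
Definition in_K (a : nat -> Cx) : Prop :=
  a O = C0 /\ a 1%nat = C1 /\
  (forall z, in_disk z -> exists w, series_to a z w) /\
  (forall z1 z2 w, in_disk z1 -> in_disk z2 ->
     series_to a z1 w -> series_to a z2 w -> z1 = z2) /\
  (forall z1 z2 w1 w2 t, in_disk z1 -> in_disk z2 ->
     series_to a z1 w1 -> series_to a z2 w2 -> 0 <= t <= 1 ->
     exists z3, in_disk z3 /\
       series_to a z3 (Cadd (Cscale (1 - t) w1) (Cscale t w2))).

(* Main.v *)
(** Upper bound. If f is convex, the mean of f(e^(i al) z) and f(e^(-i al) z) takes values
    in f(D), so it equals f(om(z)) with om : D -> D analytic and om(0) = 0. Expanding
    1 - Re (om(z)/z) >= 0 to second order in al, at the level of Taylor coefficients, shows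
    that p = 1 + z f''/f' has nonnegative real part, so b_k = k a_k are the coefficients of
    a starlike function. Leung's argument applies: averaging over the Herglotz measure of p
    provides a unimodular zeta with sum_{k<=n} (|p_k - zeta^k|^2 - 1)/k <= 0, up to an
    arbitrarily small error, and the third Lebedev-Milin inequality then yields
    |b_{n+1} - zeta b_n| <= 1. Hence (n+1)(|a_n| - |a_{n+1}|) <= 1 + |a_n|, which stays below
    2 unless |p_1| is close to 2; in that case f is close to a half-plane map, for which
    |a_n| = |a_{n+1}|.

    Lower bound. The strip maps a_k = sin (k t) / (k sin t) give exactly 1/n at
    t = pi/(n+1), and decreasing t slightly improves this value when
    cos (pi/(n+1)) > n/(n+1), that is when n >= 4. *)

(* The Schwarz function [om] is given only pointwise, as a preimage under f of a mean value, so its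
   analyticity has to be earned: injectivity forces f' to have no zero, quantitative local inverses
   then make [om] complex differentiable, and its Taylor coefficients are read off circle averages,
   whose dependence on the radius comes from differentiation under the integral sign. Positivity of
   Re p is kept in dual form: one linear inequality in p_1, ..., p_n for each nonnegative
   trigonometric polynomial of degree n. Each later fact about p (the bound 2, the rigidity when
   |p_1| is near 2, the existence of zeta) is the choice of a test polynomial. Strictness on the
   right has to survive a supremum, so the closeness to a half-plane map is made quantitative and
   yields a gain d > 0 that depends on n alone. On the left, t = pi/(n+1) gives a_n = 1/n and
   a_{n+1} = 0; the gap minus 1/n vanishes there, and the sign of its derivative is that of n -
   (n+1) cos t. *)
Require Import Defs.
From Stdlib Require Import Reals Lra Lia Psatz Classical Wf_nat Arith.
From Stdlib Require Import FunctionalExtensionality IndefiniteDescription.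
From Coquelicot Require Import Coquelicot.
Open Scope R_scope.

(** * Power series on the disk *)

Lemma C_ext (u v : C) : Re u = Re v -> Im u = Im v -> u = v.
Proof. destruct u, v; simpl; congruence. Qed.

(** Componentwise convergence is the notion used by [series_to], and it gives direct access to the
    theory of real series. *)
Definition csum (u : nat -> C) (s : C) : Prop :=
  is_series (fun k => Re (u k)) (Re s) /\ is_series (fun k => Im (u k)) (Im s).

Lemma csum_unique u s s' : csum u s -> csum u s' -> s = s'.
Proof.
  intros [H1 H2] [H3 H4]; apply C_ext.
  - rewrite <- (is_series_unique _ _ H1); apply is_series_unique, H3.
  - rewrite <- (is_series_unique _ _ H2); apply is_series_unique, H4.
Qed.

Lemma csum_ext u v s : (forall k, u k = v k) -> csum u s -> csum v s.
Proof.
  intros E [H1 H2]; split.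
  - apply is_series_ext with (2 := H1); intros; now rewrite E.
  - apply is_series_ext with (2 := H2); intros; now rewrite E.
Qed.

Lemma csum_plus u v s t :
  csum u s -> csum v t -> csum (fun k => u k + v k)%C (s + t)%C.
Proof.
  intros [H1 H2] [H3 H4]; split.
  - exact (is_series_plus _ _ _ _ H1 H3).
  - exact (is_series_plus _ _ _ _ H2 H4).
Qed.

Lemma csum_scal (c : C) u s : csum u s -> csum (fun k => c * u k)%C (c * s)%C.
Proof.
  intros [H1 H2]; split; simpl.
  - exact (is_series_minus _ _ _ _ (is_series_scal (Re c) _ _ H1) (is_series_scal (Im c) _ _ H2)).
  - exact (is_series_plus _ _ _ _ (is_series_scal (Re c) _ _ H2) (is_series_scal (Im c) _ _ H1)).
Qed.

Lemma csum_decr u s : csum (fun k => u (S k)) s -> csum u (u O + s)%C.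
Proof.
  intros [H1 H2]; split; apply is_series_decr_1; simpl.
  - replace (plus _ _) with (Re s); [exact H1|].
    unfold plus, opp; simpl; unfold Re; ring.
  - replace (plus _ _) with (Im s); [exact H2|].
    unfold plus, opp; simpl; unfold Im; ring.
Qed.

Lemma Im_le_Cmod (c : C) : Rabs (Im c) <= Cmod c.
Proof.
  eapply Rle_trans; [|apply Rmax_Cmod]. apply Rmax_r.
Qed.

Lemma Re_le_Cmod (c : C) : Re c <= Cmod c.
Proof. eapply Rle_trans; [apply Rle_abs|apply re_le_Cmod]. Qed.

(** A rotation turns a modulus into a real part, so that linear inequalities between real parts
    yield bounds on moduli. *)
Lemma unit_align (s : C) : exists u : C, Cmod u = 1 /\ Re (u * s) = Cmod s.
Proof.
  destruct (Req_dec (Cmod s) 0) as [H|H].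
  - exists (RtoC 1). rewrite Cmod_1. split; [reflexivity|].
    rewrite (Cmod_eq_0 _ H), Cmod_0. simpl; ring.
  - assert (Hs : s <> 0%C) by (intro E; apply H; rewrite E; apply Cmod_0).
    assert (Hc : RtoC (Cmod s) <> 0%C) by (intro E; apply H; now injection E).
    exists (Cconj s / Cmod s)%C. split.
    + rewrite Cmod_div by exact Hc. rewrite Cmod_conj, Cmod_R.
      rewrite Rabs_pos_eq by apply Cmod_ge_0. now field.
    + assert (E : (Cconj s / Cmod s * s)%C = RtoC (Cmod s)).
      { replace (Cconj s / Cmod s * s)%C with ((s * Cconj s) / Cmod s)%C by (field; auto).
        rewrite <- Cmod2_conj. rewrite RtoC_pow. field; auto. }
      rewrite E; reflexivity.
Qed.

Lemma is_series_le (u v : nat -> R) (s t : R) :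
  (forall k, u k <= v k) -> is_series u s -> is_series v t -> s <= t.
Proof.
  intros H Hu Hv.
  apply (is_lim_seq_le (sum_n u) (sum_n v) s t); [|exact Hu|exact Hv].
  intros n. apply sum_n_m_le, H.
Qed.

Lemma csum_dominated (u : nat -> C) (v : nat -> R) (S : R) :
  (forall k, Cmod (u k) <= v k) -> is_series v S ->
  exists s, csum u s /\ Cmod s <= S.
Proof.
  intros H HS.
  assert (E1 : ex_series (fun k => Re (u k))).
  { apply @ex_series_le with (b := v); [|now exists S].
    intros k. eapply Rle_trans; [apply re_le_Cmod|apply H]. }
  assert (E2 : ex_series (fun k => Im (u k))).
  { apply @ex_series_le with (b := v); [|now exists S].
    intros k. eapply Rle_trans; [apply Im_le_Cmod|apply H]. }
  set (s := (Series (fun k => Re (u k)), Series (fun k => Im (u k))) : C).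
  assert (Hs : csum u s) by (split; simpl; apply Series_correct; assumption).
  exists s; split; [exact Hs|].
  (* Comparing components would lose a constant; after rotating the sum onto the positive axis, a
     single real comparison gives the sharp bound. *)
  destruct (unit_align s) as [w [Hw Hws]].
  rewrite <- Hws.
  destruct (csum_scal w _ _ Hs) as [H1 _].
  apply (is_series_le (fun k => Re (w * u k)) v) with (3 := HS); [|exact H1].
  intros k. eapply Rle_trans; [apply Re_le_Cmod|].
  rewrite Cmod_mult, Hw, Rmult_1_l. apply H.
Qed.

(** A Cauchy estimate in place of a radius of convergence: on |z| < rho the series is dominated by a
    geometric one with explicit constants, which makes all later bounds uniform in the point. *)
Definition bnd (rho M : R) (a : nat -> C) : Prop :=
  forall k, Cmod (a k) * rho ^ k <= M.

(* Meaningful only where the series converges: [Series] is total. *)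
Definition ev (a : nat -> C) (z : C) : C :=
  (Series (fun k => Re (a k * z ^ k)), Series (fun k => Im (a k * z ^ k))).

Lemma csum_ev a z s : csum (fun k => a k * z ^ k)%C s -> ev a z = s.
Proof.
  intros [H1 H2]. apply C_ext; simpl; apply is_series_unique; assumption.
Qed.

Lemma bnd_nonneg rho M a : bnd rho M a -> 0 <= M.
Proof.
  intros H. generalize (H O) (Cmod_ge_0 (a O)); simpl; lra.
Qed.

Lemma ev_spec rho M a z :
  bnd rho M a -> Cmod z < rho ->
  csum (fun k => a k * z ^ k)%C (ev a z) /\
  Cmod (ev a z) <= M * rho / (rho - Cmod z).
Proof.
  intros H Hz.
  assert (Hz0 := Cmod_ge_0 z).
  assert (Hr : 0 < rho) by lra.
  assert (Hq : 0 <= Cmod z / rho < 1).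
  { split; [apply Rdiv_le_0_compat; lra|]. apply Rlt_div_l; lra. }
  destruct (csum_dominated (fun k => a k * z ^ k)%C (fun k => M * (Cmod z / rho) ^ k)
     (M * / (1 - Cmod z / rho))) as [s [Hs1 Hs2]].
  - intros k. rewrite Cmod_mult, Cmod_pow.
    unfold Rdiv. rewrite Rpow_mult_distr, pow_inv.
    assert (0 < rho ^ k) by (apply pow_lt; lra).
    assert (0 <= Cmod z ^ k) by (apply pow_le; lra).
    replace (M * (Cmod z ^ k * / rho ^ k)) with ((M * / rho ^ k) * Cmod z ^ k) by ring.
    apply Rmult_le_compat_r; [assumption|].
    apply Rle_div_r; [lra|apply H].
  - apply (is_series_scal M (fun k => (Cmod z / rho) ^ k)). apply is_series_geom.
    rewrite Rabs_pos_eq; lra.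
  - rewrite (csum_ev _ _ _ Hs1). split; [exact Hs1|].
    eapply Rle_trans; [exact Hs2|]. right. field. split; lra.
Qed.

Lemma ev_lin rho M M' a b c d (z : C) (x y : C) :
  bnd rho M a -> bnd rho M' b -> Cmod z < rho ->
  (forall k, c k = x * a k + y * b k)%C -> d = (x * ev a z + y * ev b z)%C ->
  ev c z = d.
Proof.
  intros Ha Hb Hz E ->. apply csum_ev.
  eapply csum_ext;
   [|exact (csum_plus _ _ _ _ (csum_scal x _ _ (proj1 (ev_spec _ _ _ _ Ha Hz)))
               (csum_scal y _ _ (proj1 (ev_spec _ _ _ _ Hb Hz))))].
  intros k; simpl. rewrite E. ring.
Qed.

Lemma bnd_shift rho M a n : 0 < rho -> bnd rho M a -> bnd rho (M / rho ^ n) (fun k => a (n + k)%nat).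
Proof.
  intros Hr H k. apply (Rle_div_r _ M (rho ^ n)); [apply pow_lt; lra|].
  rewrite Rmult_assoc, <- pow_add, Nat.add_comm.
  replace (k + n)%nat with (n + k)%nat by lia. apply H.
Qed.

Lemma ev_shift rho M a z : bnd rho M a -> Cmod z < rho ->
  ev a z = (a O + z * ev (fun k => a (S k)) z)%C.
Proof.
  intros H Hz. assert (Hr : 0 < rho) by (generalize (Cmod_ge_0 z); lra).
  apply csum_ev.
  replace (a O) with (a O * z ^ 0)%C by (simpl; ring).
  apply (csum_decr (fun k => a k * z ^ k)%C).
  eapply csum_ext;
    [|exact (csum_scal z _ _ (proj1 (ev_spec _ _ _ _ (bnd_shift _ _ _ 1 Hr H) Hz)))].
  intros k; simpl. ring.
Qed.

(* Coefficients of the difference quotient (f(z) - f(z0)) / (z - z0). *)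
Definition dv (z0 : C) (a : nat -> C) (k : nat) : C := ev (fun i => a (S k + i)%nat) z0.

Lemma bnd_dv rho M a z0 : bnd rho M a -> Cmod z0 < rho ->
  bnd rho (M / (rho - Cmod z0)) (dv z0 a).
Proof.
  intros H Hz k. assert (Hr : 0 < rho) by (generalize (Cmod_ge_0 z0); lra).
  assert (B := proj2 (ev_spec _ _ _ _ (bnd_shift _ _ _ (S k) Hr H) Hz)).
  assert (0 < rho ^ k) by (apply pow_lt; lra).
  apply Rle_trans with (M / rho ^ S k * rho / (rho - Cmod z0) * rho ^ k).
  - apply Rmult_le_compat_r; [lra|exact B].
  - right. simpl. field. lra.
Qed.

(** Synthetic division: the quotient coefficients satisfy d_k = a_{k+1} + z0 d_{k+1}, and summing
    this relation against z^k gives the factorization. *)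
Lemma ev_factor rho M a z0 z : bnd rho M a -> Cmod z0 < rho -> Cmod z < rho ->
  (ev a z - ev a z0 = (z - z0) * ev (dv z0 a) z)%C.
Proof.
  intros H H0 Hz. assert (Hr : 0 < rho) by (generalize (Cmod_ge_0 z0); lra).
  assert (Hd := bnd_dv _ _ _ _ H H0).
  assert (Hd1 := bnd_shift _ _ _ 1 Hr Hd).
  assert (Erec : forall k, dv z0 a k = (a (S k) + z0 * dv z0 a (S k))%C).
  { intros k. unfold dv at 1.
    rewrite (ev_shift _ _ _ _ (bnd_shift _ _ _ (S k) Hr H) H0).
    rewrite Nat.add_0_r. do 2 f_equal. unfold dv. f_equal.
    apply FunctionalExtensionality.functional_extensionality. intros i.
    f_equal. lia. }
  assert (E1 : ev (fun k => a (S k)) z =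
     (1 * ev (dv z0 a) z + (- z0) * ev (fun k => dv z0 a (1 + k)%nat) z)%C).
  { eapply (ev_lin _ _ _ _ _ _ _ _ 1 (- z0)%C Hd Hd1 Hz); [|reflexivity].
    intros k. rewrite (Erec k). simpl. ring. }
  assert (E2 := ev_shift _ _ _ _ Hd Hz).
  rewrite (ev_shift _ _ _ _ H Hz), (ev_shift _ _ _ _ H H0).
  change (ev (fun k => a (S k)) z0) with (dv z0 a 0).
  change (fun k => dv z0 a (1 + k)%nat) with (fun k => dv z0 a (S k)) in E1.
  rewrite E1.
  transitivity (z * ev (dv z0 a) z - z0 * (dv z0 a 0 + z * ev (fun k => dv z0 a (S k)) z))%C.
  - ring.
  - rewrite <- E2. ring.
Qed.

(** The derivative f'(z), as the difference quotient on the diagonal. In this form Taylor estimates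
    come from factoring repeatedly. *)
Definition df (a : nat -> C) (z : C) : C := ev (dv z a) z.

Lemma bnd_mono rho M M' a : M <= M' -> bnd rho M a -> bnd rho M' a.
Proof. intros H Ha k. eapply Rle_trans; [apply Ha|exact H]. Qed.

Lemma bnd_dv_unif rho r M a z0 : bnd rho M a -> r < rho -> Cmod z0 <= r ->
  bnd rho (M / (rho - r)) (dv z0 a).
Proof.
  intros H Hr Hz. assert (HM := bnd_nonneg _ _ _ H).
  apply bnd_mono with (M / (rho - Cmod z0)).
  - apply Rmult_le_compat_l; [exact HM|]. apply Rinv_le_contravar; lra.
  - apply bnd_dv; [exact H|lra].
Qed.

Lemma ev_bound_unif rho r M a z : bnd rho M a -> r < rho -> Cmod z <= r ->
  Cmod (ev a z) <= M * rho / (rho - r).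
Proof.
  intros H Hr Hz. assert (HM := bnd_nonneg _ _ _ H).
  assert (Hz0 := Cmod_ge_0 z).
  eapply Rle_trans; [apply (ev_spec _ _ _ _ H); lra|].
  apply Rmult_le_compat_l; [nra|]. apply Rinv_le_contravar; lra.
Qed.

Lemma ev_lip rho r M a : bnd rho M a -> 0 <= r < rho ->
  exists K, 0 <= K /\ forall z z0, Cmod z <= r -> Cmod z0 <= r ->
    Cmod (ev a z - ev a z0) <= K * Cmod (z - z0).
Proof.
  intros H Hr. exists (M / (rho - r) * rho / (rho - r)).
  assert (HM := bnd_nonneg _ _ _ H). split.
  - repeat apply Rmult_le_pos; try lra; left; apply Rinv_0_lt_compat; lra.
  - intros z z0 Hz H0.
    rewrite (ev_factor _ _ _ _ _ H) by lra. rewrite Cmod_mult, Rmult_comm.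
    apply Rmult_le_compat_r; [apply Cmod_ge_0|].
    apply ev_bound_unif; [apply bnd_dv_unif; lra || assumption|lra|lra].
Qed.

(** Factoring twice writes the remainder as (z - z0)^2 times a second difference quotient, which is
    bounded uniformly on |z| <= r. *)
Lemma ev_taylor rho r M a : bnd rho M a -> 0 <= r < rho ->
  exists K, 0 <= K /\ forall z z0, Cmod z <= r -> Cmod z0 <= r ->
    Cmod (ev a z - ev a z0 - df a z0 * (z - z0)) <= K * Cmod (z - z0) ^ 2.
Proof.
  intros H Hr. exists (M / (rho - r) / (rho - r) * rho / (rho - r)).
  assert (HM := bnd_nonneg _ _ _ H). split.
  - repeat apply Rmult_le_pos; try lra; left; apply Rinv_0_lt_compat; lra.
  - intros z z0 Hz H0.
    assert (Hd : bnd rho (M / (rho - r)) (dv z0 a)) by (apply bnd_dv_unif; lra || assumption).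
    assert (Hdd : bnd rho (M / (rho - r) / (rho - r)) (dv z0 (dv z0 a)))
      by (apply bnd_dv_unif; lra || assumption).
    rewrite (ev_factor _ _ _ _ _ H) by lra.
    replace ((z - z0) * ev (dv z0 a) z - df a z0 * (z - z0))%C
      with ((z - z0) * (ev (dv z0 a) z - ev (dv z0 a) z0))%C by (unfold df; ring).
    rewrite (ev_factor _ _ _ _ _ Hd) by lra. rewrite !Cmod_mult.
    replace (Cmod (z - z0) * (Cmod (z - z0) * Cmod (ev (dv z0 (dv z0 a)) z)))
      with (Cmod (ev (dv z0 (dv z0 a)) z) * Cmod (z - z0) ^ 2) by ring.
    apply Rmult_le_compat_r; [apply pow2_ge_0|].
    apply ev_bound_unif; [assumption|lra|lra].
Qed.

Lemma Cmod_sub_sym (x y : C) : Cmod (x - y) = Cmod (y - x).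
Proof. rewrite <- Cmod_opp. f_equal. ring. Qed.

(** The Taylor remainders at z0 and at z, with the two points exchanged, add up to (f'(z) - f'(z0))
    (z - z0). *)
Lemma df_lip rho r M a : bnd rho M a -> 0 <= r < rho ->
  exists K, 0 <= K /\ forall z z0, Cmod z <= r -> Cmod z0 <= r ->
    Cmod (df a z - df a z0) <= K * Cmod (z - z0).
Proof.
  intros H Hr. destruct (ev_taylor _ _ _ _ H Hr) as [K [HK T]].
  exists (2 * K). split; [lra|]. intros z z0 Hz H0.
  destruct (Req_dec (Cmod (z - z0)) 0) as [E|E].
  - apply Cmod_eq_0 in E. replace z with z0.
    + replace (df a z0 - df a z0)%C with (RtoC 0) by ring.
      replace (z0 - z0)%C with (RtoC 0) by ring. rewrite Cmod_0. lra.
    + replace z with (z0 + (z - z0))%C by ring. rewrite E. ring.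
  - assert (P : 0 < Cmod (z - z0)) by (generalize (Cmod_ge_0 (z - z0)); lra).
    apply Rmult_le_reg_r with (1 := P). rewrite <- Cmod_mult.
    assert (T1 := T z z0 Hz H0). assert (T2 := T z0 z H0 Hz).
    rewrite (Cmod_sub_sym z0 z) in T2.
    replace ((df a z - df a z0) * (z - z0))%C with
      ((ev a z - ev a z0 - df a z0 * (z - z0)) + (ev a z0 - ev a z - df a z * (z0 - z)))%C by ring.
    eapply Rle_trans; [apply Cmod_triangle|]. nra.
Qed.

(** * Contractions and perturbed powers *)

Lemma le_geom_nonpos (x c : R) : (forall n, x <= c * (1/2) ^ n) -> x <= 0.
Proof.
  intros H.
  apply (is_lim_seq_le (fun _ => x) (fun n => c * (1/2) ^ n) x 0); [exact H|apply is_lim_seq_const|].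
  replace (Finite 0) with (Rbar_mult c 0) by (simpl; f_equal; ring).
  apply (is_lim_seq_scal_l (fun n => (1/2) ^ n) c 0). apply is_lim_seq_geom. rewrite Rabs_pos_eq; lra.
Qed.

(** Banach iteration from 0. Ratio 1/2 and |Psi 0| <= e/2 keep the iterates in the ball of radius e;
    the limit is the sum of the telescoping series of increments, dominated by a geometric
    series. *)
Lemma fixed_point (Psi : C -> C) (e : R) : 0 <= e ->
  (forall y y', Cmod y <= e -> Cmod y' <= e ->
     Cmod (Psi y - Psi y') <= 1/2 * Cmod (y - y')) ->
  Cmod (Psi 0) <= e / 2 ->
  exists y, Cmod y <= e /\ Psi y = y.
Proof.
  intros He Hc H0.
  set (y := fun n => Nat.iter n Psi (RtoC 0)).
  assert (Z : Cmod 0 <= e) by (rewrite Cmod_0; lra).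
  assert (By : forall n, Cmod (y n) <= e).
  { induction n as [|n IH]; [exact Z|].
    change (Cmod (Psi (y n)) <= e).
    replace (Psi (y n)) with (Psi (y n) - Psi 0 + Psi 0)%C by ring.
    eapply Rle_trans; [apply Cmod_triangle|].
    assert (Hh := Hc (y n) 0 IH Z). replace (y n - 0)%C with (y n) in Hh by ring. lra. }
  set (u := fun k => (y (S k) - y k)%C).
  assert (Bu : forall k, Cmod (u k) <= e / 2 * (1/2) ^ k).
  { induction k as [|k IH].
    - unfold u, y; simpl. replace (Psi 0 - 0)%C with (Psi 0) by ring. lra.
    - assert (Hh := Hc (y (S k)) (y k) (By _) (By _)).
      change (Cmod (u (S k)) <= 1/2 * Cmod (u k)) in Hh. simpl. lra. }
  assert (T : forall n, exists s, csum (fun k => u (n + k)%nat) s /\ Cmod s <= e * (1/2) ^ n).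
  { intros n. apply csum_dominated with (fun k => e / 2 * (1/2) ^ n * (1/2) ^ k).
    - intros k. rewrite Rmult_assoc, <- pow_add. apply Bu.
    - replace (e * (1/2) ^ n) with (e / 2 * (1/2) ^ n * / (1 - 1/2)) by field.
      apply (is_series_scal (e / 2 * (1/2) ^ n) (fun k => (1/2) ^ k)).
      apply is_series_geom. rewrite Rabs_pos_eq; lra. }
  destruct (T O) as [s [Hs Bs]]. simpl in Bs.
  assert (Tail : forall n, csum (fun k => u (n + k)%nat) (s - y n)%C).
  { induction n as [|n IH].
    - replace (s - y 0%nat)%C with s by (unfold y; simpl; ring). exact Hs.
    - destruct (T (S n)) as [t [Ht _]].
      assert (E : (s - y n = u (n + 0)%nat + t)%C).
      { apply csum_unique with (1 := IH). apply (csum_decr (fun k => u (n + k)%nat)).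
        eapply csum_ext; [|exact Ht]. intros k; simpl; f_equal; lia. }
      replace (s - y (S n))%C with t; [exact Ht|].
      rewrite Nat.add_0_r in E. unfold u in E.
      transitivity ((y (S n) - y n + t) - (y (S n) - y n))%C; [ring|]. rewrite <- E. ring. }
  assert (Bs' : Cmod s <= e) by lra.
  exists s. split; [exact Bs'|].
  assert (D : Cmod (Psi s - s) <= 0).
  { apply le_geom_nonpos with e. intros n.
    assert (Dn : forall n, Cmod (s - y n) <= e * (1/2) ^ n).
    { intros k. destruct (T k) as [t [Ht Bt]]. now rewrite (csum_unique _ _ _ (Tail k) Ht). }
    replace (Psi s - s)%C with ((Psi s - Psi (y n)) + - (s - y (S n)))%C
      by (change (y (S n)) with (Psi (y n)); ring).
    eapply Rle_trans; [apply Cmod_triangle|]. rewrite Cmod_opp.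
    assert (H1 := Hc s (y n) Bs' (By n)).
    assert (H2 := Dn n). assert (H3 := Dn (S n)).
    rewrite <- tech_pow_Rmult in H3. lra. }
  assert (E : (Psi s - s)%C = 0%C).
  { apply Cmod_eq_0. generalize (Cmod_ge_0 (Psi s - s)); lra. }
  replace (Psi s) with (s + (Psi s - s))%C by ring. rewrite E. ring.
Qed.

Lemma Cmod_1_plus (y : C) (e : R) : Cmod y <= e -> Cmod (1 + y) <= 1 + e.
Proof. intros H. eapply Rle_trans; [apply Cmod_triangle|]. rewrite Cmod_1. lra. Qed.

Lemma pow_1_plus_bound (m : nat) : exists B, 0 <= B /\ forall y e,
  Cmod y <= e -> e <= 1 -> Cmod ((1 + y) ^ m) <= 2 ^ m /\ Cmod ((1 + y) ^ m - 1) <= B * e.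
Proof.
  induction m as [|m [B [HB IH]]].
  - exists 0. split; [lra|]. intros y e Hy He. simpl. rewrite Cmod_1.
    replace (1 - 1)%C with (RtoC 0) by ring. rewrite Cmod_0. lra.
  - exists (2 * B + 1). split; [lra|]. intros y e Hy He.
    destruct (IH y e Hy He) as [H1 H2].
    assert (H3 := Cmod_1_plus _ _ Hy).
    assert (0 <= e) by (generalize (Cmod_ge_0 y); lra).
    assert (P := Cmod_ge_0 (1 + y)). split.
    + rewrite Cpow_S, Cmod_mult. simpl.
      apply Rmult_le_compat; try apply Cmod_ge_0; [lra|exact H1].
    + replace ((1 + y) ^ S m - 1)%C with ((1 + y) * ((1 + y) ^ m - 1) + y)%C by (rewrite Cpow_S; ring).
      eapply Rle_trans; [apply Cmod_triangle|]. rewrite Cmod_mult.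
      assert (Cmod (1 + y) * Cmod ((1 + y) ^ m - 1) <= 2 * (B * e)); [|lra].
      apply Rmult_le_compat; try apply Cmod_ge_0; [lra|exact H2].
Qed.

(** On the ball of radius e the map (1 + y)^m - m y has Lipschitz constant O(e); this is what makes
    the Newton map below contract. *)
Lemma pow_1_plus_lin (m : nat) : exists B, 0 <= B /\ forall y y' e,
  Cmod y <= e -> Cmod y' <= e -> e <= 1 ->
  Cmod ((1 + y) ^ m - (1 + y') ^ m - INR m * (y - y')) <= B * e * Cmod (y - y').
Proof.
  induction m as [|m [B [HB IH]]].
  - exists 0. split; [lra|]. intros y y' e _ _ _. simpl.
    replace (1 - 1 - 0 * (y - y'))%C with (RtoC 0) by ring. rewrite Cmod_0. lra.
  - destruct (pow_1_plus_bound m) as [B' [HB' Q]].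
    exists (2 * B + INR m + B'). split; [generalize (pos_INR m); lra|].
    intros y y' e Hy Hy' He.
    assert (H1 := IH y y' e Hy Hy' He).
    destruct (Q y' e Hy' He) as [_ H2].
    assert (H3 := Cmod_1_plus _ _ Hy).
    assert (0 <= e) by (generalize (Cmod_ge_0 y); lra).
    replace ((1 + y) ^ S m - (1 + y') ^ S m - INR (S m) * (y - y'))%C with
      ((1 + y) * ((1 + y) ^ m - (1 + y') ^ m - INR m * (y - y'))
        + INR m * y * (y - y') + (y - y') * ((1 + y') ^ m - 1))%C
      by (rewrite !Cpow_S, S_INR, RtoC_plus; ring).
    eapply Rle_trans; [apply Cmod_triangle|].
    eapply Rle_trans; [apply Rplus_le_compat_r, Cmod_triangle|].
    rewrite !Cmod_mult, Cmod_R, (Rabs_pos_eq _ (pos_INR m)).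
    set (d := Cmod (y - y')) in *. assert (0 <= d) by apply Cmod_ge_0.
    set (X := Cmod ((1 + y) ^ m - (1 + y') ^ m - INR m * (y - y'))) in *.
    assert (0 <= X) by apply Cmod_ge_0.
    assert (0 <= Cmod (1 + y)) by apply Cmod_ge_0.
    assert (Cmod (1 + y) * X <= 2 * (B * e * d)) by (apply Rmult_le_compat; lra).
    assert (INR m * Cmod y * d <= INR m * e * d).
    { apply Rmult_le_compat_r; [assumption|]. apply Rmult_le_compat_l; [apply pos_INR|assumption]. }
    assert (d * Cmod ((1 + y') ^ m - 1) <= d * (B' * e)) by (apply Rmult_le_compat_l; assumption).
    lra.
Qed.

(** * Analytic injections have non-vanishing derivative *)

(* Substituting z = z0 + s (1 + y) turns (z - z0)^m g(z) = g(z0) s^m into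
   (1 + y)^m (1 + q(y)) = 1 with q small, solved by a simplified Newton iteration. *)
Lemma solve_power_eq (g : C -> C) (z0 : C) (d0 K : R) (m : nat) (e : R) :
  0 < d0 -> 0 <= K ->
  (forall z z', Cmod (z - z0) <= d0 -> Cmod (z' - z0) <= d0 ->
     Cmod (g z - g z') <= K * Cmod (z - z')) ->
  g z0 <> 0%C -> (1 <= m)%nat -> 0 < e ->
  exists d, 0 < d /\ forall s, Cmod s <= d ->
    exists z, Cmod (z - z0 - s) <= e * Cmod s /\
      ((z - z0) ^ m * g z = g z0 * s ^ m)%C.
Proof.
  intros Hd0 HK Hg Hz0 Hm He.
  destruct (pow_1_plus_bound m) as [B1 [HB1 Q1]].
  destruct (pow_1_plus_lin m) as [B2 [HB2 Q2]].
  (* Three demands: accuracy e, the range |y| <= 1 of the power estimates, and a linearization error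
     that contributes at most 1/4 to the contraction ratio. *)
  set (eta := Rmin (Rmin e 1) (/ (4 * (B2 + 1)))).
  assert (Heta : 0 < eta /\ eta <= e /\ eta <= 1 /\ B2 * eta <= 1/4).
  { assert (P : 0 < / (4 * (B2 + 1))) by (apply Rinv_0_lt_compat; lra).
    assert (L : eta <= / (4 * (B2 + 1))) by apply Rmin_r.
    assert (L1 : eta <= Rmin e 1) by apply Rmin_l.
    generalize (Rmin_l e 1) (Rmin_r e 1); intros. repeat split; try lra.
    - unfold eta. repeat apply Rmin_glb_lt; lra.
    - apply Rmult_le_compat_l with (r := B2) in L; [|lra].
      eapply Rle_trans; [exact L|].
      apply Rle_div_l; [lra|]. lra. }
  destruct Heta as [He0 [He1 [He2 He3]]].
  set (gam := g z0) in *.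
  assert (Hgam : 0 < Cmod gam) by now apply Cmod_gt_0.
  set (K' := K / Cmod gam).
  assert (HK' : 0 <= K') by (apply Rdiv_le_0_compat; lra).
  assert (P2 : 1 <= 2 ^ m) by (apply pow_R1_Rle; lra).
  assert (Pm : 1 <= INR m) by (change 1 with (INR 1); now apply le_INR).
  (* Collects the contributions of q: with W |s| <= eta/4 they add at most another 1/4 to the ratio
     and keep |Psi 0| <= eta/2. *)
  set (W := K' * (2 ^ m + 2 * (INR m + 1)) + K' + 1).
  assert (HW : 0 < W) by (unfold W; nra).
  set (d := Rmin (d0 / 2) (eta / (4 * W))).
  assert (Hd : 0 < d).
  { apply Rmin_glb_lt; [lra|]. apply Rdiv_lt_0_compat; lra. }
  assert (HdW : W * d <= eta / 4).
  { assert (L : d <= eta / (4 * W)) by apply Rmin_r.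
    apply Rmult_le_compat_l with (r := W) in L; [|lra].
    replace (W * (eta / (4 * W))) with (eta / 4) in L by (field; lra). exact L. }
  assert (Hd2 : 2 * d <= d0) by (generalize (Rmin_l (d0 / 2) (eta / (4 * W))); fold d; lra).
  exists d. split; [exact Hd|]. intros s Hs. assert (Hs0 := Cmod_ge_0 s).
  set (q := fun y => (g (z0 + s * (1 + y)) / gam - 1)%C).
  assert (near : forall y, Cmod y <= eta -> Cmod (z0 + s * (1 + y) - z0) <= 2 * Cmod s).
  { intros y Hy. replace (z0 + s * (1 + y) - z0)%C with (s * (1 + y))%C by ring.
    rewrite Cmod_mult. assert (H := Cmod_1_plus _ _ Hy). nra. }
  assert (qlip : forall y y', Cmod y <= eta -> Cmod y' <= eta ->
            Cmod (q y - q y') <= K' * Cmod s * Cmod (y - y')).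
  { intros y y' Hy Hy'. unfold q.
    replace (g (z0 + s * (1 + y)) / gam - 1 - (g (z0 + s * (1 + y')) / gam - 1))%C
      with ((g (z0 + s * (1 + y)) - g (z0 + s * (1 + y'))) / gam)%C by (field; assumption).
    rewrite Cmod_div by assumption. unfold K', Rdiv.
    assert (H := Hg (z0 + s * (1 + y))%C (z0 + s * (1 + y'))%C).
    replace (z0 + s * (1 + y) - (z0 + s * (1 + y')))%C with (s * (y - y'))%C in H by ring.
    rewrite Cmod_mult in H.
    assert (N1 := near y Hy). assert (N2 := near y' Hy').
    apply Rmult_le_reg_r with (1 := Hgam). field_simplify; [|lra|lra]. rewrite (Rmult_assoc K). apply H; lra. }
  assert (qbd : forall y, Cmod y <= eta -> Cmod (q y) <= K' * (2 * Cmod s)).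
  { intros y Hy. unfold q.
    replace (g (z0 + s * (1 + y)) / gam - 1)%C with ((g (z0 + s * (1 + y)) - g z0) / gam)%C
      by (fold gam; field; assumption).
    rewrite Cmod_div by assumption. assert (N := near y Hy).
    assert (H := Hg (z0 + s * (1 + y))%C z0 ltac:(lra)).
    replace (z0 - z0)%C with (RtoC 0) in H by ring. rewrite Cmod_0 in H.
    specialize (H ltac:(lra)).
    unfold K'. apply Rle_div_l; [lra|].
    replace (K / Cmod gam * (2 * Cmod s) * Cmod gam) with (K * (2 * Cmod s)) by (field; lra).
    eapply Rle_trans; [exact H|]. apply Rmult_le_compat_l; lra. }
  assert (Cm : RtoC (INR m) <> 0%C) by (intro E; injection E; lra).
  (* Newton step with the derivative frozen at m, its value at y = 0 for q = 0. *)
  set (Psi := fun y => (y - ((1 + y) ^ m * (1 + q y) - 1) / INR m)%C).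
  assert (Ks : 0 <= K' * Cmod s) by now apply Rmult_le_pos.
  assert (KsW : K' * Cmod s * (2 ^ m + 2 * (INR m + 1)) <= 1/4 /\ K' * Cmod s <= eta / 4).
  { assert (W * Cmod s <= eta / 4) by (eapply Rle_trans; [|exact HdW]; apply Rmult_le_compat_l; lra).
    unfold W in H.
    assert (0 <= K' * Cmod s * (2 ^ m + 2 * (INR m + 1))) by (apply Rmult_le_pos; lra).
    split; lra. }
  destruct (fixed_point Psi eta) as [y [Hy Fy]].
  - lra.
  - intros y y' Hy Hy'. unfold Psi.
    set (D := ((1 + y) ^ m - (1 + y') ^ m - INR m * (y - y'))%C).
    assert (HD : Cmod D <= B2 * eta * Cmod (y - y')) by (now apply Q2).
    assert (Hp : Cmod ((1 + y) ^ m) <= 2 ^ m) by (apply (Q1 y eta); assumption).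
    replace (y - ((1 + y) ^ m * (1 + q y) - 1) / INR m -
       (y' - ((1 + y') ^ m * (1 + q y') - 1) / INR m))%C with
      (- ((D + (1 + y) ^ m * (q y - q y') + (D + INR m * (y - y')) * q y') / INR m))%C
      by (unfold D; field; assumption).
    rewrite Cmod_opp, Cmod_div by assumption. rewrite Cmod_R, Rabs_pos_eq by lra.
    apply Rle_div_l; [lra|].
    set (dd := Cmod (y - y')) in *. assert (Hdd : 0 <= dd) by apply Cmod_ge_0.
    assert (A1 : Cmod D <= 1/4 * dd).
    { eapply Rle_trans; [exact HD|]. apply Rmult_le_compat_r; lra. }
    assert (A2 : Cmod ((1 + y) ^ m * (q y - q y')) <= 2 ^ m * (K' * Cmod s * dd)).
    { rewrite Cmod_mult. apply Rmult_le_compat; try apply Cmod_ge_0; [exact Hp|]. now apply qlip. }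
    assert (A3 : Cmod ((D + INR m * (y - y')) * q y') <= ((INR m + 1) * dd) * (K' * (2 * Cmod s))).
    { rewrite Cmod_mult. apply Rmult_le_compat; try apply Cmod_ge_0; [|now apply qbd].
      eapply Rle_trans; [apply Cmod_triangle|]. rewrite Cmod_mult, Cmod_R, Rabs_pos_eq by lra.
      fold dd. lra. }
    eapply Rle_trans; [apply Cmod_triangle|].
    eapply Rle_trans; [apply Rplus_le_compat_r, Cmod_triangle|].
    assert (K' * Cmod s * (2 ^ m + 2 * (INR m + 1)) * dd <= 1/4 * dd)
      by (apply Rmult_le_compat_r; lra).
    assert (1 * dd <= INR m * dd) by (apply Rmult_le_compat_r; lra).
    lra.
  - unfold Psi. replace (0 - ((1 + 0) ^ m * (1 + q 0) - 1) / INR m)%C with (- (q 0 / INR m))%C.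
    2:{ replace (1 + 0)%C with (RtoC 1) by ring. rewrite Cpow_1_l. field. assumption. }
    rewrite Cmod_opp, Cmod_div by assumption. rewrite Cmod_R, Rabs_pos_eq by lra.
    apply Rle_div_l; [lra|].
    assert (Q0 := qbd 0%C). rewrite Cmod_0 in Q0. specialize (Q0 ltac:(lra)). nra.
  - exists (z0 + s * (1 + y))%C. split.
    + replace (z0 + s * (1 + y) - z0 - s)%C with (s * y)%C by ring.
      rewrite Cmod_mult, Rmult_comm. apply Rmult_le_compat_r; lra.
    + assert (E : ((1 + y) ^ m * (1 + q y))%C = 1%C).
      { unfold Psi in Fy.
        transitivity (1 + INR m * (y - (y - ((1 + y) ^ m * (1 + q y) - 1) / INR m)))%C;
          [field; assumption|]. rewrite Fy. ring. }
      replace (z0 + s * (1 + y) - z0)%C with (s * (1 + y))%C by ring.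
      rewrite Cpow_mult_l.
      transitivity (gam * s ^ m * ((1 + y) ^ m * (1 + q y)))%C.
      * unfold q. field. assumption.
      * rewrite E. ring.
Qed.

Definition cis (t : R) : C := (cos t, sin t).

Lemma cis_plus s t : cis (s + t) = (cis s * cis t)%C.
Proof. apply C_ext; simpl; [apply cos_plus|]. rewrite sin_plus; ring. Qed.

Lemma cis_0 : cis 0 = 1%C.
Proof. unfold cis. now rewrite cos_0, sin_0. Qed.

Lemma cis_pow t n : (cis t ^ n)%C = cis (INR n * t).
Proof.
  induction n as [|n IH].
  - simpl. now rewrite Rmult_0_l, cis_0.
  - rewrite Cpow_S, IH, <- cis_plus, S_INR. f_equal. ring.
Qed.

Lemma Cmod_cis t : Cmod (cis t) = 1.
Proof.
  unfold Cmod, cis; simpl.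
  replace (cos t * (cos t * 1) + sin t * (sin t * 1)) with 1; [apply sqrt_1|].
  generalize (sin2_cos2 t); unfold Rsqr; lra.
Qed.

Lemma root_of_unity (m : nat) : (2 <= m)%nat -> exists zeta : C,
  Cmod zeta = 1 /\ (zeta ^ m = 1)%C /\ zeta <> 1%C.
Proof.
  intros Hm. exists (cis (2 * PI / INR m)).
  assert (H2 : 2 <= INR m) by (change 2 with (INR 2); now apply le_INR).
  split; [apply Cmod_cis|split].
  - rewrite cis_pow. replace (INR m * (2 * PI / INR m)) with (2 * PI) by (field; lra).
    unfold cis. now rewrite cos_2PI, sin_2PI.
  - intros E. apply (f_equal Re) in E. unfold cis, Re in E; simpl in E.
    assert (HP := PI_RGT_0).
    assert (L : cos (2 * PI / INR m) < cos 0).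
    { apply cos_decreasing_1; try lra.
      - apply Rdiv_le_0_compat; lra.
      - apply Rle_div_l; [lra|]. nra.
      - apply Rdiv_lt_0_compat; lra. }
    rewrite cos_0 in L. lra.
Qed.

Definition disk_coeffs (a : nat -> C) : Prop :=
  forall rho, 0 < rho < 1 -> exists M, bnd rho M a.

Definition disk_injective (a : nat -> C) : Prop :=
  forall z z', Cmod z < 1 -> Cmod z' < 1 -> ev a z = ev a z' -> z = z'.

(** Iterated difference quotients at z0; evaluated at z0, the m-th one is the Taylor coefficient
    f^(m)(z0)/m!. *)
Definition divn (z0 : C) (m : nat) (a : nat -> C) := Nat.iter m (dv z0) a.

Lemma bnd_divn rho M a z0 m : bnd rho M a -> Cmod z0 < rho ->
  bnd rho (M / (rho - Cmod z0) ^ m) (divn z0 m a).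
Proof.
  intros H Hz. induction m as [|m IH].
  - simpl. unfold Rdiv. now rewrite Rinv_1, Rmult_1_r.
  - simpl. replace (M / ((rho - Cmod z0) * (rho - Cmod z0) ^ m)) with
      (M / (rho - Cmod z0) ^ m / (rho - Cmod z0)).
    + now apply bnd_dv.
    + field. split; [apply pow_nonzero|]; lra.
Qed.

Lemma ev_factor_iter rho M a z0 z m : bnd rho M a -> Cmod z0 < rho -> Cmod z < rho ->
  (forall j, (1 <= j <= m)%nat -> ev (divn z0 j a) z0 = 0%C) ->
  (ev a z - ev a z0 = (z - z0) ^ (S m) * ev (divn z0 (S m) a) z)%C.
Proof.
  intros H H0 Hz. induction m as [|m IH]; intros Hj.
  - rewrite (ev_factor _ _ _ _ _ H H0 Hz). simpl. ring.
  - rewrite IH by (intros; apply Hj; lia).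
    assert (E := ev_factor _ _ _ _ _ (bnd_divn _ _ _ _ (S m) H H0) H0 Hz).
    rewrite Hj in E by lia.
    replace (ev (divn z0 (S m) a) z) with (ev (divn z0 (S m) a) z - 0)%C by ring.
    rewrite E. rewrite (Cpow_S _ (S m)). change (dv z0 (divn z0 (S m) a)) with (divn z0 (S (S m)) a). ring.
Qed.

(** If f'(z0) = 0, either f - f(z0) = (z - z0)^m g with m >= 2 and g(z0) nonzero, and solving for
    the right-hand sides s^m and (s zeta)^m, with zeta^m = 1, gives two points with the same value;
    or all Taylor coefficients of positive order vanish and f is constant near z0. Both contradict
    injectivity. *)
Lemma df_neq_0 (a : nat -> C) (z0 : C) :
  disk_coeffs a -> disk_injective a -> Cmod z0 < 1 -> df a z0 <> 0%C.
Proof.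
  intros Ha Hinj Hz0 Hdf. assert (Hz00 := Cmod_ge_0 z0).
  set (rho := (1 + Cmod z0) / 2).
  assert (Hrho : Cmod z0 < rho < 1) by (unfold rho; lra).
  destruct (Ha rho) as [M HM]; [lra|].
  set (dl := (rho - Cmod z0) / 2).
  assert (Hdl : 0 < dl) by (unfold dl; lra).
  assert (Hin : forall z, Cmod (z - z0) <= dl -> Cmod z <= Cmod z0 + dl).
  { intros z Hz. replace z with (z0 + (z - z0))%C at 1 by ring.
    eapply Rle_trans; [apply Cmod_triangle|lra]. }
  destruct (classic (exists j, (1 <= j)%nat /\ ev (divn z0 j a) z0 <> 0%C)) as [Hex|Hno].
  - destruct (dec_inh_nat_subset_has_unique_least_element
      (fun j => (1 <= j)%nat /\ ev (divn z0 j a) z0 <> 0%C)) as [m [[[Hm1 Hm2] Hleast] _]].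
    + intros n; apply classic.
    + exact Hex.
    + assert (Hsmall : forall j, (1 <= j < m)%nat -> ev (divn z0 j a) z0 = 0%C).
      { intros j Hj. apply NNPP. intros Hn. specialize (Hleast j (conj (proj1 Hj) Hn)). lia. }
      (* Order 1 is excluded by the vanishing derivative, so a root of unity other than 1 is
         available. *)
      destruct m as [|[|m]]; [lia|now apply Hm2|].
      assert (Hb := bnd_divn _ _ _ _ (S (S m)) HM (proj1 Hrho)).
      destruct (ev_lip rho (Cmod z0 + dl) _ _ Hb) as [K [HK Lip]]; [unfold dl; lra|].
      destruct (root_of_unity (S (S m))) as [zeta [Z1 [Z2 Z3]]]; [lia|].
      assert (Hz1 : 0 < Cmod (1 - zeta)).
      { apply Cmod_gt_0. intros E. apply Z3. transitivity (1 - (1 - zeta))%C; [ring|]. rewrite E; ring. }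
      assert (Hz2 : Cmod (1 - zeta) <= 2).
      { unfold Cminus. eapply Rle_trans; [apply Cmod_triangle|]. rewrite Cmod_opp, Cmod_1, Z1; lra. }
      (* With accuracy |1 - zeta|/4 the two solutions stay closer to z0 + s and z0 + s zeta than
         half the distance s |1 - zeta| between these points, hence differ. *)
      destruct (solve_power_eq (ev (divn z0 (S (S m)) a)) z0 dl K (S (S m)) (Cmod (1 - zeta) / 4))
        as [d [Hd Sol]]; try assumption; try lia; try lra.
      { intros z z' Hz Hz'. apply Lip; now apply Hin. }
      set (s := Rmin d (dl / 2)).
      assert (Hs : 0 < s /\ s <= d /\ s <= dl / 2).
      { split; [apply Rmin_glb_lt; lra|]. split; [apply Rmin_l|apply Rmin_r]. }
      assert (Es : Cmod s = s) by (rewrite Cmod_R; apply Rabs_pos_eq; lra).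
      destruct (Sol s) as [z [Bz Ez]]; [lra|].
      destruct (Sol (s * zeta)%C) as [z' [Bz' Ez']]; [rewrite Cmod_mult, Z1, Es; lra|].
      rewrite Cmod_mult, Z1, Rmult_1_r, Es in Bz'. rewrite Es in Bz.
      rewrite Cpow_mult_l, Z2 in Ez'.
      assert (N : forall x y : C, Cmod (x - z0 - y) <= Cmod (1 - zeta) / 4 * s -> Cmod y = s -> Cmod x < rho).
      { intros x y Hx Hy. assert (Cmod (x - z0) <= dl).
        { replace (x - z0)%C with (x - z0 - y + y)%C by ring.
          eapply Rle_trans; [apply Cmod_triangle|]. nra. }
        apply Hin in H. unfold dl in H. lra. }
      assert (Nz := N z s Bz Es).
      assert (Nz' := N z' (s * zeta)%C Bz' ltac:(rewrite Cmod_mult, Z1, Es; ring)).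
      assert (E : z = z').
      { apply Hinj; try lra.
        assert (F := ev_factor_iter rho M a z0 z (S m) HM (proj1 Hrho) Nz ltac:(intros; apply Hsmall; lia)).
        assert (F' := ev_factor_iter rho M a z0 z' (S m) HM (proj1 Hrho) Nz' ltac:(intros; apply Hsmall; lia)).
        rewrite Ez in F. rewrite Ez' in F'.
        transitivity (ev a z0 + (ev a z - ev a z0))%C; [ring|].
        transitivity (ev a z0 + (ev a z' - ev a z0))%C; [|ring].
        rewrite F, F'. ring. }
      subst z'.
      assert (L : Cmod (s * (1 - zeta)) <= 2 * (Cmod (1 - zeta) / 4 * s)).
      { replace (s * (1 - zeta))%C with ((z - z0 - s * zeta) + - (z - z0 - s))%C by ring.
        eapply Rle_trans; [apply Cmod_triangle|]. rewrite Cmod_opp. lra. }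
      rewrite Cmod_mult, Es in L. nra.
  - assert (Hall : forall j, (1 <= j)%nat -> ev (divn z0 j a) z0 = 0%C).
    { intros j Hj. apply NNPP. intros Hn. apply Hno. now exists j. }
    (* A quarter of the available distance: factoring n + 1 times leaves a difference of order
       4^-(n+1), so f(z0 + s) = f(z0). *)
    set (s := (rho - Cmod z0) / 4).
    assert (Hs : 0 < s) by (unfold s; lra).
    assert (Es : Cmod s = s) by (rewrite Cmod_R; apply Rabs_pos_eq; lra).
    assert (Nz : Cmod (z0 + s) <= Cmod z0 + s).
    { eapply Rle_trans; [apply Cmod_triangle|]. rewrite Es; lra. }
    assert (E : (z0 + s)%C = z0).
    { apply Hinj; try (unfold s in *; lra).
      assert (D : Cmod (ev a (z0 + s) - ev a z0) <= 0).
      { apply le_geom_nonpos with (M * rho / (rho - (Cmod z0 + s))). intros n.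
        assert (HMn := bnd_nonneg _ _ _ HM).
        rewrite (ev_factor_iter rho M a z0 (z0 + s)%C n HM) by
          (try (unfold s in *; lra); intros; apply Hall; lia).
        assert (B := ev_bound_unif rho (Cmod z0 + s) _ _ (z0 + s)%C (bnd_divn _ _ _ _ (S n) HM (proj1 Hrho))
          ltac:(unfold s in *; lra) Nz).
        replace (z0 + s - z0)%C with (RtoC s) by ring.
        rewrite Cmod_mult, Cmod_pow, Es.
        assert (Q : s ^ S n / (rho - Cmod z0) ^ S n <= (1/2) ^ n).
        { replace (s ^ S n / (rho - Cmod z0) ^ S n) with ((1/4) ^ S n).
          - apply Rle_trans with ((1/4) ^ n).
            + simpl. assert (0 <= (1/4)^n) by (apply pow_le; lra). lra.
            + apply pow_incr; lra.
          - unfold Rdiv. rewrite <- pow_inv, <- Rpow_mult_distr. f_equal. unfold s. field. lra. }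
        assert (0 < (rho - Cmod z0) ^ S n) by (apply pow_lt; lra).
        apply Rle_trans with (s ^ S n * (M / (rho - Cmod z0) ^ S n * rho / (rho - (Cmod z0 + s)))).
        - apply Rmult_le_compat_l; [apply pow_le; lra|exact B].
        - replace (s ^ S n * (M / (rho - Cmod z0) ^ S n * rho / (rho - (Cmod z0 + s))))
            with (M * rho / (rho - (Cmod z0 + s)) * (s ^ S n / (rho - Cmod z0) ^ S n))
            by (field; unfold s in *; lra).
          apply Rmult_le_compat_l; [|exact Q].
          apply Rdiv_le_0_compat; [apply Rmult_le_pos; lra|unfold s; lra]. }
      assert (E0 : (ev a (z0 + s) - ev a z0)%C = 0%C).
      { apply Cmod_eq_0. generalize (Cmod_ge_0 (ev a (z0 + s) - ev a z0)); lra. }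
      transitivity (ev a z0 + (ev a (z0 + s) - ev a z0))%C; [ring|]. rewrite E0; ring. }
    assert (E' : RtoC s = 0%C) by (transitivity (z0 + s - z0)%C; [ring|rewrite E; ring]).
    injection E'; lra.
Qed.

(** * Calculus along circles *)

(** Complex differentiability in explicit form. Together with a derivative that is [ccont], it is
    the form of analyticity on which the circle averages rest. *)
Definition cder (F : C -> C) (z D : C) : Prop :=
  forall e, 0 < e -> exists d, 0 < d /\ forall z', Cmod (z' - z) <= d ->
    Cmod (F z' - F z - D * (z' - z)) <= e * Cmod (z' - z).

Definition ccont (F : C -> C) (z : C) : Prop :=
  forall e, 0 < e -> exists d, 0 < d /\ forall z', Cmod (z' - z) <= d ->
    Cmod (F z' - F z) <= e.

Lemma cder_ccont F z D : cder F z D -> ccont F z.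
Proof.
  intros H e He. destruct (H 1 Rlt_0_1) as [d [Hd Hz]].
  assert (HD := Cmod_ge_0 D).
  exists (Rmin d (e / (1 + Cmod D))). split.
  - apply Rmin_glb_lt; [lra|]. apply Rdiv_lt_0_compat; lra.
  - intros z' Hz'.
    assert (L1 := Rle_trans _ _ _ Hz' (Rmin_l _ _)).
    assert (L2 := Rle_trans _ _ _ Hz' (Rmin_r _ _)).
    specialize (Hz z' L1).
    replace (F z' - F z)%C with ((F z' - F z - D * (z' - z)) + D * (z' - z))%C by ring.
    eapply Rle_trans; [apply Cmod_triangle|]. rewrite Cmod_mult.
    apply Rle_div_r in L2; [|lra]. lra.
Qed.

Definition rder (G : R -> C) (t : R) (D : C) : Prop :=
  is_derive (fun s => Re (G s)) t (Re D) /\ is_derive (fun s => Im (G s)) t (Im D).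

Lemma is_derive_Rmult (f g : R -> R) (x a b : R) :
  is_derive f x a -> is_derive g x b -> is_derive (fun t => f t * g t) x (a * g x + f x * b).
Proof. intros H1 H2. exact (is_derive_mult f g x a b H1 H2 Rmult_comm). Qed.

Lemma rder_mult G H t D E : rder G t D -> rder H t E ->
  rder (fun s => G s * H s)%C t (D * H t + G t * E)%C.
Proof.
  intros [G1 G2] [H1 H2]; split; simpl.
  - evar_last.
    + exact (is_derive_minus _ _ _ _ _ (is_derive_Rmult _ _ _ _ _ G1 H1)
        (is_derive_Rmult _ _ _ _ _ G2 H2)).
    + unfold minus, plus, opp; simpl; unfold Re, Im; ring.
  - evar_last.
    + exact (is_derive_plus _ _ _ _ _ (is_derive_Rmult _ _ _ _ _ G1 H2)
        (is_derive_Rmult _ _ _ _ _ G2 H1)).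
    + unfold minus, plus, opp; simpl; unfold Re, Im; ring.
Qed.

Lemma rder_const c t : rder (fun _ => c) t 0%C.
Proof. split; exact (is_derive_const _ _). Qed.

Lemma rder_ext G H t D : (forall s, G s = H s) -> rder G t D -> rder H t D.
Proof.
  intros E [H1 H2]; split; [eapply is_derive_ext; [|exact H1]|eapply is_derive_ext; [|exact H2]];
    intros; simpl; now rewrite E.
Qed.

Lemma rder_cis (k t : R) : rder (fun s => cis (k * s)) t (k * Ci * cis (k * t))%C.
Proof. split; simpl; auto_derive; auto; ring. Qed.

Lemma rder_id t : rder RtoC t 1%C.
Proof. split; simpl; [exact (is_derive_id _)|exact (is_derive_const _ _)]. Qed.

Lemma Cmod_le_abs (z : C) : Cmod z <= Rabs (Re z) + Rabs (Im z).
Proof.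
  replace z with (RtoC (Re z) + Ci * RtoC (Im z))%C.
  - eapply Rle_trans; [apply Cmod_triangle|].
    rewrite Cmod_mult, Cmod_Ci, !Cmod_R. simpl.
    rewrite !Rmult_0_l, !Rmult_0_r, !Rmult_1_l. right; f_equal; f_equal; ring.
  - apply C_ext; simpl; ring.
Qed.

Lemma derive_bound (f : R -> R) t l : is_derive f t l ->
  forall e, 0 < e -> exists d, 0 < d /\ forall h, Rabs h <= d ->
    Rabs (f (t + h) - f t - l * h) <= e * Rabs h.
Proof.
  intros H e He. apply is_derive_Reals in H. destruct (H e He) as [d Hd].
  assert (P := cond_pos d).
  exists (d / 2). split; [lra|]. intros h Hh.
  destruct (Req_dec h 0) as [->|N].
  - rewrite Rplus_0_r. replace (f t - f t - l * 0) with 0 by ring. rewrite Rabs_R0; lra.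
  - assert (Q := Hd h N ltac:(lra)).
    replace (f (t + h) - f t - l * h) with (((f (t + h) - f t) / h - l) * h) by (field; exact N).
    rewrite Rabs_mult. apply Rmult_le_compat_r; [apply Rabs_pos|lra].
Qed.

Lemma bound_derive (f : R -> R) t l :
  (forall e, 0 < e -> exists d, 0 < d /\ forall h, Rabs h <= d ->
    Rabs (f (t + h) - f t - l * h) <= e * Rabs h) -> is_derive f t l.
Proof.
  intros H. apply is_derive_Reals. intros e He.
  destruct (H (e / 2)) as [d [Hd Q]]; [lra|].
  exists (mkposreal d Hd). intros h N Hh. simpl in Hh.
  specialize (Q h ltac:(lra)).
  replace ((f (t + h) - f t) / h - l) with ((f (t + h) - f t - l * h) / h) by (field; exact N).
  rewrite Rabs_div by exact N. assert (0 < Rabs h) by now apply Rabs_pos_lt.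
  apply Rlt_div_l; [assumption|]. nra.
Qed.

Lemma rder_bound G t D : rder G t D <->
  forall e, 0 < e -> exists d, 0 < d /\ forall h : R, Rabs h <= d ->
    Cmod (G (t + h)%R - G t - D * h) <= e * Rabs h.
Proof.
  split.
  - intros [H1 H2] e He.
    destruct (derive_bound _ _ _ H1 (e / 2)) as [d1 [P1 Q1]]; [lra|].
    destruct (derive_bound _ _ _ H2 (e / 2)) as [d2 [P2 Q2]]; [lra|].
    exists (Rmin d1 d2). split; [now apply Rmin_glb_lt|]. intros h Hh.
    specialize (Q1 h (Rle_trans _ _ _ Hh (Rmin_l _ _))).
    specialize (Q2 h (Rle_trans _ _ _ Hh (Rmin_r _ _))).
    eapply Rle_trans; [apply Cmod_le_abs|].
    replace (Re (G (t + h)%R - G t - D * h)) with (Re (G (t + h)) - Re (G t) - Re D * h)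
      by (simpl; unfold Re, Im; ring).
    replace (Im (G (t + h)%R - G t - D * h)) with (Im (G (t + h)) - Im (G t) - Im D * h)
      by (simpl; unfold Re, Im; ring).
    lra.
  - intros H; split; apply bound_derive; intros e He; destruct (H e He) as [d [Hd Q]];
      exists d; split; auto; intros h Hh; (eapply Rle_trans; [|now apply Q]).
    + replace (Re (G (t + h)) - Re (G t) - Re D * h) with (Re (G (t + h)%R - G t - D * h))
        by (simpl; unfold Re, Im; ring). apply re_le_Cmod.
    + replace (Im (G (t + h)) - Im (G t) - Im D * h) with (Im (G (t + h)%R - G t - D * h))
        by (simpl; unfold Re, Im; ring). apply Im_le_Cmod.
Qed.

Lemma rder_comp F G t D E : cder F (G t) D -> rder G t E ->
  rder (fun s => F (G s)) t (D * E)%C.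
Proof.
  intros HF HG. apply rder_bound. intros e He.
  rewrite rder_bound in HG.
  assert (HD := Cmod_ge_0 D). assert (HE := Cmod_ge_0 E).
  set (e1 := e / (2 * (1 + Cmod D))).
  set (e2 := e / (2 * (Cmod E + 1))).
  assert (He1 : 0 < e1) by (apply Rdiv_lt_0_compat; lra).
  assert (He2 : 0 < e2) by (apply Rdiv_lt_0_compat; lra).
  destruct (HG _ He1) as [d1 [P1 Q1]].
  destruct (HG _ Rlt_0_1) as [d2 [P2 Q2]].
  destruct (HF _ He2) as [d3 [P3 Q3]].
  set (d4 := d3 / (Cmod E + 1)).
  assert (P4 : 0 < d4) by (apply Rdiv_lt_0_compat; lra).
  exists (Rmin d1 (Rmin d2 d4)). split; [repeat apply Rmin_glb_lt; assumption|].
  intros h Hh.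
  assert (L1 := Rle_trans _ _ _ Hh (Rmin_l _ _)).
  assert (L := Rle_trans _ _ _ Hh (Rmin_r _ _)).
  assert (L2 := Rle_trans _ _ _ L (Rmin_l _ _)).
  assert (L4 := Rle_trans _ _ _ L (Rmin_r _ _)).
  specialize (Q1 h L1). specialize (Q2 h L2).
  assert (Hhp := Rabs_pos h).
  assert (B : Cmod (G (t + h)%R - G t) <= (Cmod E + 1) * Rabs h).
  { replace (G (t + h)%R - G t)%C with ((G (t + h)%R - G t - E * h) + E * h)%C by ring.
    eapply Rle_trans; [apply Cmod_triangle|]. rewrite Cmod_mult, Cmod_R. lra. }
  assert (B3 : Cmod (G (t + h)%R - G t) <= d3).
  { eapply Rle_trans; [exact B|]. unfold d4 in L4. apply Rle_div_r in L4; lra. }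
  specialize (Q3 _ B3).
  replace (F (G (t + h)%R) - F (G t) - D * E * h)%C with
    ((F (G (t + h)%R) - F (G t) - D * (G (t + h)%R - G t)) + D * (G (t + h)%R - G t - E * h))%C by ring.
  eapply Rle_trans; [apply Cmod_triangle|]. rewrite (Cmod_mult D).
  assert (X1 : e2 * Cmod (G (t + h)%R - G t) <= e / 2 * Rabs h).
  { apply Rle_trans with (e2 * ((Cmod E + 1) * Rabs h)); [apply Rmult_le_compat_l; lra|].
    right. unfold e2. field. lra. }
  assert (X2 : Cmod D * Cmod (G (t + h)%R - G t - E * h) <= e / 2 * Rabs h).
  { apply Rle_trans with ((1 + Cmod D) * (e1 * Rabs h)).
    - apply Rmult_le_compat; try apply Cmod_ge_0; lra.
    - right. unfold e1. field. lra. }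
  lra.
Qed.

(** Joint continuity in radius and angle, as required for differentiating an integral with respect
    to the radius. *)
Definition c2d (G : R -> R -> C) (x y : R) : Prop :=
  continuity_2d_pt (fun u v => Re (G u v)) x y /\ continuity_2d_pt (fun u v => Im (G u v)) x y.

Lemma c2d_mult G H x y : c2d G x y -> c2d H x y -> c2d (fun u v => G u v * H u v)%C x y.
Proof.
  intros [G1 G2] [H1 H2]; split; simpl.
  - apply continuity_2d_pt_minus; apply continuity_2d_pt_mult; assumption.
  - apply continuity_2d_pt_plus; apply continuity_2d_pt_mult; assumption.
Qed.

Lemma c2d_const c x y : c2d (fun _ _ => c) x y.
Proof. split; apply continuity_2d_pt_const. Qed.

Lemma c2d_cis k x y : c2d (fun _ v => cis (k * v)) x y.
Proof.
  split; simpl.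
  - apply (continuity_1d_2d_pt_comp (fun s => cos (k * s)) (fun _ v => v)); [|apply continuity_2d_pt_id2].
    reg.
  - apply (continuity_1d_2d_pt_comp (fun s => sin (k * s)) (fun _ v => v)); [|apply continuity_2d_pt_id2].
    reg.
Qed.

Lemma c2d_RtoC x y : c2d (fun u _ => RtoC u) x y.
Proof. split; simpl; [apply continuity_2d_pt_id1|apply continuity_2d_pt_const]. Qed.

Lemma c2d_comp F G x y : ccont F (G x y) -> c2d G x y -> c2d (fun u v => F (G u v)) x y.
Proof.
  intros HF [G1 G2].
  assert (K : forall e, 0 < e -> locally_2d (fun u v => Cmod (F (G u v) - F (G x y)) < e) x y).
  { intros e He. destruct (HF (e / 2)) as [d [Hd Q]]; [lra|].
    assert (Hd2 : 0 < d / 2) by lra.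
    apply (fun H => locally_2d_impl _ _ _ _ H (locally_2d_and _ _ _ _ (G1 (mkposreal _ Hd2)) (G2 (mkposreal _ Hd2)))).
    apply locally_2d_forall. intros u v [A B]. simpl in A, B.
    apply Rle_lt_trans with (e / 2); [|lra]. apply Q.
    eapply Rle_trans; [apply Cmod_le_abs|].
    replace (Re (G u v - G x y)) with (Re (G u v) - Re (G x y)) by reflexivity.
    replace (Im (G u v - G x y)) with (Im (G u v) - Im (G x y)) by reflexivity. lra. }
  split; intros e; apply (fun H => locally_2d_impl _ _ _ _ H (K e (cond_pos e))); apply locally_2d_forall;
    intros u v A; (eapply Rle_lt_trans; [|exact A]).
  - replace (Re (F (G u v)) - Re (F (G x y))) with (Re (F (G u v) - F (G x y))) by reflexivity.
    apply re_le_Cmod.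
  - replace (Im (F (G u v)) - Im (F (G x y))) with (Im (F (G u v) - F (G x y))) by reflexivity.
    apply Im_le_Cmod.
Qed.

Lemma continuity_2d_1d f x y : continuity_2d_pt f x y -> continuous (fun v => f x v) y.
Proof.
  intros H. apply continuity_pt_filterlim. intros e He.
  destruct (H (mkposreal e He)) as [d Hd].
  exists d. split; [apply cond_pos|]. intros v [_ Hv]. apply Hd.
  - unfold Rminus; rewrite Rplus_opp_r, Rabs_R0; apply cond_pos.
  - exact Hv.
Qed.

(** Real part of 2 pi c times the Fourier coefficient of frequency j of [om] on |z| = r. The factor
    c gives access to both components, and a real j covers negative frequencies. *)
Definition circ (om : C -> C) (c : C) (j r : R) : R :=
  RInt (fun t => Re (c * om (r * cis t) * cis (- j * t))%C) 0 (2 * PI).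

Lemma Cmod_rcis (r t : R) : Cmod (r * cis t) = Rabs r.
Proof. now rewrite Cmod_mult, Cmod_cis, Cmod_R, Rmult_1_r. Qed.

Lemma cis_eq t : cis (1 * t) = cis t.
Proof. now rewrite Rmult_1_l. Qed.

Section Circle.
Variables (om dom : C -> C).
Hypothesis Hom : forall z, Cmod z < 1 -> cder om z (dom z).
Hypothesis Hdom : forall z, Cmod z < 1 -> ccont dom z.

Lemma rder_ray c (j r t : R) : Rabs r < 1 ->
  rder (fun u => c * om (u * cis t) * cis (- j * t))%C r
       (c * (dom (r * cis t) * cis t) * cis (- j * t))%C.
Proof.
  intros Hr.
  assert (G : rder (fun u => u * cis t)%C r (cis t)).
  { eapply (eq_rect _ (rder _ r)); [apply (rder_mult _ _ _ _ _ (rder_id r) (rder_const (cis t) r))|]. ring. }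
  assert (O := rder_comp om _ r _ _ (Hom (r * cis t)%C ltac:(rewrite Cmod_rcis; exact Hr)) G).
  eapply (eq_rect _ (rder _ r));
    [apply (rder_mult _ _ _ _ _ (rder_mult _ _ _ _ _ (rder_const c r) O) (rder_const (cis (- j * t)) r))|].
  simpl. ring.
Qed.

(** Cauchy-Riemann in polar form: -i times the angular derivative of the integrand is r times its
    radial derivative ([rder_ray]) minus j times the integrand. *)
Lemma rder_angle c (j r t : R) : Rabs r < 1 ->
  rder (fun s => - Ci * c * om (r * cis s) * cis (- j * s))%C t
       (r * (c * (dom (r * cis t) * cis t) * cis (- j * t))
         - j * (c * om (r * cis t) * cis (- j * t)))%C.
Proof.
  intros Hr.
  assert (G : rder (fun s => r * cis s)%C t (r * (Ci * cis t))%C).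
  { apply rder_ext with (fun s => r * cis (1 * s))%C; [intros; now rewrite cis_eq|].
    eapply (eq_rect _ (rder _ t)); [apply (rder_mult _ _ _ _ _ (rder_const r t) (rder_cis 1 t))|].
    rewrite cis_eq. ring. }
  assert (O := rder_comp om _ t _ _ (Hom (r * cis t)%C ltac:(rewrite Cmod_rcis; exact Hr)) G).
  eapply (eq_rect _ (rder _ t));
    [apply (rder_mult _ _ _ _ _ (rder_mult _ _ _ _ _ (rder_const (- Ci * c)%C t) O) (rder_cis (- j) t))|].
  simpl. rewrite RtoC_opp.
  transitivity (- (Ci * Ci) * (r * (c * (dom (r * cis t) * cis t) * cis (- j * t))
         - j * (c * om (r * cis t) * cis (- j * t))))%C; [ring|].
  replace (Ci * Ci)%C with (- (1))%C; [ring|]. apply C_ext; simpl; ring.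
Qed.

Lemma c2d_ray (F : C -> C) c (j r t : R) : ccont F (r * cis t)%C ->
  c2d (fun u v => c * F (u * cis v) * cis (- j * v))%C r t.
Proof.
  intros HF. apply c2d_mult; [|apply c2d_cis].
  apply c2d_mult; [apply c2d_const|].
  apply (c2d_comp F (fun u v => u * cis v)%C); [exact HF|].
  apply c2d_mult; [apply c2d_RtoC|].
  destruct (c2d_cis 1 r t) as [H1 H2]; split;
    [eapply continuity_2d_pt_ext; [|exact H1]|eapply continuity_2d_pt_ext; [|exact H2]];
    intros; simpl; now rewrite Rmult_1_l.
Qed.

Lemma c2d_ray_deriv c (j r t : R) : Rabs r < 1 ->
  c2d (fun u v => c * (dom (u * cis v) * cis v) * cis (- j * v))%C r t.
Proof.
  intros Hr.
  (* The extra factor e^{iv} is absorbed by lowering the frequency to j - 1. *)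
  assert (H := c2d_ray dom c (j - 1) r t (Hdom _ ltac:(rewrite Cmod_rcis; exact Hr))).
  destruct H as [H1 H2].
  assert (E : forall u v : R, (c * dom (u * cis v) * cis (- (j - 1) * v)
     = c * (dom (u * cis v) * cis v) * cis (- j * v))%C).
  { intros u v. replace (- (j - 1) * v) with (v + - j * v) by ring. rewrite cis_plus. ring. }
  split; [eapply continuity_2d_pt_ext; [|exact H1]|eapply continuity_2d_pt_ext; [|exact H2]].
  - intros u v; exact (f_equal Re (E u v)).
  - intros u v; exact (f_equal Im (E u v)).
Qed.

Lemma circ_integrable c (j r : R) : Rabs r < 1 ->
  ex_RInt (fun t => Re (c * om (r * cis t) * cis (- j * t))%C) 0 (2 * PI).
Proof.
  intros Hr. apply (ex_RInt_continuous (V := R_CompleteNormedModule)). intros t _.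
  apply (continuity_2d_1d (fun u v => Re (c * om (u * cis v) * cis (- j * v))%C)).
  apply c2d_ray. eapply cder_ccont. apply Hom. now rewrite Cmod_rcis.
Qed.

(** Integrating the polar Cauchy-Riemann relation over a period kills the angular derivative. What
    remains is r C'(r) = j C(r), which takes the role of Cauchy's theorem. *)
Lemma circ_derive c j r : cis (- j * (2 * PI)) = 1%C -> 0 < r < 1 ->
  is_derive (fun u => circ om c j u) r (j / r * circ om c j r).
Proof.
  intros Hj Hr.
  set (U := fun u v : R => Re (c * om (u * cis v) * cis (- j * v))%C).
  set (V := fun u v : R => Re (c * (dom (u * cis v) * cis v) * cis (- j * v))%C).
  assert (HUV : forall u v : R, Rabs u < 1 -> is_derive (fun s => U s v) u (V u v)).
  { intros u v Hu. exact (proj1 (rder_ray c j u v Hu)). }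
  assert (Hr' : Rabs r < 1) by (rewrite Rabs_pos_eq; lra).
  assert (Loc : locally r (fun u => Rabs u < 1)).
  { assert (P : 0 < Rmin r (1 - r)) by (apply Rmin_glb_lt; lra).
    exists (mkposreal _ P). intros u Hu. unfold ball in Hu; simpl in Hu.
    unfold AbsRing_ball, abs, minus, plus, opp in Hu; simpl in Hu.
    generalize (Rmin_l r (1 - r)) (Rmin_r r (1 - r)).
    apply Rabs_def2 in Hu. intros. apply Rabs_def1; lra. }
  assert (HV : forall t, continuous (fun v => V r v) t).
  { intros t. apply (continuity_2d_1d V). apply (c2d_ray_deriv c j r t Hr'). }
  assert (D : is_derive (fun u => RInt (fun t => U u t) 0 (2 * PI)) r
                (RInt (fun t => Derive (fun u => U u t) r) 0 (2 * PI))).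
  { apply is_derive_RInt_param.
    - apply filter_imp with (2 := Loc).
      intros u Hu t _. eexists. now apply HUV.
    - intros t _. eapply continuity_2d_pt_ext_loc; [|exact (proj1 (c2d_ray_deriv c j r t Hr'))].
      destruct Loc as [d Hd]. exists d. intros u v Hu _. symmetry.
      apply is_derive_unique, HUV, Hd. exact Hu.
    - apply filter_imp with (2 := Loc). intros u Hu. now apply circ_integrable. }
  assert (E1 : RInt (fun t => Derive (fun u => U u t) r) 0 (2 * PI) = RInt (fun t => V r t) 0 (2 * PI)).
  { apply RInt_ext. intros t _. now apply is_derive_unique, HUV. }
  rewrite E1 in D.
  assert (IV : ex_RInt (fun t => V r t) 0 (2 * PI)).
  { apply (ex_RInt_continuous (V := R_CompleteNormedModule)). intros; apply HV. }
  assert (IU := circ_integrable c j r Hr'). fold U in IU.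
  assert (HU : forall t, continuous (fun v => U r v) t).
  { intros t. apply (continuity_2d_1d U). apply c2d_ray. eapply cder_ccont. apply Hom.
    now rewrite Cmod_rcis. }
  assert (P : is_RInt (fun t => r * V r t - j * U r t) 0 (2 * PI) 0).
  { evar_last.
    - apply (is_RInt_derive (V := R_CompleteNormedModule)
        (fun t => Re (- Ci * c * om (r * cis t) * cis (- j * t))%C)).
      + intros t _. evar_last; [exact (proj1 (rder_angle c j r t Hr'))|].
        unfold U, V. simpl. unfold Re, Im; simpl. ring.
      + intros t _. apply (continuous_minus (V := R_NormedModule)); apply (continuous_scal_r (V := R_NormedModule)); [apply HV|apply HU].
    - cbv beta. rewrite Hj, (Rmult_0_r (- j)), !cis_0. replace (cis (2 * PI)) with (cis 0).
      + rewrite cis_0. exact (minus_eq_zero (G := R_AbelianGroup) _).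
      + unfold cis. now rewrite cos_2PI, sin_2PI, cos_0, sin_0. }
  assert (Q : r * RInt (fun t => V r t) 0 (2 * PI) - j * RInt (fun t => U r t) 0 (2 * PI) = 0).
  { transitivity (RInt (fun t => r * V r t - j * U r t) 0 (2 * PI)); [|exact (is_RInt_unique _ _ _ _ P)].
    symmetry. apply is_RInt_unique. apply (is_RInt_minus (V := R_NormedModule)); apply (is_RInt_scal (V := R_NormedModule)); apply (RInt_correct (V := R_CompleteNormedModule)); assumption. }
  evar_last; [exact D|]. unfold circ. fold (U r).
  apply Rmult_eq_reg_l with r; [|lra]. field_simplify; [|lra].
  change (RInt (fun t => U r t) 0 (2 * PI)) with (RInt (U r) 0 (2 * PI)) in Q. lra.
Qed.
End Circle.

Fixpoint rsum (u : nat -> R) (n : nat) : R :=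
  match n with O => 0 | S n => rsum u n + u n end.

Fixpoint csumn (u : nat -> C) (n : nat) : C :=
  match n with O => 0%C | S n => (csumn u n + u n)%C end.

Lemma cis_opp_mult t : (cis (- t) * cis t)%C = 1%C.
Proof. rewrite <- cis_plus, Rplus_opp_l. apply cis_0. Qed.

Lemma cis_period n : cis (INR n * (2 * PI)) = 1%C.
Proof.
  rewrite <- cis_pow. replace (cis (2 * PI)) with (RtoC 1); [apply Cpow_1_l|].
  unfold cis. now rewrite cos_2PI, sin_2PI.
Qed.

Lemma cis_period_opp n : cis (- INR n * (2 * PI)) = 1%C.
Proof.
  rewrite Ropp_mult_distr_l_reverse, <- (cis_opp_mult (INR n * (2 * PI))), cis_period.
  ring.
Qed.

Lemma cis_conj t : Cconj (cis t) = cis (- t).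
Proof. apply C_ext; simpl; [now rewrite cos_neg|now rewrite sin_neg]. Qed.

Lemma Re_mult_Re (u v : C) : Re u * Re v = / 2 * (Re (u * v) + Re (u * Cconj v)).
Proof. simpl; unfold Re, Im; field. Qed.

Section Circle.
Variables (om dom : C -> C).
Hypothesis Hom : forall z, Cmod z < 1 -> cder om z (dom z).
Hypothesis Hdom : forall z, Cmod z < 1 -> ccont dom z.

(** By the differential equation C(r) / r^n is constant: the Taylor coefficient does not depend on
    the circle. *)
Lemma circ_pow c n r s : 0 < r < 1 -> 0 < s < 1 ->
  circ om c (INR n) r * s ^ n = circ om c (INR n) s * r ^ n.
Proof.
  assert (Main : forall r s, 0 < r < 1 -> 0 < s < 1 -> r < s ->
     circ om c (INR n) r * s ^ n = circ om c (INR n) s * r ^ n).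
  { intros x y Hx Hy Hxy.
    assert (E : circ om c (INR n) x * (/ x) ^ n = circ om c (INR n) y * (/ y) ^ n).
    { apply (eq_is_derive (V := R_NormedModule) (fun u => circ om c (INR n) u * (/ u) ^ n)); [|exact Hxy].
      intros t Ht.
      assert (D1 : is_derive (fun u : R => (/ u) ^ n) t (INR n * (- (1 / t ^ 2)) * (/ t) ^ pred n)).
      { apply is_derive_pow. auto_derive; [lra|field; lra]. }
      evar_last.
      - apply is_derive_Rmult; [|exact D1].
        apply (circ_derive om dom Hom Hdom); [apply cis_period_opp|lra].
      - destruct n as [|m]; [simpl; unfold zero; simpl; field; lra|].
        change (pred (S m)) with m. unfold zero; simpl (/ t ^ S m). rewrite <- tech_pow_Rmult.
        simpl. field. lra. }
    rewrite !pow_inv in E.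
    assert (0 < x ^ n) by (apply pow_lt; lra). assert (0 < y ^ n) by (apply pow_lt; lra).
    apply (f_equal (fun q => q * (x ^ n * y ^ n))) in E. field_simplify in E; [|lra|lra]. lra. }
  intros Hr Hs. destruct (Rtotal_order r s) as [L|[->|L]].
  - now apply Main.
  - reflexivity.
  - symmetry. now apply Main.
Qed.

Lemma circ_bound c j r B : Rabs r < 1 -> (forall t, Cmod (om (r * cis t)) <= B) ->
  Rabs (circ om c j r) <= 2 * PI * (Cmod c * B).
Proof.
  intros Hr HB. assert (HP := PI_RGT_0).
  replace (2 * PI * (Cmod c * B)) with ((2 * PI - 0) * (Cmod c * B)) by ring.
  apply abs_RInt_le_const; [lra|now apply (circ_integrable om dom Hom)|].
  intros t _. eapply Rle_trans; [apply re_le_Cmod|].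
  rewrite !Cmod_mult, Cmod_cis, Rmult_1_r. apply Rmult_le_compat_l; [apply Cmod_ge_0|apply HB].
Qed.

(** For frequency -n the constant quantity is C(r) r^n. It tends to 0 with r because [om] z =
    O(|z|), which also settles n = 0. *)
Lemma circ_neg c n r : om 0 = 0%C -> 0 < r < 1 -> circ om c (- INR n) r = 0.
Proof.
  intros H0 Hr. assert (HP := PI_RGT_0).
  assert (Main : forall x y, 0 < x -> y < 1 -> x < y ->
     circ om c (- INR n) x * x ^ n = circ om c (- INR n) y * y ^ n).
  { intros x y Hx Hy Hxy.
    apply (eq_is_derive (V := R_NormedModule) (fun u => circ om c (- INR n) u * u ^ n)); [|exact Hxy].
    intros t Ht.
    assert (D1 : is_derive (fun u : R => u ^ n) t (INR n * 1 * t ^ pred n)).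
    { apply is_derive_pow. apply (is_derive_id (K := R_AbsRing)). }
    evar_last.
    - apply is_derive_Rmult; [|exact D1].
      apply (circ_derive om dom Hom Hdom); [rewrite Ropp_involutive; apply cis_period|lra].
    - destruct n as [|m]; [simpl; unfold zero; simpl; field; lra|].
      change (pred (S m)) with m. rewrite <- tech_pow_Rmult.
      unfold zero; simpl. field. lra. }
  destruct (Hom 0%C ltac:(rewrite Cmod_0; lra) 1 Rlt_0_1) as [d [Hd Q]].
  set (K := 1 + Cmod (dom 0)).
  assert (HK : 0 <= K) by (unfold K; generalize (Cmod_ge_0 (dom 0)); lra).
  assert (Hsmall : forall z, Cmod z <= d -> Cmod (om z) <= K * Cmod z).
  { intros z Hz. replace (z - 0)%C with z in Q by ring.
    specialize (Q z). replace (z - 0)%C with z in Q by ring. specialize (Q Hz).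
    rewrite H0 in Q. replace (om z - 0 - dom 0 * z)%C with (om z - dom 0 * z)%C in Q by ring.
    replace (om z) with ((om z - dom 0 * z) + dom 0 * z)%C by ring.
    eapply Rle_trans; [apply Cmod_triangle|]. rewrite Cmod_mult. unfold K. lra. }
  set (X := Rabs (circ om c (- INR n) r * r ^ n)).
  assert (HX : X <= 0).
  { apply le_epsilon. intros e He. rewrite Rplus_0_l.
    set (C0 := 2 * PI * (Cmod c * K) + 1).
    assert (HC0 : 0 < C0 /\ 2 * PI * (Cmod c * K) <= C0).
    { assert (0 <= Cmod c * K) by (apply Rmult_le_pos; [apply Cmod_ge_0|lra]). unfold C0; split; nra. }
    set (x := Rmin (r / 2) (Rmin d (e / C0))).
    assert (Hx : 0 < x). { repeat apply Rmin_glb_lt; try lra. apply Rdiv_lt_0_compat; lra. }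
    assert (L1 : x <= r / 2) by apply Rmin_l.
    assert (L2 : x <= d) by (eapply Rle_trans; [apply Rmin_r|apply Rmin_l]).
    assert (L3 : x <= e / C0) by (eapply Rle_trans; [apply Rmin_r|apply Rmin_r]).
    unfold X. rewrite <- (Main x r) by lra. rewrite Rabs_mult.
    assert (B : Rabs (circ om c (- INR n) x) <= 2 * PI * (Cmod c * (K * x))).
    { apply circ_bound; [rewrite Rabs_pos_eq; lra|]. intros t.
      assert (Et : Cmod (x * cis t) = x) by (rewrite Cmod_rcis, Rabs_pos_eq; lra).
      rewrite <- Et at 2. apply Hsmall. lra. }
    assert (P : Rabs (x ^ n) <= 1).
    { rewrite Rabs_pos_eq by (apply pow_le; lra). rewrite <- (pow1 n). apply pow_incr; lra. }
    apply Rle_trans with (2 * PI * (Cmod c * (K * x)) * 1).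
    - apply Rmult_le_compat; try apply Rabs_pos; assumption.
    - apply Rle_div_r in L3; [|lra]. nra. }
  assert (E : circ om c (- INR n) r * r ^ n = 0).
  { apply NNPP; intros N. apply Rabs_pos_lt in N. fold X in N. lra. }
  apply Rmult_integral in E. destruct E as [E|E]; [exact E|].
  exfalso. revert E. apply pow_nonzero. lra.
Qed.

Lemma is_RInt_cis (c : C) (k : R) : k <> 0 -> cis (k * (2 * PI)) = 1%C ->
  is_RInt (fun t => Re (c * cis (k * t))%C) 0 (2 * PI) 0.
Proof.
  intros Hk E.
  assert (Ck : RtoC k <> 0%C) by (intros F; apply Hk; now injection F).
  assert (Cki : (k * Ci)%C <> 0%C).
  { apply Cmult_neq_0; [exact Ck|]. intros F; injection F; lra. }
  evar_last.
  - apply (is_RInt_derive (V := R_CompleteNormedModule) (fun t => Re (c / (k * Ci) * cis (k * t))%C)).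
    + intros t _. evar_last.
      * exact (proj1 (rder_mult _ _ _ _ _ (rder_const (c / (k * Ci))%C t) (rder_cis k t))).
      * apply (f_equal Re). set (w := (k * Ci)%C) in *. field. exact Cki.
    + intros t _. apply (continuity_2d_1d (fun _ v => Re (c * cis (k * v))%C) 0).
      exact (proj1 (c2d_mult _ _ _ _ (c2d_const c 0 t) (c2d_cis k 0 t))).
  - cbv beta. rewrite E, (Rmult_0_r k), cis_0. exact (minus_eq_zero (G := R_AbelianGroup) _).
Qed.

(* [t k] is the coefficient of frequency [k + 1]. *)
Definition trig (t0 : R) (t : nat -> C) (n : nat) (x : R) : R :=
  t0 + rsum (fun k => Re (t k * cis (- INR (S k) * x))%C) n.

Lemma is_RInt_trig t0 t n : is_RInt (trig t0 t n) 0 (2 * PI) (2 * PI * t0).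
Proof.
  induction n as [|n IH].
  - evar_last; [eapply is_RInt_ext; [|apply (is_RInt_const (V := R_NormedModule) 0 (2 * PI) t0)]|].
    + intros x _. unfold trig; simpl. ring.
    + unfold scal; simpl; unfold mult; simpl. ring.
  - assert (N : - INR (S n) <> 0) by (generalize (lt_0_INR (S n) ltac:(lia)); lra).
    evar_last.
    + eapply is_RInt_ext;
       [|apply (is_RInt_plus (V := R_NormedModule) _ _ _ _ _ _ IH (is_RInt_cis (t n) (- INR (S n)) N (cis_period_opp (S n))))].
      intros x _. unfold trig, plus; cbn [rsum]. exact (Rplus_assoc _ _ _).
    + unfold plus; simpl; ring.
Qed.

Lemma is_RInt_circ c j r : Rabs r < 1 ->
  is_RInt (fun x => Re (c * om (r * cis x) * cis (- j * x))%C) 0 (2 * PI) (circ om c j r).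
Proof.
  intros Hr. apply (RInt_correct (V := R_CompleteNormedModule)).
  now apply (circ_integrable om dom Hom).
Qed.

(** A product of real parts splits into two frequencies: against e^{-ix} [om], the term [t k] of
    frequency k + 1 produces k + 2, which is kept, and -k, which [circ_neg] removes. This explains
    the factor 1/2. *)
Lemma is_RInt_om_trig t0 t n r : om 0 = 0%C -> 0 < r < 1 ->
  is_RInt (fun x => Re (om (r * cis x) * cis (- (1) * x))%C * trig t0 t n x) 0 (2 * PI)
    (t0 * circ om 1 1 r + / 2 * rsum (fun k => circ om (t k) (INR (S (S k))) r) n).
Proof.
  intros H0 Hr. assert (Hr' : Rabs r < 1) by (rewrite Rabs_pos_eq; lra).
  induction n as [|n IH].
  - evar_last; [eapply is_RInt_ext; [|apply (is_RInt_scal (V := R_NormedModule) _ _ _ t0 _ (is_RInt_circ 1 1 r Hr'))]|].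
    + intros x _. unfold trig, scal; simpl; unfold mult; simpl. unfold Re, Im; ring.
    + unfold scal; simpl; unfold mult; simpl. ring.
  - evar_last.
    + eapply is_RInt_ext;
       [|apply (is_RInt_plus (V := R_NormedModule) _ _ _ _ _ _ IH
          (is_RInt_scal (V := R_NormedModule) _ _ _ (/ 2) _
          (is_RInt_plus (V := R_NormedModule) _ _ _ _ _ _
            (is_RInt_circ (t n) (INR (S (S n))) r Hr') (is_RInt_circ (Cconj (t n)) (- INR n) r Hr'))))].
      intros x _. unfold trig; cbn [rsum].
      change (Re (om (r * cis x) * cis (- (1) * x))%C * (t0 + rsum (fun k => Re (t k * cis (- INR (S k) * x))%C) n)
        + / 2 * (Re (t n * om (r * cis x) * cis (- INR (S (S n)) * x))%C
           + Re (Cconj (t n) * om (r * cis x) * cis (- - INR n * x))%C)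
        = Re (om (r * cis x) * cis (- (1) * x))%C * (t0 + (rsum (fun k => Re (t k * cis (- INR (S k) * x))%C) n
           + Re (t n * cis (- INR (S n) * x))%C))).
      rewrite <- Rplus_assoc, (Rmult_plus_distr_l _ _ (Re (t n * _))). f_equal.
      rewrite Re_mult_Re, Cmult_conj, cis_conj. do 3 f_equal.
      * replace (- INR (S (S n)) * x) with (- (1) * x + - INR (S n) * x) by (rewrite (S_INR (S n)); ring).
        rewrite cis_plus. ring.
      * replace (- - INR n * x) with (- (1) * x + - (- INR (S n) * x)) by (rewrite (S_INR n); ring).
        rewrite cis_plus. ring.
    + rewrite (circ_neg _ _ _ H0 Hr). unfold plus, scal; simpl; unfold mult; simpl. ring.
Qed.
End Circle.

(** * Finite sums and the Schwarz lemma against test polynomials *)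

Lemma rsum_ext u v n : (forall k, (k < n)%nat -> u k = v k) -> rsum u n = rsum v n.
Proof.
  induction n as [|n IH]; intros H; [reflexivity|]. simpl.
  rewrite IH by (intros; apply H; lia). now rewrite H by lia.
Qed.

Lemma rsum_le u v n : (forall k, (k < n)%nat -> u k <= v k) -> rsum u n <= rsum v n.
Proof.
  induction n as [|n IH]; intros H; [simpl; lra|]. simpl.
  apply Rplus_le_compat; [apply IH; intros; apply H; lia|apply H; lia].
Qed.

Lemma rsum_plus u v n : rsum (fun k => u k + v k) n = rsum u n + rsum v n.
Proof. induction n as [|n IH]; simpl; [ring|rewrite IH; ring]. Qed.

Lemma rsum_scal c u n : rsum (fun k => c * u k) n = c * rsum u n.
Proof. induction n as [|n IH]; simpl; [ring|rewrite IH; ring]. Qed.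

Lemma rsum_continuity (u : nat -> R -> R) x n :
  (forall k, continuity_pt (u k) x) -> continuity_pt (fun r => rsum (fun k => u k r) n) x.
Proof.
  intros H. induction n as [|n IH]; simpl.
  - apply continuity_pt_const. intros a b; reflexivity.
  - apply continuity_pt_plus; [exact IH|apply H].
Qed.

Lemma continuity_pt_monomial c n x : continuity_pt (fun r => c * r ^ n) x.
Proof.
  apply continuity_pt_mult.
  - apply continuity_pt_const. intros a b; reflexivity.
  - apply derivable_continuous_pt, derivable_pt_pow.
Qed.

Section Circle.
Variables (om dom : C -> C).
Hypothesis Hom : forall z, Cmod z < 1 -> cder om z (dom z).
Hypothesis Hdom : forall z, Cmod z < 1 -> ccont dom z.
Hypothesis Hom0 : om 0 = 0%C.
Hypothesis Hom1 : forall z, Cmod z < 1 -> Cmod (om z) <= 1.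

Lemma circ_positive t0 t n r : (forall x, 0 <= trig t0 t n x) -> 0 < r < 1 ->
  t0 * circ om 1 1 r + / 2 * rsum (fun k => circ om (t k) (INR (S (S k))) r) n <= 2 * PI * t0.
Proof.
  intros HT Hr. assert (HP := PI_RGT_0).
  refine (is_RInt_le _ _ _ _ _ _ _ (is_RInt_om_trig om dom Hom Hdom t0 t n r Hom0 Hr) (is_RInt_trig t0 t n) _).
  - lra.
  - intros x _. assert (H := HT x).
    assert (B : Re (om (r * cis x) * cis (- (1) * x)) <= 1).
    { eapply Rle_trans; [apply Re_le_Cmod|]. rewrite Cmod_mult, Cmod_cis, Rmult_1_r.
      apply Hom1. rewrite Cmod_rcis, Rabs_pos_eq; lra. }
    nra.
Qed.

(** The Schwarz lemma Re([om](z)/z) <= 1 in dual form. As the normalized coefficients do not depend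
    on the circle, [circ_positive] at radius u bounds a polynomial [G] in u on (0, 1), and
    continuity extends the bound to u = 1. *)
Lemma circ_positive_normalized t0 t n r : (forall x, 0 <= trig t0 t n x) -> 0 < r < 1 ->
  t0 * (circ om 1 1 r / r) +
    / 2 * rsum (fun k => circ om (t k) (INR (S (S k))) r / r ^ S (S k)) n <= 2 * PI * t0.
Proof.
  intros HT Hr.
  set (G := fun u : R => t0 * (circ om 1 1 r / r) * u ^ 1 +
    / 2 * rsum (fun k => circ om (t k) (INR (S (S k))) r / r ^ S (S k) * u ^ S (S k)) n).
  assert (HG : forall u, 0 < u < 1 -> G u <= 2 * PI * t0).
  { intros u Hu. eapply Rle_trans; [|apply (circ_positive t0 t n u HT Hu)].
    assert (E : forall c m, circ om c (INR m) r / r ^ m * u ^ m = circ om c (INR m) u).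
    { intros c m. assert (0 < r ^ m) by (apply pow_lt; lra).
      assert (Q := circ_pow om dom Hom Hdom c m r u Hr Hu).
      apply Rmult_eq_reg_r with (r ^ m); [|lra]. rewrite <- Q. field. lra. }
    right. unfold G. f_equal.
    - assert (E1 := E 1%C 1%nat). simpl INR in E1. rewrite <- E1. simpl. field. lra.
    - f_equal. apply rsum_ext. intros k _. apply E. }
  replace (t0 * (circ om 1 1 r / r) + _) with (G 1).
  2:{ unfold G. f_equal; [simpl; ring|]. f_equal. apply rsum_ext. intros k _. rewrite pow1. ring. }
  assert (CG : continuity_pt G 1).
  { apply continuity_pt_plus; [apply continuity_pt_monomial|].
    apply continuity_pt_scal. apply rsum_continuity. intros k. apply continuity_pt_monomial. }
  apply Rnot_lt_le. intros L.
  destruct (CG (G 1 - 2 * PI * t0)) as [d [Hd Q]]; [lra|].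
  set (u := 1 - Rmin (d / 2) (1 / 2)).
  assert (Hm : 0 < Rmin (d / 2) (1 / 2)) by (apply Rmin_glb_lt; lra).
  generalize (Rmin_l (d / 2) (1 / 2)) (Rmin_r (d / 2) (1 / 2)). intros.
  assert (Hu : 0 < u < 1) by (unfold u; lra).
  specialize (HG u Hu).
  assert (D : R_dist (G u) (G 1) < G 1 - 2 * PI * t0).
  { apply Q. split.
    - split; [exact I|lra].
    - simpl; unfold R_dist. rewrite Rabs_left; unfold u; lra. }
  unfold R_dist in D. apply Rabs_def2 in D. lra.
Qed.

Lemma is_RInt_poly c (w : nat -> C) (r : R) m N :
  is_RInt (fun x => Re (c * csumn (fun i => w i * (r * cis x) ^ i) N * cis (- INR m * x))%C)
    0 (2 * PI) (if Compare_dec.lt_dec m N then 2 * PI * (r ^ m * Re (c * w m)%C) else 0).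
Proof.
  induction N as [|N IH].
  - destruct (Compare_dec.lt_dec m 0) as [H|_]; [lia|].
    evar_last; [eapply is_RInt_ext; [|apply (is_RInt_const (V := R_NormedModule) 0 (2 * PI) 0)]|].
    + intros x _. simpl. unfold Re, Im; simpl; ring.
    + unfold scal; simpl; unfold mult; simpl. ring.
  - assert (M : is_RInt (fun x => Re (c * (w N * (r * cis x) ^ N) * cis (- INR m * x))%C)
       0 (2 * PI) (if Nat.eq_dec m N then 2 * PI * (r ^ m * Re (c * w m)%C) else 0)).
    { assert (E : forall x, (c * (w N * (r * cis x) ^ N) * cis (- INR m * x))%C
         = (c * w N * (r ^ N)%R * cis ((INR N - INR m) * x))%C).
      { intros x. rewrite Cpow_mult_l, cis_pow, RtoC_pow.
        replace ((INR N - INR m) * x) with (INR N * x + - INR m * x) by ring.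
        rewrite cis_plus. ring. }
      destruct (Nat.eq_dec m N) as [<-|H].
      - evar_last; [eapply is_RInt_ext; [|apply (is_RInt_const (V := R_NormedModule) 0 (2 * PI) (r ^ m * Re (c * w m)%C))]|].
        + intros x _. cbv beta. rewrite E. replace ((INR m - INR m) * x) with 0 by ring.
          rewrite cis_0. simpl; unfold Re, Im; simpl; ring.
        + unfold scal; simpl; unfold mult; simpl. ring.
      - eapply is_RInt_ext; [|apply (is_RInt_cis (c * w N * (r ^ N)%R) (INR N - INR m))].
        + intros x _. cbv beta. now rewrite E.
        + intros F. apply H. apply INR_eq. lra.
        + replace ((INR N - INR m) * (2 * PI)) with (INR N * (2 * PI) + - INR m * (2 * PI)) by ring.
          rewrite cis_plus, cis_period, cis_period_opp. ring. }
    evar_last.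
    + eapply is_RInt_ext; [|apply (is_RInt_plus (V := R_NormedModule) _ _ _ _ _ _ IH M)].
      intros x _. unfold plus; cbn [csumn]. simpl. unfold Re, Im; simpl. ring.
    + match goal with |- plus ?a ?b = ?d => change (a + b = d) end.
      destruct (Compare_dec.lt_dec m N), (Nat.eq_dec m N), (Compare_dec.lt_dec m (S N)); try lia; simpl; ring.
Qed.

Lemma circ_approx (c : C) (w : nat -> C) (r e : R) m N : 0 < r < 1 -> (m < N)%nat ->
  (forall x, Cmod (om (r * cis x) - csumn (fun i => w i * (r * cis x) ^ i)%C N) <= e) ->
  Rabs (circ om c (INR m) r - 2 * PI * (r ^ m * Re (c * w m)%C)) <= 2 * PI * (Cmod c * e).
Proof.
  intros Hr Hm He. assert (HP := PI_RGT_0).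
  assert (Hr' : Rabs r < 1) by (rewrite Rabs_pos_eq; lra).
  assert (P := is_RInt_poly c w r m N). destruct (Compare_dec.lt_dec m N) as [_|]; [|lia].
  assert (D := is_RInt_minus (V := R_NormedModule) _ _ _ _ _ _ (is_RInt_circ om dom Hom c (INR m) r Hr') P).
  rewrite <- (is_RInt_unique (V := R_CompleteNormedModule) _ _ _ _ D : _ = circ om c (INR m) r - 2 * PI * (r ^ m * Re (c * w m)%C)).
  replace (2 * PI * (Cmod c * e)) with ((2 * PI - 0) * (Cmod c * e)) by ring.
  apply abs_RInt_le_const; [lra|eexists; exact D|].
  intros x _.
  replace (minus _ _) with (Re (c * (om (r * cis x) - csumn (fun i => w i * (r * cis x) ^ i) N) * cis (- INR m * x))%C).
  - eapply Rle_trans; [apply re_le_Cmod|].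
    rewrite !Cmod_mult, Cmod_cis, Rmult_1_r. apply Rmult_le_compat_l; [apply Cmod_ge_0|apply He].
  - unfold minus, plus, opp; simpl. unfold Re, Im; simpl; ring.
Qed.

(** The dual Schwarz inequality passes to any polynomial close to [om] on a single circle.
    Normalizing the coefficient of order m <= n + 1 divides the error by r^m, hence the loss e /
    r^(n+1). *)
Lemma coeff_positive (t0 : R) t n (w : nat -> C) (r e : R) : (forall x, 0 <= trig t0 t n x) -> 0 < r < 1 -> 
  (forall x, Cmod (om (r * cis x) - csumn (fun i => w i * (r * cis x) ^ i)%C (S (S n))) <= e) ->
  t0 * Re (w 1%nat) + / 2 * rsum (fun k => Re (t k * w (S (S k)))%C) n
   <= t0 + (Rabs t0 + rsum (fun k => Cmod (t k)) n) * (e / r ^ S n).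
Proof.
  intros HT Hr He. assert (HP := PI_RGT_0).
  assert (H := circ_positive_normalized t0 t n r HT Hr).
  assert (He0 : 0 <= e) by (eapply Rle_trans; [apply Cmod_ge_0|apply (He 0)]).
  assert (A : forall c m, (m <= S n)%nat ->
     Rabs (circ om c (INR m) r / r ^ m - 2 * PI * Re (c * w m)%C) <= 2 * PI * (Cmod c * (e / r ^ S n))).
  { intros c m Hm. assert (Q := circ_approx c w r e m (S (S n)) Hr ltac:(lia) He).
    assert (P1 : 0 < r ^ m) by (apply pow_lt; lra).
    assert (P2 : 0 < r ^ S n) by (apply pow_lt; lra).
    assert (P3 : r ^ S n <= r ^ m).
    { replace (S n) with (m + (S n - m))%nat by lia. rewrite pow_add.
      assert (r ^ (S n - m) <= 1) by (rewrite <- (pow1 (S n - m)); apply pow_incr; lra). nra. }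
    replace (circ om c (INR m) r / r ^ m - 2 * PI * Re (c * w m)%C) with
      ((circ om c (INR m) r - 2 * PI * (r ^ m * Re (c * w m)%C)) / r ^ m) by (field; lra).
    rewrite Rabs_div, (Rabs_pos_eq (r ^ m)) by lra.
    apply Rle_trans with (2 * PI * (Cmod c * e) / r ^ m).
    - apply Rmult_le_compat_r; [left; now apply Rinv_0_lt_compat|exact Q].
    - replace (2 * PI * (Cmod c * e) / r ^ m) with (2 * PI * (Cmod c * (e / r ^ m))) by (field; lra).
      apply Rmult_le_compat_l; [lra|]. apply Rmult_le_compat_l; [apply Cmod_ge_0|].
      apply Rmult_le_compat_l; [exact He0|]. apply Rinv_le_contravar; lra. }
  set (E := e / r ^ S n) in *.
  assert (A1 := A 1%C 1%nat ltac:(lia)). rewrite Cmod_1 in A1. simpl INR in A1.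
  rewrite pow_1, Cmult_1_l in A1.
  assert (B1 : t0 * (2 * PI * Re (w 1%nat)) - Rabs t0 * (2 * PI * E) <= t0 * (circ om 1 1 r / r)).
  { assert (Q : Rabs (t0 * (circ om 1 1 r / r - 2 * PI * Re (w 1%nat))) <= Rabs t0 * (2 * PI * E)).
    { rewrite Rabs_mult. apply Rmult_le_compat_l; [apply Rabs_pos|]. lra. }
    apply Rabs_le_between in Q. lra. }
  assert (B2 : rsum (fun k => 2 * PI * (Re (t k * w (S (S k)))%C + - E * Cmod (t k))) n <=
      rsum (fun k => circ om (t k) (INR (S (S k))) r / r ^ S (S k)) n).
  { apply rsum_le. intros k Hk. assert (Q := A (t k) (S (S k)) ltac:(lia)).
    apply Rabs_le_between in Q. lra. }
  rewrite rsum_scal, rsum_plus, rsum_scal in B2.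
  assert (S0 : 0 <= rsum (fun k => Cmod (t k)) n).
  { apply Rle_trans with (rsum (fun _ => 0 * 0) n).
    - rewrite rsum_scal. lra.
    - apply rsum_le. intros. rewrite Rmult_0_l. apply Cmod_ge_0. }
  set (X := rsum (fun k => Re (t k * w (S (S k)))%C) n) in *.
  set (Y := rsum (fun k => Cmod (t k)) n) in *.
  assert (HE : 0 <= E). { apply Rdiv_le_0_compat; [exact He0|apply pow_lt; lra]. }
  apply Rmult_le_reg_l with (2 * PI); [lra|].
  assert (0 <= PI * (Y * E)) by (apply Rmult_le_pos; [lra|now apply Rmult_le_pos]).
  lra.
Qed.
End Circle.

(** * The Schwarz function attached to a convex map *)

Lemma ccont_mult F G z : ccont F z -> ccont G z -> ccont (fun x => F x * G x)%C z.
Proof.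
  intros HF HG e He.
  assert (A := Cmod_ge_0 (F z)). assert (B := Cmod_ge_0 (G z)).
  set (e1 := Rmin 1 (e / (2 * (Cmod (G z) + 1)))).
  set (e2 := e / (2 * (Cmod (F z) + 1))).
  assert (H1 : 0 < e1) by (apply Rmin_glb_lt; [lra|apply Rdiv_lt_0_compat; lra]).
  assert (H2 : 0 < e2) by (apply Rdiv_lt_0_compat; lra).
  destruct (HF _ H1) as [d1 [P1 Q1]]. destruct (HG _ H2) as [d2 [P2 Q2]].
  exists (Rmin d1 d2). split; [now apply Rmin_glb_lt|]. intros z' Hz.
  specialize (Q1 _ (Rle_trans _ _ _ Hz (Rmin_l _ _))).
  specialize (Q2 _ (Rle_trans _ _ _ Hz (Rmin_r _ _))).
  replace (F z' * G z' - F z * G z)%C with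
    ((F z + (F z' - F z)) * (G z' - G z) + (F z' - F z) * G z)%C by ring.
  eapply Rle_trans; [apply Cmod_triangle|]. rewrite !Cmod_mult.
  assert (L1 : e1 <= 1) by apply Rmin_l.
  assert (L2 : e1 * (2 * (Cmod (G z) + 1)) <= e) by (apply Rle_div_r; [lra|apply Rmin_r]).
  assert (X1 : Cmod (F z + (F z' - F z)) * Cmod (G z' - G z) <= (Cmod (F z) + 1) * e2).
  { apply Rmult_le_compat; try apply Cmod_ge_0; [|exact Q2].
    eapply Rle_trans; [apply Cmod_triangle|]. lra. }
  assert (X2 : (Cmod (F z) + 1) * e2 = e / 2) by (unfold e2; field; lra).
  assert (X3 : Cmod (F z' - F z) * Cmod (G z) <= e1 * (Cmod (G z) + 1)).
  { apply Rmult_le_compat; try apply Cmod_ge_0; lra. }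
  lra.
Qed.

Lemma ccont_inv F z : ccont F z -> F z <> 0%C -> ccont (fun x => / F x)%C z.
Proof.
  intros HF HN e He. assert (A : 0 < Cmod (F z)) by now apply Cmod_gt_0.
  set (c := Cmod (F z)) in *.
  assert (H1 : 0 < Rmin (c / 2) (e * (c * c / 2))).
  { apply Rmin_glb_lt; [lra|]. apply Rmult_lt_0_compat; [lra|nra]. }
  destruct (HF _ H1) as [d [Pd Q]]. exists d. split; [exact Pd|]. intros z' Hz.
  specialize (Q z' Hz).
  assert (L1 := Rle_trans _ _ _ Q (Rmin_l _ _)).
  assert (L2 := Rle_trans _ _ _ Q (Rmin_r _ _)).
  assert (B : c / 2 <= Cmod (F z')).
  { assert (T : c <= Cmod (F z') + Cmod (F z' - F z)).
    { unfold c. rewrite (Cmod_sub_sym (F z') (F z)). replace (F z) with (F z' + (F z - F z'))%C at 1 by ring.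
      apply Cmod_triangle. }
    lra. }
  assert (HN' : F z' <> 0%C) by (apply Cmod_gt_0; lra).
  replace (/ F z' - / F z)%C with (- ((F z' - F z) / (F z' * F z)))%C by (field; auto).
  rewrite Cmod_opp, Cmod_div by (apply Cmult_neq_0; assumption).
  rewrite Cmod_mult. fold c.
  apply Rle_div_l; [nra|]. eapply Rle_trans; [exact L2|].
  apply Rmult_le_compat_l; [lra|]. nra.
Qed.

Lemma ccont_comp F G z : ccont F (G z) -> ccont G z -> ccont (fun x => F (G x)) z.
Proof.
  intros HF HG e He. destruct (HF e He) as [d1 [P1 Q1]]. destruct (HG d1 P1) as [d2 [P2 Q2]].
  exists d2. split; [exact P2|]. intros z' Hz. now apply Q1, Q2.
Qed.

Lemma disk_near (z : C) : Cmod z < 1 -> exists rho r d, 0 <= r < rho /\ rho < 1 /\ 0 < d /\ Cmod z <= r /\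
  forall z', Cmod (z' - z) <= d -> Cmod z' <= r.
Proof.
  intros Hz. assert (Hz0 := Cmod_ge_0 z).
  exists ((2 + Cmod z) / 3), ((1 + 2 * Cmod z) / 3), ((1 - Cmod z) / 3).
  repeat split; try lra. intros z' H.
  replace z' with (z + (z' - z))%C at 1 by ring. eapply Rle_trans; [apply Cmod_triangle|]. lra.
Qed.

Lemma ev_cder b z : disk_coeffs b -> Cmod z < 1 -> cder (ev b) z (df b z).
Proof.
  intros Hb Hz e He. destruct (disk_near z Hz) as [rho [r [d [H1 [H2 [H3 [H4 H5]]]]]]].
  destruct (Hb rho) as [M HM]; [lra|].
  destruct (ev_taylor rho r M b HM H1) as [K [HK T]].
  exists (Rmin d (e / (K + 1))). split.
  - apply Rmin_glb_lt; [lra|]. apply Rdiv_lt_0_compat; lra.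
  - intros z' Hz'. assert (L1 := Rle_trans _ _ _ Hz' (Rmin_l _ _)).
    assert (L2 := Rle_trans _ _ _ Hz' (Rmin_r _ _)).
    eapply Rle_trans; [apply T; [now apply H5|exact H4]|].
    replace (K * Cmod (z' - z) ^ 2) with (K * Cmod (z' - z) * Cmod (z' - z)) by ring.
    assert (P := Cmod_ge_0 (z' - z)).
    apply Rmult_le_compat_r; [exact P|].
    apply Rle_div_r in L2; [|lra]. lra.
Qed.

Lemma df_ccont b z : disk_coeffs b -> Cmod z < 1 -> ccont (df b) z.
Proof.
  intros Hb Hz e He. destruct (disk_near z Hz) as [rho [r [d [H1 [H2 [H3 [H4 H5]]]]]]].
  destruct (Hb rho) as [M HM]; [lra|].
  destruct (df_lip rho r M b HM H1) as [K [HK T]].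
  exists (Rmin d (e / (K + 1))). split.
  - apply Rmin_glb_lt; [lra|]. apply Rdiv_lt_0_compat; lra.
  - intros z' Hz'. assert (L1 := Rle_trans _ _ _ Hz' (Rmin_l _ _)).
    assert (L2 := Rle_trans _ _ _ Hz' (Rmin_r _ _)).
    eapply Rle_trans; [apply T; [now apply H5|exact H4]|].
    assert (P := Cmod_ge_0 (z' - z)). apply Rle_div_r in L2; [|lra]. nra.
Qed.

(** The case m = 1 of [solve_power_eq], for the difference quotient at z0 and s = (w - f(z0)) /
    f'(z0). The estimate is the first-order expansion of the inverse. *)
Lemma local_inverse a z0 e : disk_coeffs a -> Cmod z0 < 1 -> df a z0 <> 0%C -> 0 < e ->
  exists d, 0 < d /\ forall w, Cmod (w - ev a z0) <= d ->
    exists z, Cmod z < 1 /\ ev a z = w /\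
      Cmod (z - z0 - (w - ev a z0) / df a z0) <= e * Cmod (w - ev a z0).
Proof.
  intros Ha Hz Hdf He. destruct (disk_near z0 Hz) as [rho [r [dl [H1 [H2 [H3 [H4 H5]]]]]]].
  destruct (Ha rho) as [M HM]; [lra|].
  assert (Hd := bnd_dv _ _ _ z0 HM ltac:(lra)).
  destruct (ev_lip rho r _ _ Hd H1) as [K [HK Lip]].
  assert (Hg : 0 < Cmod (df a z0)) by now apply Cmod_gt_0.
  set (g := Cmod (df a z0)) in *.
  destruct (solve_power_eq (ev (dv z0 a)) z0 dl K 1 (e * g)) as [d [Pd Sol]]; try assumption.
  - intros z z' Q Q'. apply Lip; now apply H5.
  - lia.
  - now apply Rmult_lt_0_compat.
  - set (d' := Rmin d (dl / (1 + e * g))).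
    assert (Heg : 0 < e * g) by now apply Rmult_lt_0_compat.
    assert (Hd' : 0 < d'). { apply Rmin_glb_lt; [exact Pd|]. apply Rdiv_lt_0_compat; lra. }
    exists (d' * g). split; [now apply Rmult_lt_0_compat|]. intros w Hw.
    set (s := ((w - ev a z0) / df a z0)%C).
    assert (Es : Cmod s = Cmod (w - ev a z0) / g) by (unfold s; now rewrite Cmod_div).
    assert (Bs : Cmod s <= d') by (rewrite Es; now apply Rle_div_l).
    destruct (Sol s) as [z [B E]]; [eapply Rle_trans; [exact Bs|apply Rmin_l]|].
    assert (Bz : Cmod (z - z0) <= dl).
    { replace (z - z0)%C with (z - z0 - s + s)%C by ring.
      eapply Rle_trans; [apply Cmod_triangle|].
      assert (L := Rle_trans _ _ _ Bs (Rmin_r _ _)). apply Rle_div_r in L; lra. }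
    assert (Bz' := H5 z Bz).
    exists z. split; [lra|split].
    + assert (F := ev_factor rho M a z0 z HM ltac:(lra) ltac:(lra)).
      rewrite !Cpow_1_r in E. rewrite E in F.
      change (ev (dv z0 a) z0) with (df a z0) in F.
      transitivity (ev a z0 + (ev a z - ev a z0))%C; [ring|]. rewrite F.
      unfold s. field. exact Hdf.
    + eapply Rle_trans; [exact B|]. rewrite Es. right. field. lra.
Qed.

Definition mid_convex (a : nat -> C) : Prop :=
  forall z z', Cmod z < 1 -> Cmod z' < 1 ->
    exists x, Cmod x < 1 /\ ev a x = (/ 2 * (ev a z + ev a z'))%C.

(** Coefficients of the mean of f(e^{i al} z) and f(e^{-i al} z), since the mean of e^{ik al} and
    e^{-ik al} is cos (k al). *)
Definition hc (a : nat -> C) (al : R) (k : nat) : C := (cos (INR k * al) * a k)%C.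

Lemma hc_coeffs rho M a al : 0 <= rho -> bnd rho M a -> bnd rho M (hc a al).
Proof.
  intros Hr H k. unfold hc. rewrite Cmod_mult, Cmod_R.
  eapply Rle_trans; [|apply H].
  rewrite <- (Rmult_1_l (Cmod (a k) * _)), Rmult_assoc. apply Rmult_le_compat_r.
  - apply Rmult_le_pos; [apply Cmod_ge_0|now apply pow_le].
  - apply Rabs_le. apply COS_bound.
Qed.

Lemma hc_disk a al : disk_coeffs a -> disk_coeffs (hc a al).
Proof. intros H rho Hr. destruct (H rho Hr) as [M HM]. exists M. apply hc_coeffs; [lra|exact HM]. Qed.

Lemma hc_mean a al z : disk_coeffs a -> Cmod z < 1 ->
  ev (hc a al) z = (/ 2 * (ev a (cis al * z) + ev a (cis (- al) * z)))%C.
Proof.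
  intros Ha Hz. destruct (disk_near z Hz) as [rho [r [d [H1 [H2 [_ [H4 _]]]]]]].
  destruct (Ha rho) as [M HM]; [lra|].
  assert (N : forall t, Cmod (cis t * z) < rho).
  { intros t. rewrite Cmod_mult, Cmod_cis. lra. }
  apply csum_ev.
  eapply csum_ext; [|exact (csum_scal (/ 2)%C _ _ (csum_plus _ _ _ _
    (proj1 (ev_spec _ _ _ _ HM (N al))) (proj1 (ev_spec _ _ _ _ HM (N (- al))))))].
  intros k. simpl. unfold hc. rewrite !Cpow_mult_l, !cis_pow.
  replace (INR k * - al) with (- (INR k * al)) by ring. rewrite <- cis_conj.
  set (c := cis (INR k * al)).
  replace (RtoC (cos (INR k * al))) with ((c + Cconj c) / 2)%C.
  - field.
  - rewrite <- re_alt. reflexivity.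
Qed.

Section Omega.
Variable a : nat -> C.
Hypotheses (Ha : disk_coeffs a) (Hinj : disk_injective a).

Lemma omega_exists al : mid_convex a ->
  exists om : C -> C, forall z, Cmod z < 1 -> Cmod (om z) < 1 /\ ev a (om z) = ev (hc a al) z.
Proof.
  intros Hc.
  (* A bare choice of preimages, with arbitrary values off the disk; regularity comes from
     uniqueness of the preimage. *)
  destruct (functional_choice (fun z w : C => Cmod z < 1 -> Cmod w < 1 /\ ev a w = ev (hc a al) z)) as [om Hom].
  - intros z. destruct (Rlt_dec (Cmod z) 1) as [H|H].
    + destruct (Hc (cis al * z)%C (cis (- al) * z)%C) as [x [Hx Ex]].
      * rewrite Cmod_mult, Cmod_cis; lra.
      * rewrite Cmod_mult, Cmod_cis; lra.
      * exists x. intros _. split; [exact Hx|]. rewrite Ex. symmetry. now apply hc_mean.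
    + exists 0%C. intros F; contradiction.
  - exists om. exact Hom.
Qed.

Variables (al : R) (om : C -> C).
Hypothesis Hom : forall z, Cmod z < 1 -> Cmod (om z) < 1 /\ ev a (om z) = ev (hc a al) z.

Definition dom (z : C) : C := (df (hc a al) z * / df a (om z))%C.

(** Near f([om] z) the local inverse supplies a preimage of the mean at z' with a first-order
    expansion; injectivity identifies it with [om] z', so no prior continuity of [om] enters. *)
Lemma omega_cder z : Cmod z < 1 -> cder om z (dom z).
Proof.
  intros Hz e He. destruct (Hom z Hz) as [Hw Ew].
  assert (Hdf := df_neq_0 a (om z) Ha Hinj Hw).
  assert (Hg : 0 < Cmod (df a (om z))) by now apply Cmod_gt_0.
  set (g := Cmod (df a (om z))) in *.
  set (Dh := df (hc a al) z).
  assert (HDh := Cmod_ge_0 Dh).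
  set (e1 := e / (2 * (Cmod Dh + 1))).
  set (e2 := Rmin 1 (e * g / 2)).
  assert (He1 : 0 < e1) by (apply Rdiv_lt_0_compat; lra).
  assert (He2 : 0 < e2) by (apply Rmin_glb_lt; [lra|]; apply Rdiv_lt_0_compat; [now apply Rmult_lt_0_compat|lra]).
  destruct (local_inverse a (om z) e1 Ha Hw Hdf He1) as [d1 [P1 Q1]].
  destruct (ev_cder (hc a al) z (hc_disk a al Ha) Hz e2 He2) as [d2 [P2 Q2]].
  destruct (disk_near z Hz) as [rho [r [d3 [H1 [H2 [H3 [H4 H5]]]]]]].
  set (d4 := d1 / (Cmod Dh + 1)).
  assert (P4 : 0 < d4) by (apply Rdiv_lt_0_compat; lra).
  exists (Rmin d2 (Rmin d3 d4)). split; [repeat apply Rmin_glb_lt; assumption|].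
  intros z' Hz'.
  assert (L2 := Rle_trans _ _ _ Hz' (Rmin_l _ _)).
  assert (L := Rle_trans _ _ _ Hz' (Rmin_r _ _)).
  assert (L3 := Rle_trans _ _ _ L (Rmin_l _ _)).
  assert (L4 := Rle_trans _ _ _ L (Rmin_r _ _)).
  specialize (Q2 z' L2). fold Dh in Q2.
  assert (Hzd : Cmod z' < 1) by (specialize (H5 z' L3); lra).
  destruct (Hom z' Hzd) as [Hw' Ew'].
  set (X := Cmod (z' - z)) in *. assert (HX : 0 <= X) by apply Cmod_ge_0.
  set (dh := (ev (hc a al) z' - ev (hc a al) z)%C) in *.
  assert (Bh : Cmod dh <= (Cmod Dh + 1) * X).
  { replace dh with ((dh - Dh * (z' - z)) + Dh * (z' - z))%C by ring.
    eapply Rle_trans; [apply Cmod_triangle|]. rewrite (Cmod_mult Dh). fold X.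
    assert (e2 <= 1) by apply Rmin_l. nra. }
  destruct (Q1 (ev (hc a al) z')) as [y [Hy [Ey By]]].
  { rewrite Ew. fold dh. eapply Rle_trans; [exact Bh|].
    unfold d4 in L4. apply Rle_div_r in L4; lra. }
  assert (Eyo : y = om z') by (apply Hinj; [exact Hy|exact Hw'|now rewrite Ey, Ew']).
  subst y. rewrite Ew in By. fold dh in By.
  unfold dom. fold Dh.
  replace (om z' - om z - Dh * / df a (om z) * (z' - z))%C with
    ((om z' - om z - dh / df a (om z)) + (dh - Dh * (z' - z)) / df a (om z))%C by (field; exact Hdf).
  eapply Rle_trans; [apply Cmod_triangle|]. rewrite Cmod_div by exact Hdf. fold g.
  assert (Y1 : e1 * Cmod dh <= e / 2 * X).
  { apply Rle_trans with (e1 * ((Cmod Dh + 1) * X)); [apply Rmult_le_compat_l; lra|].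
    right. unfold e1. field. lra. }
  assert (Y2 : Cmod (dh - Dh * (z' - z)) / g <= e / 2 * X).
  { apply Rle_div_l; [exact Hg|]. eapply Rle_trans; [exact Q2|].
    assert (e2 <= e * g / 2) by apply Rmin_r. nra. }
  lra.
Qed.

Lemma dom_ccont z : Cmod z < 1 -> ccont dom z.
Proof.
  intros Hz. destruct (Hom z Hz) as [Hw _].
  apply ccont_mult; [apply df_ccont; [now apply hc_disk|exact Hz]|].
  apply (ccont_inv (fun x => df a (om x))).
  - apply ccont_comp; [now apply df_ccont|]. eapply cder_ccont. now apply omega_cder.
  - now apply df_neq_0.
Qed.
End Omega.

(** * Second-order expansion of the Schwarz function *)

Lemma INR_le_pow2 k : INR k <= 2 ^ k.
Proof.
  induction k as [|k IH]; [simpl; lra|]. rewrite S_INR. simpl.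
  assert (1 <= 2 ^ k) by (apply pow_R1_Rle; lra). lra.
Qed.

Lemma INR_pow4 k : INR k ^ 4 <= 16 ^ k.
Proof.
  replace (16 ^ k) with ((2 ^ k) ^ 4).
  - apply pow_incr. split; [apply pos_INR|apply INR_le_pow2].
  - rewrite <- pow_mult, Nat.mul_comm, pow_mult. f_equal. ring.
Qed.

Lemma INR_pow_le_16 k : INR k <= 16 ^ k /\ INR k ^ 2 <= 16 ^ k.
Proof.
  assert (H := INR_pow4 k). destruct k as [|k].
  - simpl; lra.
  - assert (1 <= INR (S k)) by (rewrite S_INR; generalize (pos_INR k); lra).
    set (x := INR (S k)) in *. assert (x <= x ^ 4 /\ x ^ 2 <= x ^ 4); [|lra].
    assert (1 <= x ^ 2) by nra. split; [nra|]. replace (x ^ 4) with (x ^ 2 * x ^ 2) by ring. nra.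
Qed.

(** Wanted for every real x, since it is applied to x = k al with k unbounded; when |x| > 2 the
    quartic dominates trivially. *)
Lemma cos_quadratic x : Rabs (cos x - 1 + x ^ 2 / 2) <= x ^ 4.
Proof.
  destruct (Rle_lt_dec (Rabs x) 2) as [H|H].
  - apply Rabs_le_between in H.
    destruct (pre_cos_bound x 0) as [B1 B2]; [lra|lra|].
    unfold cos_approx, cos_term in B1, B2. simpl in B1, B2.
    assert (Q : 0 <= (x ^ 2) ^ 2) by apply pow2_ge_0.
    apply Rabs_le. split; nra.
  - assert (B := COS_bound x).
    assert (Q : 4 <= x ^ 2) by (rewrite <- pow2_abs; nra).
    apply Rabs_le. split; nra.
Qed.

Lemma binomial_linear k (y : C) : Cmod y <= 1 ->
  Cmod ((1 + y) ^ k - 1 - INR k * y) <= 16 ^ k * Cmod y ^ 2.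
Proof.
  intros Hy. assert (Hy0 := Cmod_ge_0 y). induction k as [|k IH].
  - simpl. replace (1 - 1 - 0 * y)%C with (RtoC 0) by ring. rewrite Cmod_0. nra.
  - rewrite Cpow_S, S_INR, RtoC_plus.
    replace ((1 + y) * (1 + y) ^ k - 1 - (INR k + 1) * y)%C with
      ((1 + y) * ((1 + y) ^ k - 1 - INR k * y) + INR k * (y * y))%C by ring.
    eapply Rle_trans; [apply Cmod_triangle|].
    rewrite !Cmod_mult, Cmod_R, (Rabs_pos_eq _ (pos_INR k)).
    assert (H1 := Cmod_1_plus _ _ Hy). assert (H2 := proj1 (INR_pow_le_16 k)).
    set (E := Cmod ((1 + y) ^ k - 1 - INR k * y)) in *.
    assert (HE : 0 <= E) by apply Cmod_ge_0.
    assert (X1 : Cmod (1 + y) * E <= 2 * (16 ^ k * Cmod y ^ 2)).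
    { apply Rmult_le_compat; [apply Cmod_ge_0|exact HE|lra|exact IH]. }
    assert (X2 : INR k * (Cmod y * Cmod y) <= 16 ^ k * Cmod y ^ 2).
    { replace (Cmod y * Cmod y) with (Cmod y ^ 2) by ring. apply Rmult_le_compat_r; [apply pow2_ge_0|exact H2]. }
    assert (0 <= 16 ^ k * Cmod y ^ 2).
    { apply Rmult_le_pos; [apply pow_le; lra|apply pow2_ge_0]. }
    simpl (16 ^ S k). lra.
Qed.

(** Any factor growing at most like 16^k, such as k^4 <= (2^k)^4, is paid for by shrinking the
    radius from 1/2 to 1/32. This is harmless because the expansion is used only near 0. *)
Lemma bnd_weight M L a (l : nat -> C) : 0 <= L -> bnd (1/2) M a ->
  (forall k, Cmod (l k) <= L * 16 ^ k) -> bnd (1/32) (M * L) (fun k => l k * a k)%C.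
Proof.
  intros HL H Hl k. rewrite Cmod_mult.
  replace ((1/32) ^ k) with ((/ 16) ^ k * (1/2) ^ k).
  2:{ rewrite <- Rpow_mult_distr. f_equal. lra. }
  assert (P : 0 < 16 ^ k) by (apply pow_lt; lra). rewrite pow_inv.
  replace (Cmod (l k) * Cmod (a k) * (/ 16 ^ k * (1/2) ^ k)) with
    (Cmod (a k) * (1/2) ^ k * (Cmod (l k) / 16 ^ k)) by (field; lra).
  apply Rmult_le_compat.
  - apply Rmult_le_pos; [apply Cmod_ge_0|apply pow_le; lra].
  - apply Rdiv_le_0_compat; [apply Cmod_ge_0|exact P].
  - apply H.
  - apply Rle_div_l; [exact P|apply Hl].
Qed.

(** * Products of a polynomial and a power series *)

Lemma csum_zero : csum (fun _ => 0%C) 0%C.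
Proof.
  destruct (csum_dominated (fun _ => 0%C) (fun k => 0 * (1/2) ^ k) (0 * / (1 - 1/2))) as [s [Hs Bs]].
  - intros k. rewrite Cmod_0. lra.
  - apply (is_series_scal 0 (fun k => (1/2) ^ k)). apply is_series_geom. rewrite Rabs_pos_eq; lra.
  - assert (E : s = 0%C) by (apply Cmod_eq_0; generalize (Cmod_ge_0 s); lra).
    now rewrite E in Hs.
Qed.

Definition shiftr (i : nat) (b : nat -> C) (m : nat) : C :=
  if (i <=? m)%nat then b (m - i)%nat else 0%C.

Lemma csum_shiftr i b z s : csum (fun k => b k * z ^ k)%C s ->
  csum (fun k => shiftr i b k * z ^ k)%C (z ^ i * s)%C.
Proof.
  intros H. induction i as [|i IH].
  - eapply csum_ext; [|replace (z ^ 0 * s)%C with s by (simpl; ring); exact H].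
    intros k. unfold shiftr; simpl. now rewrite Nat.sub_0_r.
  - replace (z ^ S i * s)%C with (shiftr (S i) b 0 * z ^ 0 + z * (z ^ i * s))%C
      by (rewrite Cpow_S; unfold shiftr; simpl; ring).
    apply (csum_decr (fun k => shiftr (S i) b k * z ^ k)%C).
    eapply csum_ext; [|exact (csum_scal z _ _ IH)].
    intros k. unfold shiftr; simpl. destruct (i <=? k)%nat; ring.
Qed.

Definition conv (p b : nat -> C) (N m : nat) : C := csumn (fun i => p i * shiftr i b m)%C N.

Lemma csum_conv p b z s N : csum (fun k => b k * z ^ k)%C s ->
  csum (fun m => conv p b N m * z ^ m)%C (csumn (fun i => p i * z ^ i) N * s)%C.
Proof.
  intros H. induction N as [|N IH].
  - eapply csum_ext; [|replace (csumn (fun i => p i * z ^ i)%C 0 * s)%C with (RtoC 0) by (simpl; ring); exact csum_zero].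
    intros k. unfold conv; simpl. ring.
  - replace (csumn (fun i => p i * z ^ i) (S N) * s)%C with
      (csumn (fun i => p i * z ^ i) N * s + p N * (z ^ N * s))%C by (simpl; ring).
    eapply csum_ext; [|exact (csum_plus _ _ _ _ IH (csum_scal (p N) _ _ (csum_shiftr N b z s H)))].
    intros k. unfold conv; simpl. ring.
Qed.

Lemma bnd_shiftr rho M b i : 0 < rho <= 1 -> bnd rho M b -> bnd rho M (shiftr i b).
Proof.
  intros Hr H m. unfold shiftr. destruct (Nat.leb_spec i m) as [L|L].
  - eapply Rle_trans; [|apply (H (m - i)%nat)].
    apply Rmult_le_compat_l; [apply Cmod_ge_0|].
    replace (rho ^ m) with (rho ^ i * rho ^ (m - i)) by (rewrite <- pow_add; f_equal; lia).
    assert (rho ^ i <= 1) by (rewrite <- (pow1 i); apply pow_incr; lra).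
    assert (0 < rho ^ (m - i)) by (apply pow_lt; lra). nra.
  - rewrite Cmod_0, Rmult_0_l. exact (bnd_nonneg _ _ _ H).
Qed.

Lemma bnd_conv rho M p b N : 0 < rho <= 1 -> bnd rho M b -> exists M', bnd rho M' (conv p b N).
Proof.
  intros Hr H. induction N as [|N [M' IH]].
  - exists 0. intros m. unfold conv; simpl. rewrite Cmod_0; lra.
  - exists (M' + Cmod (p N) * M). intros m. unfold conv; simpl.
    apply Rle_trans with ((Cmod (conv p b N m) + Cmod (p N * shiftr N b m)) * rho ^ m).
    + apply Rmult_le_compat_r; [apply pow_le; lra|apply Cmod_triangle].
    + rewrite Cmod_mult, Rmult_plus_distr_r, Rmult_assoc. apply Rplus_le_compat; [apply IH|].
      apply Rmult_le_compat_l; [apply Cmod_ge_0|]. now apply bnd_shiftr.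
Qed.

Lemma bnd_minus rho M M' a b : 0 < rho -> bnd rho M a -> bnd rho M' b ->
  bnd rho (M + M') (fun k => a k - b k)%C.
Proof.
  intros Hr Ha Hb k.
  apply Rle_trans with ((Cmod (a k) + Cmod (b k)) * rho ^ k).
  - apply Rmult_le_compat_r; [apply pow_le; lra|]. rewrite <- (Cmod_opp (b k)). apply Cmod_triangle.
  - rewrite Rmult_plus_distr_r. apply Rplus_le_compat; [apply Ha|apply Hb].
Qed.

Lemma ev_vanishing rho M d z N : bnd rho M d -> Cmod z < rho ->
  (forall m, (m < N)%nat -> d m = 0%C) ->
  ev d z = (z ^ N * ev (fun k => d (N + k)%nat) z)%C.
Proof.
  intros H Hz. assert (Hr : 0 < rho) by (generalize (Cmod_ge_0 z); lra).
  induction N as [|N IH]; intros Hd.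
  - change (fun k => d (0 + k)%nat) with d. simpl. ring.
  - rewrite IH by (intros; apply Hd; lia).
    rewrite (ev_shift _ _ _ _ (bnd_shift _ _ _ N Hr H) Hz).
    rewrite Nat.add_0_r, (Hd N) by lia.
    replace (fun k => d (N + S k)%nat) with (fun k => d (S N + k)%nat).
    + rewrite Cpow_S. ring.
    + apply FunctionalExtensionality.functional_extensionality. intros k. f_equal. lia.
Qed.

Lemma ev_vanishing_bound rho r M d N : bnd rho M d -> 0 <= r < rho ->
  (forall m, (m < N)%nat -> d m = 0%C) ->
  exists K, 0 <= K /\ forall z, Cmod z <= r -> Cmod (ev d z) <= K * Cmod z ^ N.
Proof.
  intros H Hr Hd. exists (M / rho ^ N * rho / (rho - r)).
  assert (Hr0 : 0 < rho) by lra.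
  assert (Hb := bnd_shift _ _ _ N Hr0 H). split.
  - assert (Q := bnd_nonneg _ _ _ Hb). apply Rdiv_le_0_compat; [|lra]. apply Rmult_le_pos; lra.
  - intros z Hz. rewrite (ev_vanishing rho M d z N H) by (lra || assumption).
    rewrite Cmod_mult, Cmod_pow, Rmult_comm. apply Rmult_le_compat_r; [apply pow_le, Cmod_ge_0|].
    apply ev_bound_unif; [exact Hb|lra|exact Hz].
Qed.

Lemma csumn_ext u v n : (forall k, (k < n)%nat -> u k = v k) -> csumn u n = csumn v n.
Proof.
  induction n as [|n IH]; intros H; [reflexivity|]. simpl.
  rewrite IH by (intros; apply H; lia). now rewrite H by lia.
Qed.

Lemma csumn_trunc (u : nat -> C) m n : (m <= n)%nat -> (forall k, (m <= k < n)%nat -> u k = 0%C) -> csumn u n = csumn u m.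
Proof.
  intros L. induction L as [|n L IH]; intros H; [reflexivity|]. simpl.
  rewrite IH by (intros; apply H; lia). rewrite H by lia. ring.
Qed.

Lemma Cmod_csumn u n : Cmod (csumn u n) <= rsum (fun k => Cmod (u k)) n.
Proof.
  induction n as [|n IH]; simpl; [rewrite Cmod_0; lra|].
  eapply Rle_trans; [apply Cmod_triangle|]. lra.
Qed.

Lemma csumn_scal c u n : csumn (fun k => c * u k)%C n = (c * csumn u n)%C.
Proof. induction n as [|n IH]; simpl; [ring|rewrite IH; ring]. Qed.

(* The recursion says that [p] are the Taylor coefficients of 1 + z f''/f', i.e. of z g'/g for g = z f'. *)
Definition log_deriv (b p : nat -> C) (n : nat) : Prop :=
  p O = 1%C /\
  forall m, (m <= n)%nat -> (INR (S m) * b (S m))%C = csumn (fun k => p k * b (S m - k)%nat)%C (S m).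

(** Cutting p after degree n leaves the product with b unchanged up to degree n + 1, because b_0 = 0
    gains one degree. *)
Lemma conv_log_deriv (b p : nat -> C) n m : b O = 0%C -> log_deriv b p n -> (m <= S n)%nat ->
  conv p b (S n) m = (INR m * b m)%C.
Proof.
  intros H0 [P0 Hp] Hm. transitivity (csumn (fun i => p i * shiftr i b m)%C m).
  - apply (csumn_trunc (fun i => p i * shiftr i b m)%C); [lia|].
    intros k Hk. unfold shiftr. destruct (Nat.leb_spec k m).
    + replace (m - k)%nat with O by lia. rewrite H0. ring.
    + ring.
  - destruct m as [|m]; [simpl; ring|]. rewrite (Hp m) by lia.
    apply csumn_ext. intros k Hk. unfold shiftr. destruct (Nat.leb_spec k (S m)); [reflexivity|lia].
Qed.

Lemma bnd_rho_mono r rho M a : 0 <= r <= rho -> bnd rho M a -> bnd r M a.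
Proof.
  intros Hr H k. eapply Rle_trans; [|apply (H k)].
  apply Rmult_le_compat_l; [apply Cmod_ge_0|]. apply pow_incr; lra.
Qed.

(** Coefficients of z f'(z), the Alexander transform of f. *)
Definition logd (a : nat -> C) (k : nat) : C := (INR k * a k)%C.

Lemma Cmod_INR_pow k m : Cmod (INR k ^ m)%C = INR k ^ m.
Proof. rewrite Cmod_pow, Cmod_R, Rabs_pos_eq; [reflexivity|apply pos_INR]. Qed.

(* To second order in [al] the Schwarz function is z - (al^2 / 2) z (1 + z f''/f'). *)
Lemma candidate_error a p n M : bnd (1/2) M a -> a O = 0%C -> log_deriv (logd a) p n ->
  exists K s1, 0 <= K /\ 0 < s1 <= 1 /\ forall al z, 0 <= al <= s1 -> Cmod z <= 1/64 ->
    Cmod (al ^ 2 / 2 * csumn (fun i => p i * z ^ i)%C (S n)) <= 1 /\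
    Cmod (ev a (z * (1 - al ^ 2 / 2 * csumn (fun i => p i * z ^ i)%C (S n))) - ev (hc a al) z)
      <= K * (al ^ 2 * Cmod z ^ S (S n) + al ^ 4).
Proof.
  intros HM H0 Hp. set (b := logd a).
  assert (HM0 := bnd_nonneg _ _ _ HM).
  assert (Ba : bnd (1/32) M a) by (apply bnd_rho_mono with (1/2); [lra|exact HM]).
  assert (Bb : bnd (1/32) M b).
  { replace M with (M * 1) by ring. apply (bnd_weight M 1 a (fun k => RtoC (INR k))); [lra|exact HM|].
    intros k. rewrite Cmod_R, Rabs_pos_eq by apply pos_INR. generalize (proj1 (INR_pow_le_16 k)); lra. }
  set (kb := fun k => (INR k ^ 2 * a k)%C).
  assert (Bk : bnd (1/32) M kb).
  { replace M with (M * 1) by ring. apply (bnd_weight M 1 a (fun k => (INR k ^ 2)%C)); [lra|exact HM|].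
    intros k. rewrite Cmod_INR_pow. generalize (proj2 (INR_pow_le_16 k)); lra. }
  set (P := fun z => csumn (fun i => p i * z ^ i)%C (S n)).
  set (P0 := rsum (fun i => Cmod (p i)) (S n)).
  assert (HP : forall z, Cmod z <= 1/64 -> Cmod (P z) <= P0).
  { intros z Hz. eapply Rle_trans; [apply Cmod_csumn|]. apply rsum_le. intros i _.
    rewrite Cmod_mult, Cmod_pow. rewrite <- (Rmult_1_r (Cmod (p i))) at 2.
    apply Rmult_le_compat_l; [apply Cmod_ge_0|]. rewrite <- (pow1 i).
    apply pow_incr. split; [apply Cmod_ge_0|lra]. }
  assert (HP0 : 0 <= P0).
  { eapply Rle_trans; [apply Cmod_ge_0|apply (HP 0%C)]. rewrite Cmod_0; lra. }
  destruct (bnd_conv (1/32) M p b (S n) ltac:(lra) Bb) as [M' HM'].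
  assert (Bd := bnd_minus (1/32) _ _ _ _ ltac:(lra) HM' Bk).
  (* Coefficients of P(z) z f' - z (z f')'. They vanish up to degree n + 1 by the recursion for p,
     hence the factor |z|^(n+2) in the error. *)
  set (d := fun k => (conv p b (S n) k - kb k)%C) in *.
  destruct (ev_vanishing_bound (1/32) (1/64) _ d (S (S n)) Bd) as [K1 [HK1 VK]]; [lra| |].
  { intros m Hm. unfold d. rewrite (conv_log_deriv b p n m) by (try lia; try exact Hp; unfold b, logd; simpl; rewrite H0; ring).
    unfold kb, b, logd. ring. }
  exists (K1 + M * P0 ^ 2 + 2 * M), (/ (P0 + 1)).
  assert (Hs1 : 0 < / (P0 + 1) <= 1).
  { split; [apply Rinv_0_lt_compat; lra|]. rewrite <- Rinv_1. apply Rinv_le_contravar; lra. }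
  split; [generalize (pow2_ge_0 P0); intros; nra|]. split; [exact Hs1|].
  intros al z Hal Hz. fold (P z).
  set (s := al ^ 2 / 2).
  assert (Hs : 0 <= s) by (unfold s; generalize (pow2_ge_0 al); lra).
  assert (Es : (al ^ 2 / 2)%C = RtoC s) by (unfold s; now rewrite RtoC_div, RtoC_pow).
  rewrite Es.
  assert (HsP : s * P0 <= 1).
  { assert (al * (P0 + 1) <= 1) by (apply (Rle_div_r al 1); lra).
    unfold s. nra. }
  set (y := (- (s * P z))%C).
  assert (Ey : Cmod y <= s * P0).
  { unfold y. rewrite Cmod_opp, Cmod_mult, Cmod_R, Rabs_pos_eq by exact Hs.
    apply Rmult_le_compat_l; [exact Hs|now apply HP]. }
  assert (Hy : Cmod y <= 1) by lra.
  split. { unfold y in Hy. rewrite Cmod_opp in Hy. exact Hy. }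
  assert (Hy0 := Cmod_ge_0 y).
  replace (1 - s * P z)%C with (1 + y)%C by (unfold y; ring).
  assert (Hz2 : Cmod (z * (1 + y)) < 1/2).
  { rewrite Cmod_mult. assert (Q := Cmod_1_plus _ _ Hy). generalize (Cmod_ge_0 z) (Cmod_ge_0 (1 + y)).
    intros. nra. }
  assert (Hz3 : Cmod z < 1/32) by lra.
  assert (Bc1 : bnd (1/32) (M * Cmod y ^ 2) (fun k => ((1 + y) ^ k - 1 - INR k * y) * a k)%C).
  { apply bnd_weight; [apply pow2_ge_0|exact HM|]. intros k. rewrite Rmult_comm. now apply binomial_linear. }
  assert (Bc2 : bnd (1/32) (M * al ^ 4) (fun k => (cos (INR k * al) - 1 + (INR k * al) ^ 2 / 2)%R * a k)%C).
  { apply bnd_weight; [apply pow_le; lra|exact HM|]. intros k. rewrite Cmod_R.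
    eapply Rle_trans; [apply cos_quadratic|]. rewrite Rpow_mult_distr, Rmult_comm.
    apply Rmult_le_compat_l; [apply pow_le; lra|apply INR_pow4]. }
  set (c1 := fun k => (((1 + y) ^ k - 1 - INR k * y) * a k)%C) in *.
  set (c2 := fun k => ((cos (INR k * al) - 1 + (INR k * al) ^ 2 / 2)%R * a k)%C) in *.
  assert (Sa := proj1 (ev_spec _ _ _ _ Ba Hz3)).
  assert (Sb := proj1 (ev_spec _ _ _ _ Bb Hz3)).
  assert (Sk := proj1 (ev_spec _ _ _ _ Bk Hz3)).
  assert (S1 := proj1 (ev_spec _ _ _ _ Bc1 Hz3)).
  assert (S2 := proj1 (ev_spec _ _ _ _ Bc2 Hz3)).
  assert (E1 : ev a (z * (1 + y)) = (ev a z + y * ev b z + ev c1 z)%C).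
  { apply csum_ev. eapply csum_ext; [|exact (csum_plus _ _ _ _ (csum_plus _ _ _ _ Sa (csum_scal y _ _ Sb)) S1)].
    intros k. unfold c1, b, logd. cbv beta. rewrite Cpow_mult_l. ring. }
  assert (E2 : ev (hc a al) z = (ev a z + (- s)%R * ev kb z + ev c2 z)%C).
  { apply csum_ev. eapply csum_ext; [|exact (csum_plus _ _ _ _ (csum_plus _ _ _ _ Sa (csum_scal (- s)%R _ _ Sk)) S2)].
    intros k. unfold c2, kb, hc, s. cbv beta. rewrite <- RtoC_pow.
    transitivity (((1 + - (al ^ 2 / 2) * INR k ^ 2 + (cos (INR k * al) - 1 + (INR k * al) ^ 2 / 2))%R) * a k * z ^ k)%C.
    - rewrite !RtoC_plus, !RtoC_mult. ring.
    - do 3 f_equal. field. }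
  assert (E3 : ev d z = (P z * ev b z - ev kb z)%C).
  { apply csum_ev. replace (P z * ev b z - ev kb z)%C with (P z * ev b z + - (1) * ev kb z)%C by ring.
    eapply csum_ext; [|exact (csum_plus _ _ _ _ (csum_conv p b z _ (S n) Sb) (csum_scal (- (1))%C _ _ Sk))].
    intros k. unfold d. cbv beta. ring. }
  (* The terms of order al^2, y z f' + s z (z f')', combine into -s times the series [d]; [c1] and
     [c2] are the second-order remainders of the power and of the cosine, both O(al^4). *)
  assert (E : (ev a (z * (1 + y)) - ev (hc a al) z)%C = (- (s * ev d z) + ev c1 z - ev c2 z)%C).
  { rewrite E1, E2, E3. unfold y. rewrite RtoC_opp. ring. }
  rewrite E.
  assert (V1 := ev_bound_unif (1/32) (1/64) _ _ z Bc1 ltac:(lra) Hz).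
  assert (V2 := ev_bound_unif (1/32) (1/64) _ _ z Bc2 ltac:(lra) Hz).
  replace (M * Cmod y ^ 2 * (1 / 32) / (1 / 32 - 1 / 64)) with (2 * M * Cmod y ^ 2) in V1 by field.
  replace (M * al ^ 4 * (1 / 32) / (1 / 32 - 1 / 64)) with (2 * M * al ^ 4) in V2 by field.
  assert (V3 := VK z Hz).
  eapply Rle_trans; [apply Cmod_triangle|]. rewrite Cmod_opp.
  eapply Rle_trans; [apply Rplus_le_compat_r, Cmod_triangle|].
  rewrite Cmod_opp, Cmod_mult, Cmod_R, Rabs_pos_eq by exact Hs.
  assert (V4 : Cmod y ^ 2 <= al ^ 4 / 4 * P0 ^ 2).
  { replace (al ^ 4 / 4 * P0 ^ 2) with ((s * P0) ^ 2) by (unfold s; field). apply pow_incr; lra. }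
  set (zz := Cmod z ^ S (S n)) in *.
  assert (Hzz : 0 <= zz) by (apply pow_le, Cmod_ge_0).
  assert (Ha4 : 0 <= al ^ 4) by (apply pow_le; lra).
  assert (Ha2 : 0 <= al ^ 2) by (apply pow_le; lra).
  assert (V5 : s * Cmod (ev d z) <= al ^ 2 * (K1 * zz)).
  { apply Rmult_le_compat; [exact Hs|apply Cmod_ge_0|unfold s; lra|exact V3]. }
  assert (V6 : 2 * M * Cmod y ^ 2 <= M * P0 ^ 2 * al ^ 4).
  { assert (M * Cmod y ^ 2 <= M * (al ^ 4 / 4 * P0 ^ 2)) by (apply Rmult_le_compat_l; assumption).
    assert (0 <= M * P0 ^ 2 * al ^ 4).
    { apply Rmult_le_pos; [apply Rmult_le_pos; [exact HM0|apply pow2_ge_0]|exact Ha4]. }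
    lra. }
  assert (V7 : 0 <= (M * P0 ^ 2 + 2 * M) * (al ^ 2 * zz)).
  { apply Rmult_le_pos; [generalize (pow2_ge_0 P0); intros; nra|now apply Rmult_le_pos]. }
  assert (V8 : 0 <= K1 * al ^ 4) by now apply Rmult_le_pos.
  lra.
Qed.

(** * Local estimates at the origin *)

Lemma ev_at_0 rho M a : 0 < rho -> bnd rho M a -> ev a 0 = a O.
Proof.
  intros Hr H. rewrite (ev_shift rho M) by (rewrite ?Cmod_0; assumption). ring.
Qed.

Lemma df_at_0 rho M a : 0 < rho -> bnd rho M a -> df a 0 = a 1%nat.
Proof.
  intros Hr H. unfold df.
  rewrite (ev_at_0 rho _ _ Hr (bnd_dv rho M a 0 H ltac:(rewrite Cmod_0; exact Hr))).
  unfold dv. now rewrite (ev_at_0 rho _ _ Hr (bnd_shift rho M a 1 Hr H)).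
Qed.

(** Since f'(0) = 1, on |z| <= r the map f differs from the identity by a Lipschitz error of at most
    (2 K + L) r <= 1/2. This turns closeness of values of f into closeness of points, with r
    independent of al. *)
Lemma lower_lipschitz a M : bnd (1/2) M a -> a 1%nat = 1%C ->
  exists r, 0 < r /\ forall u v, Cmod u <= r -> Cmod v <= r ->
    Cmod (u - v) <= 2 * Cmod (ev a u - ev a v).
Proof.
  intros HM H1.
  destruct (ev_taylor (1/2) (1/4) M a HM ltac:(lra)) as [K [HK T]].
  destruct (df_lip (1/2) (1/4) M a HM ltac:(lra)) as [L [HL D]].
  set (r := Rmin (1/4) (/ (4 * (K + L + 1)))).
  assert (Hr : 0 < r).
  { apply Rmin_glb_lt; [lra|]. apply Rinv_0_lt_compat; lra. }
  assert (Hr1 : r <= 1/4) by apply Rmin_l.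
  assert (Hr2 : r * (4 * (K + L + 1)) <= 1).
  { assert (Q : r <= / (4 * (K + L + 1))) by apply Rmin_r.
    apply (Rle_div_r r 1); lra. }
  exists r. split; [exact Hr|]. intros u v Hu Hv.
  assert (T1 := T u v ltac:(lra) ltac:(lra)).
  assert (D1 := D v 0%C ltac:(lra) ltac:(rewrite Cmod_0; lra)).
  rewrite (df_at_0 (1/2) M) in D1 by (lra || assumption). rewrite H1 in D1.
  replace (v - 0)%C with v in D1 by ring.
  set (X := Cmod (u - v)) in *. assert (HX : 0 <= X) by apply Cmod_ge_0.
  assert (X2 : X <= 2 * r).
  { unfold X, Cminus. eapply Rle_trans; [apply Cmod_triangle|]. rewrite Cmod_opp. lra. }
  assert (E : X <= Cmod (ev a u - ev a v) + Cmod (ev a u - ev a v - df a v * (u - v)) + Cmod (df a v - 1) * X).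
  { assert (Eq : (u - v)%C = ((ev a u - ev a v) + - (ev a u - ev a v - df a v * (u - v))
      + - ((df a v - 1) * (u - v)))%C) by ring.
    apply (f_equal Cmod) in Eq. fold X in Eq. eapply Rle_trans; [right; exact Eq|].
    eapply Rle_trans; [apply Cmod_triangle|]. rewrite Cmod_opp, (Cmod_mult (df a v - 1)). fold X.
    apply Rplus_le_compat_r. eapply Rle_trans; [apply Cmod_triangle|]. rewrite Cmod_opp. lra. }
  assert (K * X ^ 2 <= K * (2 * r) * X).
  { replace (X ^ 2) with (X * X) by ring. rewrite <- Rmult_assoc.
    apply Rmult_le_compat_r; [exact HX|]. now apply Rmult_le_compat_l. }
  assert (Cmod (df a v - 1) * X <= L * r * X).
  { apply Rmult_le_compat_r; [exact HX|]. eapply Rle_trans; [exact D1|]. now apply Rmult_le_compat_l. }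
  assert ((2 * K * r + L * r) * X <= 1/2 * X) by (apply Rmult_le_compat_r; [exact HX|nra]).
  lra.
Qed.

(** The mean is small near 0 uniformly in al, the local inverse at 0 gives it a small preimage, and
    injectivity identifies that preimage with [om] z. The uniformity lets al be chosen after the
    radius. *)
Lemma omega_small a : disk_coeffs a -> disk_injective a -> a O = 0%C ->
  forall e, 0 < e -> exists r, 0 < r /\ forall al (om : C -> C),
    (forall z, Cmod z < 1 -> Cmod (om z) < 1 /\ ev a (om z) = ev (hc a al) z) ->
    forall z, Cmod z <= r -> Cmod (om z) <= e.
Proof.
  intros Ha Hinj H0 e He.
  assert (Z1 : Cmod 0 < 1) by (rewrite Cmod_0; lra).
  destruct (local_inverse a 0 1 Ha Z1 (df_neq_0 a 0 Ha Hinj Z1) Rlt_0_1) as [d [Hd LI]].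
  destruct (Ha (1/2) ltac:(lra)) as [M HM].
  destruct (ev_lip (1/2) (1/4) M a HM ltac:(lra)) as [K [HK Lip]].
  assert (F0 : ev a 0 = 0%C) by (rewrite (ev_at_0 (1/2) M); [exact H0|lra|exact HM]).
  rewrite F0 in LI.
  set (D := df a 0) in *.
  assert (HD : 0 < Cmod D) by (apply Cmod_gt_0, df_neq_0; assumption).
  set (Q := 1 + / Cmod D).
  assert (HQ : 1 <= Q) by (unfold Q; generalize (Rinv_0_lt_compat _ HD); lra).
  set (m := Rmin d (e / Q)).
  assert (Hm : 0 < m) by (apply Rmin_glb_lt; [lra|apply Rdiv_lt_0_compat; lra]).
  exists (Rmin (1/4) (m / (K + 1))). split.
  { apply Rmin_glb_lt; [lra|]. apply Rdiv_lt_0_compat; lra. }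
  intros al om Hom z Hz.
  assert (L1 := Rle_trans _ _ _ Hz (Rmin_l _ _)).
  assert (L2 := Rle_trans _ _ _ Hz (Rmin_r _ _)). apply Rle_div_r in L2; [|lra].
  destruct (Hom z ltac:(lra)) as [Hw Ew].
  assert (Bf : forall t, Cmod (ev a (cis t * z)) <= K * Cmod z).
  { intros t. assert (Et : Cmod (cis t * z) = Cmod z) by (rewrite Cmod_mult, Cmod_cis; ring).
    assert (B := Lip (cis t * z)%C 0%C ltac:(lra) ltac:(rewrite Cmod_0; lra)).
    rewrite F0 in B. replace (ev a (cis t * z) - 0)%C with (ev a (cis t * z)) in B by ring.
    replace (cis t * z - 0)%C with (cis t * z)%C in B by ring. now rewrite Et in B. }
  set (h := ev (hc a al) z) in *.
  assert (Bh : Cmod h <= K * Cmod z).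
  { unfold h. rewrite hc_mean by (assumption || lra). rewrite Cmod_mult.
    replace (Cmod (/ 2)) with (/ 2).
    2:{ rewrite Cmod_inv, Cmod_R, Rabs_pos_eq; [reflexivity|lra|]. intros F; injection F; lra. }
    assert (T := Cmod_triangle (ev a (cis al * z)) (ev a (cis (- al) * z))).
    generalize (Bf al) (Bf (- al)). lra. }
  assert (Hz0 := Cmod_ge_0 z).
  assert (Bm : Cmod h <= m) by lra.
  destruct (LI h) as [x [Hx [Ex Bx]]].
  { replace (h - 0)%C with h by ring. eapply Rle_trans; [exact Bm|apply Rmin_l]. }
  assert (x = om z) by (apply Hinj; [exact Hx|exact Hw|congruence]). subst x.
  replace (om z - 0 - (h - 0) / D)%C with (om z - h / D)%C in Bx by (field; apply Cmod_gt_0; exact HD).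
  replace (h - 0)%C with h in Bx by ring.
  assert (Hm2 : m * Q <= e) by (apply Rle_div_r; [lra|apply Rmin_r]).
  replace (om z) with ((om z - h / D) + h / D)%C by ring.
  eapply Rle_trans; [apply Cmod_triangle|].
  rewrite (Cmod_div h D) by (apply Cmod_gt_0; exact HD).
  assert (Cmod h * Q <= m * Q) by (apply Rmult_le_compat_r; lra).
  unfold Q, Rdiv in *. lra.
Qed.

(** Coefficients of the candidate z (1 - s P(z)), where s stands for al^2 / 2. *)
Definition weight (s : R) (p : nat -> C) (i : nat) : C :=
  match i with O => 0%C | 1%nat => (1 - s * p O)%C | S j => (- (s * p j))%C end.

Lemma csumn_weight s p z N :
  csumn (fun i => weight s p i * z ^ i)%C (S (S N)) =
  (z * (1 - s * csumn (fun i => p i * z ^ i) (S N)))%C.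
Proof.
  induction N as [|N IH].
  - simpl. ring.
  - change (csumn (fun i => weight s p i * z ^ i)%C (S (S N)) + weight s p (S (S N)) * z ^ (S (S N)) =
      z * (1 - s * (csumn (fun i => p i * z ^ i) (S N) + p (S N) * z ^ S N)))%C.
    rewrite IH. rewrite (Cpow_S z (S N)). simpl weight. ring.
Qed.

(** In the dual Schwarz inequality for the candidate, t0 cancels and the terms of order s form -s
    times the quantity claimed to be nonnegative. Dividing by s leaves an error O(r), and r tends to
    0. *)
Lemma taylor_positive a p n t0 t : disk_coeffs a -> disk_injective a -> mid_convex a ->
  a O = 0%C -> a 1%nat = 1%C -> log_deriv (logd a) p n ->
  (forall x, 0 <= trig t0 t n x) ->
  0 <= t0 + / 2 * rsum (fun k => Re (t k * p (S k))%C) n.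
Proof.
  intros Ha Hinj Hc H0 H1 Hp HT.
  destruct (Ha (1/2) ltac:(lra)) as [M HM].
  destruct (candidate_error a p n M HM H0 Hp) as [K [s1 [HK [Hs1 Err]]]].
  destruct (lower_lipschitz a M HM H1) as [r1 [Hr1 Low]].
  destruct (omega_small a Ha Hinj H0 r1 Hr1) as [r2 [Hr2 Om]].
  set (X := t0 + / 2 * rsum (fun k => Re (t k * p (S k))%C) n).
  set (S0 := Rabs t0 + rsum (fun k => Cmod (t k)) n).
  (* Respectively: the range of the expansion; the candidate, of modulus at most 2 r, stays where
     [lower_lipschitz] applies; so does [om]; and al <= s1, because al^2 <= r. *)
  set (rm := Rmin (Rmin (1/64) (r1 / 2)) (Rmin r2 (s1 * s1))).
  assert (Hrm : 0 < rm).
  { repeat apply Rmin_glb_lt; try lra. apply Rmult_lt_0_compat; lra. }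
  assert (Main : forall r, 0 < r <= rm -> - (8 * S0 * K) * r <= X).
  { intros r Hr.
    assert (L1 : r <= 1/64) by (eapply Rle_trans; [apply Hr|eapply Rle_trans; [apply Rmin_l|apply Rmin_l]]).
    assert (L2 : r <= r1 / 2) by (eapply Rle_trans; [apply Hr|eapply Rle_trans; [apply Rmin_l|apply Rmin_r]]).
    assert (L3 : r <= r2) by (eapply Rle_trans; [apply Hr|eapply Rle_trans; [apply Rmin_r|apply Rmin_l]]).
    assert (L4 : r <= s1 * s1) by (eapply Rle_trans; [apply Hr|eapply Rle_trans; [apply Rmin_r|apply Rmin_r]]).
    (* On |z| = r with al^2 = r^(n+2), the error of the expansion is O(r * al^2 * r^(n+1)),
       hence negligible in the coefficients of degree at most n + 1. *)
    set (q := r ^ S (S n)).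
    assert (Hq : 0 < q) by (apply pow_lt; lra).
    assert (Hqr : q <= r).
    { unfold q. simpl. assert (r * r ^ n <= 1 * 1); [|nra].
      apply Rmult_le_compat; try lra; [apply pow_le; lra|]. rewrite <- (pow1 n). apply pow_incr; lra. }
    set (al := sqrt q).
    assert (Hal : 0 <= al <= s1).
    { split; [apply sqrt_pos|]. rewrite <- (sqrt_Rsqr s1) by lra. apply sqrt_le_1_alt. unfold Rsqr. lra. }
    assert (Eal : al ^ 2 = q) by (apply pow2_sqrt; lra).
    assert (Eal4 : al ^ 4 = q * q) by (replace (al ^ 4) with (al ^ 2 * al ^ 2) by ring; now rewrite Eal).
    set (s := q / 2).
    destruct (omega_exists a Ha al Hc) as [om Hom].
    assert (Om0 : om 0 = 0%C).
    { destruct (Hom 0%C ltac:(rewrite Cmod_0; lra)) as [A B]. apply Hinj; [exact A|rewrite Cmod_0; lra|].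
      rewrite B. rewrite (ev_at_0 (1/2) M a) by (lra || assumption).
      rewrite (ev_at_0 (1/2) M (hc a al)) by (lra || (apply hc_coeffs; [lra|assumption])).
      unfold hc. rewrite H0. ring. }
    assert (App : forall x, Cmod (om (r * cis x)%C - csumn (fun i => weight s p i * (r * cis x) ^ i)%C (S (S n))) <= 4 * K * (q * q)).
    { intros x. rewrite csumn_weight.
      set (z := (r * cis x)%C).
      assert (Ez : Cmod z = r) by (unfold z; rewrite Cmod_rcis, Rabs_pos_eq; lra).
      destruct (Err al z Hal ltac:(lra)) as [E1 E2].
      assert (Es : (al ^ 2 / 2)%C = RtoC s).
      { unfold s. rewrite <- Eal. now rewrite RtoC_div, RtoC_pow. }
      rewrite Es in E1, E2. rewrite Eal, Eal4, Ez in E2. fold q in E2.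
      set (P := csumn (fun i => p i * z ^ i)%C (S n)) in *.
      eapply Rle_trans; [apply Low|].
      - apply (Om al om Hom). lra.
      - rewrite Cmod_mult, Ez. assert (T : Cmod (1 - s * P) <= 2).
        { unfold Cminus. eapply Rle_trans; [apply Cmod_triangle|]. rewrite Cmod_opp, Cmod_1. lra. }
        nra.
      - rewrite (proj2 (Hom z ltac:(lra))). rewrite Cmod_sub_sym. lra. }
    assert (CP' := coeff_positive om (dom a al om)
       (omega_cder a Ha Hinj al om Hom) (dom_ccont a Ha Hinj al om Hom) Om0
       (fun z Hz => Rlt_le _ _ (proj1 (Hom z Hz))) t0 t n (weight s p) r (4 * K * (q * q)) HT ltac:(lra) App).
    change (weight s p 1) with (1 - s * p O)%C in CP'.
    rewrite (proj1 Hp) in CP'.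
    replace (Re (1 - s * 1)) with (1 - s) in CP' by (simpl; ring).
    rewrite (rsum_ext _ (fun k => - s * Re (t k * p (S k))%C)) in CP'.
    2:{ intros k _. simpl; unfold Re, Im; ring. }
    rewrite rsum_scal in CP'. fold S0 in CP'.
    replace (4 * K * (q * q) / r ^ S n) with (4 * K * q * r) in CP'.
    2:{ unfold q at 2. simpl. field. split; [apply pow_nonzero|]; lra. }
    apply Rmult_le_reg_l with s; [unfold s; lra|]. unfold X.
    replace (s * (- (8 * S0 * K) * r)) with (- (S0 * (4 * K * q * r))) by (unfold s; field).
    lra. }
  apply Rnot_lt_le. intros Neg.
  assert (HS0 : 0 <= S0).
  { unfold S0. apply Rplus_le_le_0_compat; [apply Rabs_pos|].
    apply Rle_trans with (rsum (fun _ => 0 * 0) n); [rewrite rsum_scal; lra|].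
    apply rsum_le. intros; rewrite Rmult_0_l; apply Cmod_ge_0. }
  set (W := 8 * S0 * K). assert (HW : 0 <= W) by (unfold W; repeat apply Rmult_le_pos; lra).
  fold W in Main.
  set (r := Rmin rm (- X / (2 * (W + 1)))).
  assert (Hr : 0 < r).
  { apply Rmin_glb_lt; [exact Hrm|]. apply Rdiv_lt_0_compat; lra. }
  assert (Hr' : r * (2 * (W + 1)) <= - X) by (apply Rle_div_r; [lra|apply Rmin_r]).
  assert (Q := Main r (conj Hr (Rmin_l _ _))). nra.
Qed.

(** * Coefficients of starlike functions *)

(* Finite-order form of Re (1 + p_1 z + p_2 z^2 + ...) >= 0. *)
Definition herglotz (p : nat -> C) (n : nat) : Prop :=
  forall t0 t, (forall x, 0 <= trig t0 t n x) ->
    0 <= t0 + / 2 * rsum (fun k => Re (t k * p (S k))%C) n.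

Lemma rsum_head u n : rsum u (S n) = u O + rsum (fun k => u (S k)) n.
Proof. induction n as [|n IH]; [simpl; ring|]. change (rsum u (S n) + u (S n) = u O + (rsum (fun k => u (S k)) n + u (S n))). rewrite IH. ring. Qed.

Lemma csumn_head u n : csumn u (S n) = (u O + csumn (fun k => u (S k)) n)%C.
Proof. induction n as [|n IH]; [simpl; ring|]. change (csumn u (S n) + u (S n) = u O + (csumn (fun k => u (S k)) n + u (S n)))%C. rewrite IH. ring. Qed.

Lemma csumn_plus u v n : csumn (fun k => u k + v k)%C n = (csumn u n + csumn v n)%C.
Proof. induction n as [|n IH]; simpl; [ring|rewrite IH; ring]. Qed.

Lemma rsum_const0 n : rsum (fun _ => 0) n = 0.
Proof. induction n as [|n IH]; simpl; [reflexivity|rewrite IH; ring]. Qed.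

Lemma rsum_nonneg u n : (forall k, (k < n)%nat -> 0 <= u k) -> 0 <= rsum u n.
Proof. intros H. rewrite <- (rsum_const0 n). now apply rsum_le. Qed.

Lemma rsum_single (f : nat -> R) j n : (j < n)%nat ->
  rsum (fun k => if Nat.eq_dec k j then f k else 0) n = f j.
Proof.
  intros H. induction n as [|n IH]; [lia|]. simpl.
  destruct (Nat.eq_dec n j) as [->|N].
  - rewrite (rsum_ext _ (fun _ => 0)); [rewrite rsum_const0; ring|].
    intros k Hk. destruct (Nat.eq_dec k j); [lia|reflexivity].
  - rewrite IH by lia. ring.
Qed.

Lemma rsum_rev u m : rsum (fun k => u (m - 1 - k)%nat) m = rsum u m.
Proof.
  revert u. induction m as [|m IH]; intros u; [reflexivity|].
  rewrite rsum_head. rewrite (rsum_ext _ (fun k => u (m - 1 - k)%nat)).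
  - rewrite IH. simpl. rewrite !Nat.sub_0_r. ring.
  - intros k Hk. f_equal. lia.
Qed.

Lemma Cmod_sq (z : C) : Cmod z ^ 2 = Re z ^ 2 + Im z ^ 2.
Proof. apply Cmod2_alt. Qed.

Lemma freq_single (c : C) j n (q : nat -> C) : (j < n)%nat ->
  rsum (fun k => Re ((if Nat.eq_dec k j then c else 0%C) * q k)%C) n = Re (c * q j)%C.
Proof.
  intros H. rewrite <- (rsum_single (fun k => Re (c * q k)%C) j n H).
  apply rsum_ext. intros k _. destruct (Nat.eq_dec k j); [reflexivity|].
  simpl; unfold Re, Im; simpl; ring.
Qed.

(** Test polynomial 1 - Re(u e^{-ikx}), with u turning p_k onto the positive axis. *)
Lemma herglotz_bound p n k : herglotz p n -> (1 <= k <= n)%nat -> Cmod (p k) <= 2.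
Proof.
  intros H Hk. destruct k as [|j]; [lia|].
  destruct (unit_align (p (S j))) as [u [Hu Eu]].
  assert (Q := H 1 (fun i => if Nat.eq_dec i j then (- u)%C else 0%C)).
  cbv beta in Q. rewrite (freq_single (- u)%C j n (fun i => p (S i))) in Q by lia.
  replace (Re (- u * p (S j))) with (- Cmod (p (S j))) in Q.
  2:{ rewrite <- Eu. simpl; unfold Re, Im; simpl; ring. }
  assert (0 <= 1 + / 2 * - Cmod (p (S j))); [apply Q|lra].
  intros x. unfold trig. rewrite (freq_single (- u)%C j n (fun i => cis (- INR (S i) * x))) by lia.
  assert (B := Re_le_Cmod (u * cis (- INR (S j) * x))%C).
  rewrite Cmod_mult, Hu, Cmod_cis in B.
  replace (Re (- u * cis (- INR (S j) * x))%C) with (- Re (u * cis (- INR (S j) * x))%C); [lra|].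
  simpl; unfold Re, Im; simpl; ring.
Qed.

Lemma unit_pow_dist (v : C) k : Cmod v = 1 -> Cmod (v ^ k - 1) <= INR k * Cmod (v - 1).
Proof.
  intros Hv. induction k as [|k IH].
  - simpl. replace (1 - 1)%C with (RtoC 0) by ring. rewrite Cmod_0. lra.
  - rewrite S_INR. replace (v ^ S k - 1)%C with (v * (v ^ k - 1) + (v - 1))%C by (rewrite Cpow_S; ring).
    eapply Rle_trans; [apply Cmod_triangle|]. rewrite Cmod_mult, Hv. lra.
Qed.

Lemma unit_dist_sq (v : C) : Cmod v = 1 -> Cmod (v - 1) ^ 2 = 2 * (1 - Re v).
Proof.
  intros Hv. assert (E := Cmod_sq v). rewrite Hv in E. rewrite Cmod_sq.
  replace (Re (v - 1)) with (Re v - 1) by reflexivity.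
  replace (Im (v - 1)) with (Im v) by (simpl; unfold Im; ring). lra.
Qed.

(** The square of |v^k - 1| <= k |v - 1|, as |v - 1|^2 = 2 (1 - Re v) on the unit circle. *)
Lemma unit_pow_re (v : C) k : Cmod v = 1 -> 1 - Re (v ^ k)%C <= INR k ^ 2 * (1 - Re v).
Proof.
  intros Hv. assert (Hk : Cmod (v ^ k) = 1) by (rewrite Cmod_pow, Hv; apply pow1).
  assert (A := unit_dist_sq v Hv). assert (B := unit_dist_sq _ Hk).
  assert (D := unit_pow_dist v k Hv).
  assert (Cmod (v ^ k - 1) ^ 2 <= (INR k * Cmod (v - 1)) ^ 2).
  { apply pow_incr. split; [apply Cmod_ge_0|exact D]. }
  rewrite Rpow_mult_distr, A, B in H. lra.
Qed.

(** Test polynomial k^2 (1 - Re v) - (1 - Re v^k) with v = u e^{-ix}, nonnegative by [unit_pow_re].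
    If u p_1 is near 2, it forces every u^k p_k to be near 2. *)
Lemma herglotz_rigidity p n k u : herglotz p n -> (1 <= k <= n)%nat -> Cmod u = 1 ->
  2 - INR k ^ 2 * (2 - Re (u * p 1%nat)%C) <= Re (u ^ k * p k)%C.
Proof.
  intros H Hk Hu. destruct k as [|j]; [lia|].
  set (K := INR (S j) ^ 2).
  assert (Q := H (K - 1) (fun i => (if Nat.eq_dec i 0 then (- K * u) else 0) + (if Nat.eq_dec i j then u ^ S j else 0))%C).
  assert (E : forall q : nat -> C, rsum (fun i => Re (((if Nat.eq_dec i 0 then (- K * u) else 0) +
     (if Nat.eq_dec i j then u ^ S j else 0)) * q i)%C) n = Re (- K * u * q O)%C + Re (u ^ S j * q j)%C).
  { intros q. rewrite <- (freq_single (- K * u)%C 0 n q) by lia.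
    rewrite <- (freq_single (u ^ S j)%C j n q) by lia.
    rewrite <- rsum_plus. apply rsum_ext. intros i _. rewrite Cmult_plus_distr_r. reflexivity. }
  cbv beta in Q. rewrite (E (fun i => p (S i))) in Q.
  assert (S1 : forall z : C, Re (- K * u * z)%C = - K * Re (u * z)%C).
  { intros z. simpl; unfold Re, Im; simpl; ring. }
  rewrite S1 in Q.
  assert (0 <= K - 1 + / 2 * (- K * Re (u * p 1%nat)%C + Re (u ^ S j * p (S j))%C)); [apply Q|lra].
  intros x. unfold trig. rewrite (E (fun i => cis (- INR (S i) * x))), S1.
  set (v := (u * cis (- INR 1 * x))%C).
  assert (Hv : Cmod v = 1) by (unfold v; rewrite Cmod_mult, Hu, Cmod_cis; ring).
  assert (P := unit_pow_re v (S j) Hv).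
  replace (u ^ S j * cis (- INR (S j) * x))%C with (v ^ S j)%C.
  - fold K in P. lra.
  - unfold v. rewrite Cpow_mult_l, cis_pow. do 2 f_equal. simpl INR at 2. ring.
Qed.

(** In the recursion each new coefficient of p is multiplied by b_1 = 1, so it can be solved for one
    degree at a time. *)
Lemma log_deriv_exists (b : nat -> C) n : b 1%nat = 1%C -> exists p, log_deriv b p n.
Proof.
  intros H1. induction n as [|n [p [P0 Hp]]].
  - exists (fun _ => 1%C). split; [reflexivity|]. intros m Hm. replace m with O by lia. simpl. rewrite H1. ring.
  - set (v := (INR (S (S n)) * b (S (S n)) - csumn (fun k => p k * b (S (S n) - k)%nat) (S n))%C).
    exists (fun k => if Nat.eq_dec k (S n) then v else p k). split; [exact P0|].
    intros m Hm. destruct (Nat.eq_dec m (S n)) as [->|N].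
    + change (csumn ?u (S (S n))) with (csumn u (S n) + u (S n))%C.
      rewrite (csumn_ext _ (fun k => p k * b (S (S n) - k)%nat)%C).
      * cbv beta. destruct (Nat.eq_dec (S n) (S n)) as [_|F]; [|lia].
        replace (S (S n) - S n)%nat with 1%nat by lia. rewrite H1. unfold v. ring.
      * intros k Hk. cbv beta. destruct (Nat.eq_dec k (S n)); [lia|reflexivity].
    + rewrite (Hp m) by lia. apply csumn_ext. intros k Hk. destruct (Nat.eq_dec k (S n)); [lia|reflexivity].
Qed.

Lemma log_deriv_rec (b p : nat -> C) n m : log_deriv b p n -> (m <= n)%nat ->
  (INR m * b (S m))%C = csumn (fun k => p (S k) * b (m - k)%nat)%C m.
Proof.
  intros [P0 Hp] Hm. assert (E := Hp m Hm). rewrite csumn_head, P0, S_INR, RtoC_plus in E.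
  rewrite Nat.sub_0_r in E.
  transitivity ((INR m + 1) * b (S m) - 1 * b (S m))%C; [ring|]. rewrite E. simpl. ring.
Qed.

Lemma rsum_down m : rsum (fun k => INR (m - k)) m = INR m * (INR m + 1) / 2.
Proof.
  induction m as [|m IH]; [simpl; field|].
  rewrite rsum_head. simpl (S m - 0)%nat. change (rsum (fun k => INR (S m - S k)) m) with (rsum (fun k => INR (m - k)) m).
  rewrite IH, !S_INR. field.
Qed.

Section Coefficients.
Variables (b p : nat -> C) (n : nat).
Hypotheses (b0 : b O = 0%C) (b1 : b 1%nat = 1%C) (Hb : log_deriv b p n) (Hp : herglotz p n).

(** Induction on m b_{m+1} = sum p_k b_{m+1-k}: with |p_k| <= 2 the right side is at most 2 (1 + ...
    + m) = m (m + 1). *)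
Lemma starlike_coeff_le j : (j <= S n)%nat -> Cmod (b j) <= INR j.
Proof.
  induction j as [j IH] using lt_wf_ind. intros Hj.
  destruct j as [|[|m]].
  - rewrite b0, Cmod_0. simpl; lra.
  - rewrite b1, Cmod_1. simpl; lra.
  - assert (E := log_deriv_rec b p n (S m) Hb ltac:(lia)).
    assert (P : 0 < INR (S m)) by (apply lt_0_INR; lia).
    apply Rmult_le_reg_l with (INR (S m)); [exact P|].
    replace (INR (S m) * Cmod (b (S (S m)))) with (Cmod (INR (S m) * b (S (S m)))).
    2:{ rewrite Cmod_mult, Cmod_R, Rabs_pos_eq; lra. }
    rewrite E. eapply Rle_trans; [apply Cmod_csumn|].
    apply Rle_trans with (rsum (fun k => 2 * INR (S m - k)) (S m)).
    + apply rsum_le. intros k Hk. rewrite Cmod_mult.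
      apply Rmult_le_compat; try apply Cmod_ge_0.
      * apply (herglotz_bound p n); [exact Hp|lia].
      * apply IH; lia.
    + rewrite rsum_scal, rsum_down, !S_INR. right. field.
Qed.

(** The same estimate with |p_1| kept. It multiplies b_{n-1}, whose bound n - 1 is exactly the
    factor of b_n, so the defect 2 - |p_1| survives undiminished. *)
Lemma starlike_coeff_gap : (2 <= n)%nat -> Cmod (b n) <= INR n - (2 - Cmod (p 1%nat)).
Proof.
  intros Hn. destruct n as [|[|m]] eqn:En; [lia|lia|]. rewrite <- En in *.
  assert (E := log_deriv_rec b p n (S m) Hb ltac:(lia)).
  assert (P : 0 < INR (S m)) by (apply lt_0_INR; lia).
  apply Rmult_le_reg_l with (INR (S m)); [exact P|]. rewrite En at 1.
  replace (INR (S m) * Cmod (b (S (S m)))) with (Cmod (INR (S m) * b (S (S m)))).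
  2:{ rewrite Cmod_mult, Cmod_R, Rabs_pos_eq; lra. }
  rewrite E. eapply Rle_trans; [apply Cmod_csumn|].
  rewrite rsum_head.
  assert (A1 : Cmod (p 1%nat * b (S m - 0)%nat) <= Cmod (p 1%nat) * INR (S m)).
  { rewrite Cmod_mult. apply Rmult_le_compat_l; [apply Cmod_ge_0|].
    replace (S m - 0)%nat with (S m) by lia. apply starlike_coeff_le. lia. }
  assert (A2 : rsum (fun k => Cmod (p (S (S k)) * b (S m - S k)%nat)) m <= rsum (fun k => 2 * INR (m - k)) m).
  { apply rsum_le. intros k Hk. rewrite Cmod_mult.
    apply Rmult_le_compat; try apply Cmod_ge_0.
    - apply (herglotz_bound p n); [exact Hp|lia].
    - replace (S m - S k)%nat with (m - k)%nat by lia. apply starlike_coeff_le. lia. }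
  rewrite rsum_scal, rsum_down in A2.
  rewrite En, !S_INR in *. lra.
Qed.
End Coefficients.

(* The Koebe function rotated by [u] has b_j = j u^(1-j) and u p_1 = 2. *)
Lemma near_koebe m : exists K, 0 <= K /\ forall (b p : nat -> C) n u,
  b O = 0%C -> b 1%nat = 1%C -> log_deriv b p n -> herglotz p n -> Cmod u = 1 -> (m <= n)%nat ->
  forall j, (j <= m)%nat ->
    Cmod (b (S j) * u ^ j - INR (S j)) <= K * sqrt (2 - Re (u * p 1%nat)%C).
Proof.
  induction m as [|m [K [HK IH]]].
  - exists 0. split; [lra|]. intros b p n u H0 H1 Hb Hp Hu Hm j Hj. replace j with O by lia.
    rewrite H1. simpl. replace (1 * 1 - 1)%C with (RtoC 0) by ring. rewrite Cmod_0. lra.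
  - set (K' := 2 * INR (S (S m)) * INR (S (S m)) + 2 * K).
    assert (HM := pos_INR (S (S m))).
    exists K'. split; [unfold K'; nra|]. intros b p n u H0 H1 Hb Hp Hu Hm j Hj.
    set (s := sqrt (2 - Re (u * p 1%nat)%C)). assert (Hs : 0 <= s) by apply sqrt_pos.
    assert (KK : K <= K') by (unfold K'; nra).
    destruct (Nat.eq_dec j (S m)) as [->|N].
    2:{ eapply Rle_trans; [apply (IH b p n u); try assumption; lia|]. apply Rmult_le_compat_r; assumption. }
    assert (Hx : 0 <= 2 - Re (u * p 1%nat)%C).
    { assert (B := Re_le_Cmod (u * p 1%nat)%C). rewrite Cmod_mult, Hu in B.
      assert (Q := herglotz_bound p n 1 Hp ltac:(lia)). lra. }
    (* For |q| <= 2 one has |q - 2|^2 <= 4 (2 - Re q), and rigidity bounds 2 - Re q; this is where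
       the square root enters. *)
    assert (HP : forall k, (1 <= k <= S m)%nat -> Cmod (u ^ k * p k - 2) <= 2 * INR k * s).
    { intros k Hk. assert (R1 := herglotz_rigidity p n k u Hp ltac:(lia) Hu).
      assert (R2 := herglotz_bound p n k Hp ltac:(lia)).
      assert (R3 : Cmod (u ^ k * p k) <= 2) by (rewrite Cmod_mult, Cmod_pow, Hu, pow1; lra).
      set (q := (u ^ k * p k)%C) in *.
      assert (R4 : Cmod q ^ 2 <= 4) by (assert (P := Cmod_ge_0 q); nra).
      rewrite Cmod_sq in R4.
      assert (R5 : Cmod (q - 2) ^ 2 <= (2 * INR k * s) ^ 2).
      { replace ((2 * INR k * s) ^ 2) with (4 * INR k ^ 2 * s ^ 2) by ring.
        unfold s. rewrite pow2_sqrt by exact Hx. rewrite Cmod_sq.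
        replace (Re (q - 2)) with (Re q - 2) by reflexivity.
        replace (Im (q - 2)) with (Im q) by (simpl; unfold Im; ring). nra. }
      apply Rsqr_incr_0_var; [unfold Rsqr; simpl in R5; lra|].
      repeat apply Rmult_le_pos; try lra; apply pos_INR. }
    assert (HB : forall i, (1 <= i <= S m)%nat -> Cmod (b i * u ^ (i - 1) - INR i) <= K * s).
    { intros i Hi. destruct i as [|i]; [lia|]. replace (S i - 1)%nat with i by lia.
      apply (IH b p n u); try assumption; lia. }
    assert (HB2 : forall i, (1 <= i <= S m)%nat -> Cmod (b i * u ^ (i - 1)) <= INR i).
    { intros i Hi. rewrite Cmod_mult, Cmod_pow, Hu, pow1, Rmult_1_r.
      apply (starlike_coeff_le b p n); try assumption; lia. }
    assert (E := log_deriv_rec b p n (S m) Hb Hm).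
    assert (P : 0 < INR (S m)) by (apply lt_0_INR; lia).
    (* Subtracts the recursion of the Koebe function, in which each rotated p_k is 2 and each
       rotated b_i is i. *)
    assert (E2 : (INR (S m) * (b (S (S m)) * u ^ S m - INR (S (S m))))%C =
       csumn (fun k => (u ^ S k * p (S k)) * (b (S m - k)%nat * u ^ (S m - k - 1)) - RtoC (2 * INR (S m - k)))%C (S m)).
    { assert (E3 : csumn (fun k => RtoC (2 * INR (S m - k))) (S m) = RtoC (INR (S m) * INR (S (S m)))).
      { assert (G : forall f N, csumn (fun k => RtoC (f k)) N = RtoC (rsum f N)).
        { intros f N. induction N as [|N IN]; [reflexivity|]. simpl. rewrite IN, RtoC_plus. reflexivity. }
        rewrite G, rsum_scal, rsum_down. f_equal. rewrite !S_INR. field. }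
      transitivity (u ^ S m * (INR (S m) * b (S (S m))) - RtoC (INR (S m) * INR (S (S m))))%C.
      { rewrite RtoC_mult. ring. }
      rewrite E, <- E3, <- csumn_scal.
      transitivity (csumn (fun k => u ^ S m * (p (S k) * b (S m - k)%nat)) (S m)
         + (- (1)) * csumn (fun k => RtoC (2 * INR (S m - k))) (S m))%C; [ring|].
      rewrite <- csumn_scal, <- csumn_plus. apply csumn_ext. intros k Hk.
      replace (u ^ S m)%C with (u ^ S k * u ^ (S m - k - 1))%C by (rewrite <- Cpow_add_r; f_equal; lia).
      ring. }
    apply Rmult_le_reg_l with (INR (S m)); [exact P|].
    rewrite <- (Rabs_pos_eq (INR (S m))) at 1 by lra.
    rewrite <- Cmod_R, <- Cmod_mult, E2.
    eapply Rle_trans; [apply Cmod_csumn|].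
    apply Rle_trans with (rsum (fun _ => K' * s * 1) (S m)).
    2:{ rewrite rsum_scal. right.
        assert (G : forall N, rsum (fun _ => 1) N = INR N).
        { induction N as [|N IN]; [reflexivity|]. rewrite S_INR. simpl. rewrite IN. reflexivity. }
        rewrite G. ring. }
    apply rsum_le. intros k Hk.
    set (i := (S m - k)%nat).
    assert (Hi : (1 <= i <= S m)%nat) by (unfold i; lia).
    set (q := (u ^ S k * p (S k))%C). set (B := (b i * u ^ (i - 1))%C).
    rewrite RtoC_mult.
    replace (q * B - 2 * INR i)%C with ((q - 2) * B + 2 * (B - INR i))%C by ring.
    eapply Rle_trans; [apply Cmod_triangle|]. rewrite !Cmod_mult.
    replace (Cmod 2) with 2 by (rewrite Cmod_R, Rabs_pos_eq; lra).
    assert (Y1 : Cmod (q - 2) * Cmod B <= (2 * INR (S (S m)) * s) * INR (S (S m))).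
    { apply Rmult_le_compat; try apply Cmod_ge_0.
      - eapply Rle_trans; [apply HP; lia|]. apply Rmult_le_compat_r; [exact Hs|].
        apply Rmult_le_compat_l; [lra|]. apply le_INR. lia.
      - eapply Rle_trans; [apply HB2; exact Hi|]. apply le_INR. lia. }
    assert (Y2 := HB i Hi). fold B in Y2. unfold K'. lra.
Qed.

(** * Leung's theorem and the upper bound *)

Lemma rsum_cauchy_schwarz u v n :
  (rsum (fun k => u k * v k) n) ^ 2 <= rsum (fun k => u k ^ 2) n * rsum (fun k => v k ^ 2) n.
Proof.
  induction n as [|n IH]; [simpl; lra|]. cbn [rsum].
  set (s := rsum (fun k => u k * v k) n) in *.
  assert (HX : 0 <= rsum (fun k => u k ^ 2) n) by (apply rsum_nonneg; intros; apply pow2_ge_0).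
  assert (HY : 0 <= rsum (fun k => v k ^ 2) n) by (apply rsum_nonneg; intros; apply pow2_ge_0).
  set (X := rsum (fun k => u k ^ 2) n) in *. set (Y := rsum (fun k => v k ^ 2) n) in *.
  assert (Q : 2 * s * (u n * v n) <= X * v n ^ 2 + Y * u n ^ 2).
  { apply Rle_trans with (Rabs (2 * s * (u n * v n))); [apply Rle_abs|].
    apply Rsqr_incr_0_var.
    - rewrite <- Rsqr_abs. unfold Rsqr.
      assert (s ^ 2 * (u n * v n) ^ 2 <= X * Y * (u n * v n) ^ 2) by (apply Rmult_le_compat_r; [apply pow2_ge_0|exact IH]).
      assert (0 <= (X * v n ^ 2 - Y * u n ^ 2) ^ 2) by apply pow2_ge_0. nra.
    - generalize (pow2_ge_0 (u n)) (pow2_ge_0 (v n)). intros. nra. }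
  nra.
Qed.

Lemma exp_le_mono x y : x <= y -> exp x <= exp y.
Proof. intros [H | ->]; [left; now apply exp_increasing|lra]. Qed.

(* [be] are the coefficients of the exponential of the series with k-th coefficient [A k / k]. *)
Lemma lebedev_milin (A be : nat -> C) n : be O = 1%C -> (1 <= n)%nat ->
  (forall m, (1 <= m <= n)%nat ->
     (INR m * be m)%C = csumn (fun k => A (S k) * be (m - 1 - k)%nat)%C m) ->
  Cmod (be n) ^ 2 <= exp (rsum (fun k => (Cmod (A (S k)) ^ 2 - 1) / INR (S k)) n).
Proof.
  intros H0 Hn Hrec.
  set (s := fun m => rsum (fun k => Cmod (be k) ^ 2) m).
  set (a := fun m => rsum (fun k => Cmod (A (S k)) ^ 2) m).
  set (E := fun m => rsum (fun k => (Cmod (A (S k)) ^ 2 - 1) / INR (S k)) m).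
  assert (Ha : forall m, 0 <= a m) by (intros; apply rsum_nonneg; intros; apply pow2_ge_0).
  assert (Hs : forall m, 0 <= s m) by (intros; apply rsum_nonneg; intros; apply pow2_ge_0).
  (* Cauchy-Schwarz applied to the recursion. *)
  assert (CS : forall m, (1 <= m <= n)%nat -> INR m ^ 2 * Cmod (be m) ^ 2 <= a m * s m).
  { intros m Hm. rewrite <- Rpow_mult_distr.
    rewrite <- (Rabs_pos_eq (INR m)) at 1 by apply pos_INR.
    rewrite <- Cmod_R, <- Cmod_mult, (Hrec m Hm).
    apply Rle_trans with (rsum (fun k => Cmod (A (S k)) * Cmod (be (m - 1 - k)%nat)) m ^ 2).
    - apply pow_incr. split; [apply Cmod_ge_0|]. eapply Rle_trans; [apply Cmod_csumn|].
      right. apply rsum_ext. intros k _. apply Cmod_mult.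
    - eapply Rle_trans; [apply rsum_cauchy_schwarz|]. right. unfold a, s. f_equal.
      exact (rsum_rev (fun k => Cmod (be k) ^ 2) m). }
  (* The second Lebedev-Milin inequality: the exponent is the sum of (|A_k|^2 - 1) (1/k - 1/m). In
     the induction 1 + a_m/m^2 = (m+1)/m (1 + dl), where dl is exactly the increment of the exponent
     and 1 + dl <= exp dl. *)
  assert (Main : forall m, (1 <= m <= n)%nat -> s m <= INR m * exp (E m - (a m - INR m) / INR m)).
  { induction m as [|m IH]; intros Hm; [lia|]. destruct m as [|m].
    - unfold s, E, a; simpl. rewrite H0, Cmod_1.
      match goal with |- _ <= 1 * exp ?x => replace x with 0 by field end. rewrite exp_0. lra.
    - set (M := S m) in *. assert (HM : 0 < INR M) by (apply lt_0_INR; unfold M; lia).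
      specialize (IH ltac:(lia)). assert (C := CS M ltac:(unfold M in *; lia)).
      assert (Es : s (S M) = s M + Cmod (be M) ^ 2) by reflexivity.
      assert (B : s (S M) <= s M * (1 + a M / INR M ^ 2)).
      { rewrite Es. assert (Cmod (be M) ^ 2 <= a M * s M / INR M ^ 2).
        { apply (Rle_div_r _ (a M * s M) (INR M ^ 2)); [now apply pow_lt|]. lra. }
        unfold Rdiv in *. lra. }
      set (G := E M - (a M - INR M) / INR M) in *.
      set (dl := (a M - INR M) / (INR M * (INR M + 1))).
      assert (EG : E (S M) - (a (S M) - INR (S M)) / INR (S M) = G + dl).
      { unfold G, dl. change (E (S M)) with (E M + (Cmod (A (S M)) ^ 2 - 1) / INR (S M)).
        change (a (S M)) with (a M + Cmod (A (S M)) ^ 2). rewrite (S_INR M). field. lra. }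
      rewrite EG, exp_plus.
      assert (F : 1 + a M / INR M ^ 2 = (INR M + 1) / INR M * (1 + dl)) by (unfold dl; field; lra).
      assert (Hpos : 0 <= 1 + a M / INR M ^ 2).
      { assert (0 <= a M / INR M ^ 2); [|lra]. apply Rdiv_le_0_compat; [apply Ha|now apply pow_lt]. }
      apply Rle_trans with (INR M * exp G * (1 + a M / INR M ^ 2)).
      { eapply Rle_trans; [exact B|]. apply Rmult_le_compat_r; assumption. }
      rewrite F, (S_INR M).
      replace (INR M * exp G * ((INR M + 1) / INR M * (1 + dl))) with ((INR M + 1) * exp G * (1 + dl)) by (field; lra).
      replace ((INR M + 1) * (exp G * exp dl)) with ((INR M + 1) * exp G * exp dl) by ring.
      apply Rmult_le_compat_l; [|apply exp_ineq1_le].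
      apply Rmult_le_pos; [lra|left; apply exp_pos]. }
  assert (HN : 0 < INR n) by (apply lt_0_INR; lia).
  assert (C := CS n ltac:(lia)). assert (B := Main n ltac:(lia)).
  change (Cmod (be n) ^ 2 <= exp (E n)).
  (* The remaining factor a_n / n = 1 + x is at most exp x, which cancels the correction -x in the
     exponent. *)
  set (x := (a n - INR n) / INR n) in *.
  assert (Ea : a n = INR n * (1 + x)) by (unfold x; field; lra).
  assert (Ex := exp_ineq1_le x).
  assert (E1 : exp (E n) = exp (E n - x) * exp x) by (rewrite <- exp_plus; f_equal; ring).
  rewrite E1.
  apply Rmult_le_reg_l with (INR n ^ 2); [now apply pow_lt|].
  eapply Rle_trans; [exact C|].
  apply Rle_trans with (INR n * exp x * (INR n * exp (E n - x))); [|right; ring].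
  apply Rmult_le_compat; [apply Ha|apply Hs| |exact B].
  rewrite Ea. apply Rmult_le_compat_l; lra.
Qed.

(* Averaging the left-hand side over the rotations [zeta], weighted by the Herglotz
   measure of [p], gives exactly 0. *)
Lemma leung_rotation p n e : herglotz p n -> 0 < e -> exists zeta : C, Cmod zeta = 1 /\
  rsum (fun k => (Cmod (p (S k) - zeta ^ S k) ^ 2 - 1) / INR (S k)) n <= e.
Proof.
  (* If every zeta = e^{-ix} failed, the sum minus e would be a nonnegative trigonometric polynomial
     in x, since |p_k - e^{-ikx}|^2 - 1 = |p_k|^2 - 2 Re(conj(p_k) e^{-ikx}); yet its pairing with p
     is -e. *)
  intros Hp He. apply NNPP. intros Hno.
  set (t0 := rsum (fun k => Cmod (p (S k)) ^ 2 / INR (S k)) n).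
  set (t := fun k => (RtoC (- 2 / INR (S k)) * Cconj (p (S k)))%C).
  assert (Q := Hp (t0 - e) t).
  assert (E : t0 + / 2 * rsum (fun k => Re (t k * p (S k))%C) n = 0).
  { unfold t0. rewrite <- rsum_scal, <- rsum_plus, <- (rsum_const0 n). apply rsum_ext. intros k _.
    unfold t. rewrite Cmod_sq. simpl. unfold Re, Im; simpl. field.
    generalize (pos_INR k); destruct k; simpl; lra. }
  assert (0 <= t0 - e + / 2 * rsum (fun k => Re (t k * p (S k))%C) n); [|lra].
  apply Q. intros x. apply Rnot_lt_le. intros Neg. apply Hno.
  exists (cis (- x)). split; [apply Cmod_cis|].
  assert (E2 : rsum (fun k => (Cmod (p (S k) - cis (- x) ^ S k) ^ 2 - 1) / INR (S k)) n = trig t0 t n x).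
  { unfold trig, t0. rewrite <- rsum_plus. apply rsum_ext. intros k _. unfold t.
    rewrite cis_pow. replace (INR (S k) * - x) with (- INR (S k) * x) by ring.
    assert (U := Cmod_cis (- INR (S k) * x)). apply (f_equal (fun q => q ^ 2)) in U.
    rewrite Cmod_sq in U. rewrite !Cmod_sq.
    set (w := cis (- INR (S k) * x)) in *. set (q := p (S k)).
    replace (Re (q - w)) with (Re q - Re w) by reflexivity.
    replace (Im (q - w)) with (Im q - Im w) by reflexivity.
    replace (Re (RtoC (- 2 / INR (S k)) * Cconj q * w)) with (- 2 / INR (S k) * (Re q * Re w + Im q * Im w))
      by (simpl; unfold Re, Im; ring).
    assert (HK : INR (S k) <> 0) by (generalize (lt_0_INR (S k) ltac:(lia)); lra).
    apply Rmult_eq_reg_r with (INR (S k)); [|exact HK]. field_simplify; [|exact HK|exact HK]. lra. }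
  rewrite E2. unfold trig in *. lra.
Qed.

Section Leung.
Variables (b p : nat -> C) (n : nat).
Hypotheses (b0 : b O = 0%C) (b1 : b 1%nat = 1%C) (Hb : log_deriv b p n) (Hp : herglotz p n).

(** For g = sum b_k z^k, the b_{m+1} - zeta b_m are the coefficients of (1 - zeta z) g(z)/z. Its
    logarithmic derivative times z has coefficients p_k - zeta^k, so it is the exponential of sum
    (p_k - zeta^k) z^k / k. *)
Lemma twisted_rec zeta m : (1 <= m <= n)%nat ->
  (INR m * (b (S m) - zeta * b m))%C =
  csumn (fun k => (p (S k) - zeta ^ S k) * (b (S (m - 1 - k)) - zeta * b (m - 1 - k)%nat))%C m.
Proof.
  intros Hm.
  assert (R1 := log_deriv_rec b p n m Hb ltac:(lia)).
  assert (R2 : (RtoC (INR m - 1) * b m)%C = csumn (fun k => p (S k) * b (m - 1 - k)%nat)%C m).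
  { destruct m as [|m]; [lia|]. rewrite S_INR. replace (INR m + 1 - 1) with (INR m) by ring.
    rewrite (log_deriv_rec b p n m Hb) by lia.
    change (csumn ?u (S m)) with (csumn u m + u m)%C.
    cbv beta. replace (S m - 1 - m)%nat with O by lia. rewrite b0.
    rewrite (csumn_ext (fun k => p (S k) * b (S m - 1 - k)%nat)%C (fun k => p (S k) * b (m - k)%nat)%C).
    - ring.
    - intros k Hk. do 2 f_equal. lia. }
  (* A telescoping sum, closed at full length by b_0 = 0. *)
  assert (R3 : forall M, (M <= m)%nat ->
     csumn (fun k => zeta ^ S k * (b (m - k)%nat - zeta * b (m - 1 - k)%nat))%C M
       = (zeta * b m - zeta ^ S M * b (m - M)%nat)%C).
  { induction M as [|M IM]; intros HM.
    - simpl. rewrite Nat.sub_0_r. ring.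
    - change (csumn ?u (S M)) with (csumn u M + u M)%C. rewrite IM by lia.
      replace (m - 1 - M)%nat with (m - S M)%nat by lia. rewrite !Cpow_S. ring. }
  specialize (R3 m (le_n m)). rewrite Nat.sub_diag, b0 in R3.
  transitivity (csumn (fun k => p (S k) * b (m - k)%nat)%C m + (- zeta) * csumn (fun k => p (S k) * b (m - 1 - k)%nat)%C m
     + (- (1)) * csumn (fun k => zeta ^ S k * (b (m - k)%nat - zeta * b (m - 1 - k)%nat))%C m)%C.
  - rewrite <- R1, <- R2, R3, RtoC_minus. ring.
  - rewrite <- !csumn_scal, <- !csumn_plus. apply csumn_ext. intros k Hk.
    replace (S (m - 1 - k)) with (m - k)%nat by lia. ring.
Qed.

Lemma successive_starlike : (1 <= n)%nat -> Cmod (b n) - Cmod (b (S n)) <= 1.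
Proof.
  intros Hn. apply le_epsilon. intros e He.
  assert (Hl : 0 < ln (1 + e)) by (rewrite <- ln_1; apply ln_increasing; lra).
  (* The tolerance is chosen so that its exponential is (1 + e)^2, bounding a squared modulus. *)
  destruct (leung_rotation p n (2 * ln (1 + e)) Hp) as [zeta [Hz Ez]]; [lra|].
  assert (LM := lebedev_milin (fun k => p k - zeta ^ k)%C (fun m => b (S m) - zeta * b m)%C n).
  cbv beta in LM.
  assert (B : Cmod (b (S n) - zeta * b n) <= 1 + e).
  { apply Rsqr_incr_0_var; [|lra].
    replace (Rsqr (1 + e)) with (exp (2 * ln (1 + e))).
    - eapply Rle_trans; [|apply exp_le_mono, Ez]. unfold Rsqr.
      replace (Cmod (b (S n) - zeta * b n) * Cmod (b (S n) - zeta * b n)) with (Cmod (b (S n) - zeta * b n) ^ 2) by ring.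
      apply LM; [rewrite b0, b1; ring|exact Hn|]. intros m Hm. now apply twisted_rec.
    - replace (2 * ln (1 + e)) with (ln (1 + e) + ln (1 + e)) by ring.
      rewrite exp_plus, exp_ln by lra. reflexivity. }
  assert (T : Cmod (b n) <= Cmod (b (S n)) + Cmod (b (S n) - zeta * b n)).
  { replace (Cmod (b n)) with (Cmod (zeta * b n)) by (rewrite Cmod_mult, Hz; ring).
    rewrite (Cmod_sub_sym (b (S n))).
    replace (zeta * b n)%C with (b (S n) + (zeta * b n - b (S n)))%C at 1 by ring.
    apply Cmod_triangle. }
  lra.
Qed.
End Leung.

(** Put x = 2 - |p_1|. If x >= x0, the defect x/n in |a_n| is the gain. If x < x0, closeness to a
    Koebe function gives (n+1) |a_{n+1}| >= n, so (n+1) times the gap is at most 1. As d depends on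
    n only, the strict bound passes to the supremum. *)
Lemma convex_successive_upper n : (2 <= n)%nat -> exists d, 0 < d /\
  forall a, disk_coeffs a -> disk_injective a -> mid_convex a -> a O = 0%C -> a 1%nat = 1%C ->
    Cmod (a n) - Cmod (a (S n)) <= (2 - d) / INR (n + 1).
Proof.
  intros Hn. destruct (near_koebe n) as [K [HK NK]].
  assert (HN : 2 <= INR n) by (change 2 with (INR 2); now apply le_INR).
  (* Below this threshold K sqrt x <= K/(K+1) <= 1. *)
  set (x0 := / (K + 1) ^ 2).
  assert (Hx0 : 0 < x0 <= 1).
  { unfold x0. assert (1 <= (K + 1) ^ 2) by nra. split; [apply Rinv_0_lt_compat; lra|].
    rewrite <- Rinv_1. apply Rinv_le_contravar; lra. }
  exists (x0 / INR n). split; [apply Rdiv_lt_0_compat; lra|].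
  intros a Ha Hinj Hc H0 H1.
  assert (b0 : logd a 0 = 0%C) by (unfold logd; simpl; ring).
  assert (b1 : logd a 1 = 1%C) by (unfold logd; rewrite H1; simpl; ring).
  destruct (log_deriv_exists (logd a) n b1) as [p Hp].
  assert (HH : herglotz p n).
  { intros t0 t HT. now apply (taylor_positive a p n t0 t). }
  assert (Eb : forall k, Cmod (logd a k) = INR k * Cmod (a k)).
  { intros k. unfold logd. rewrite Cmod_mult, Cmod_R, Rabs_pos_eq by apply pos_INR. reflexivity. }
  assert (G := starlike_coeff_gap (logd a) p n b0 b1 Hp HH Hn).
  assert (L := successive_starlike (logd a) p n b0 b1 Hp HH ltac:(lia)).
  destruct (unit_align (p 1%nat)) as [u [Hu Eu]].
  assert (N := NK (logd a) p n u b0 b1 Hp HH Hu (le_n n) n (le_n n)).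
  rewrite Eu in N.
  assert (HX : 0 <= 2 - Cmod (p 1%nat)) by (generalize (herglotz_bound p n 1 HH ltac:(lia)); lra).
  set (x := 2 - Cmod (p 1%nat)) in *.
  rewrite !Eb in *.
  set (A := Cmod (a n)) in *. set (B := Cmod (a (S n))) in *.
  rewrite Nat.add_1_r. rewrite S_INR in *.
  apply Rle_div_r; [lra|].
  assert (HA : A <= 1 - x / INR n).
  { apply Rmult_le_reg_l with (INR n); [lra|]. field_simplify; lra. }
  (* (n+1)(A - B) is n A - (n+1) B, at most 1 by Leung's inequality, plus A. *)
  assert (X1 : (A - B) * (INR n + 1) <= 2 - x / INR n) by lra.
  assert (Low : INR n + 1 <= (INR n + 1) * B + K * sqrt x).
  { assert (T : Cmod (INR n + 1)%R <= Cmod (logd a (S n) * u ^ n) + Cmod (logd a (S n) * u ^ n - (INR n + 1)%R)).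
    { rewrite (Cmod_sub_sym (logd a (S n) * u ^ n)).
      replace (RtoC (INR n + 1)%R) with (logd a (S n) * u ^ n + ((INR n + 1)%R - logd a (S n) * u ^ n))%C at 1 by ring.
      apply Cmod_triangle. }
    rewrite Cmod_mult, Cmod_pow, Hu, pow1, Eb, S_INR, Cmod_R, Rabs_pos_eq in T by lra. fold B in T. lra. }
  destruct (Rle_lt_dec x0 x) as [Hx|Hx].
  - assert (x0 / INR n <= x / INR n) by (apply Rmult_le_compat_r; [left; apply Rinv_0_lt_compat|]; lra).
    lra.
  - assert (Sx : sqrt x <= / (K + 1)).
    { rewrite <- (sqrt_Rsqr (/ (K + 1))) by (left; apply Rinv_0_lt_compat; lra).
      apply sqrt_le_1_alt. unfold Rsqr. unfold x0 in Hx.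
      replace (/ (K + 1) * / (K + 1)) with (/ (K + 1) ^ 2) by (field; lra). lra. }
    assert (KS : K * sqrt x <= 1).
    { apply Rle_trans with (K * / (K + 1)); [now apply Rmult_le_compat_l|].
      apply (Rle_div_l K 1); lra. }
    assert (A <= 1).
    { assert (0 <= x / INR n) by (apply Rdiv_le_0_compat; lra). lra. }
    assert (x0 / INR n <= 1) by (apply Rle_div_l; lra).
    nra.
Qed.

(** * The strip map *)

(** Taylor coefficients of -log(1 - z). *)
Definition lc (k : nat) : R := match k with O => 0 | S _ => / INR k end.

(* The principal branch of - log (1 - z) on the unit disk. *)
Definition mlog (z : C) : C :=
  (- (1/2) * ln ((1 - Re z) ^ 2 + Im z ^ 2), atan (Im z / (1 - Re z))).

Lemma Re_lt_1 (z : C) : Cmod z < 1 -> Re z < 1.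
Proof. intros H. eapply Rle_lt_trans; [apply Re_le_Cmod|exact H]. Qed.

Lemma one_minus_neq_0 (z : C) : Cmod z < 1 -> (1 - z)%C <> 0%C.
Proof. intros H E. apply Re_lt_1 in H. apply (f_equal Re) in E. unfold Re in *; simpl in E. lra. Qed.

Lemma geom_bound_lim (u : nat -> R) l K q : 0 <= q < 1 ->
  (forall N, Rabs (u N - l) <= K * q ^ N) -> is_lim_seq u l.
Proof.
  intros Hq H.
  assert (G : is_lim_seq (fun N => K * q ^ N) 0).
  { replace (Finite 0) with (Rbar_mult K 0) by (simpl; f_equal; ring).
    apply (is_lim_seq_scal_l (fun N => q ^ N) K 0). apply is_lim_seq_geom. rewrite Rabs_pos_eq; lra. }
  assert (D : is_lim_seq (fun N => u N - l) 0).
  { apply is_lim_seq_abs_0. apply is_lim_seq_le_le with (fun _ => 0) (fun N => K * q ^ N).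
    - intros N. split; [apply Rabs_pos|apply H].
    - apply is_lim_seq_const.
    - exact G. }
  apply is_lim_seq_ext with (fun N => (u N - l) + l); [intros; ring|].
  replace (Finite l) with (Finite (0 + l)) by (f_equal; ring).
  apply is_lim_seq_plus'; [exact D|apply is_lim_seq_const].
Qed.

Lemma sum_n_Re (u : nat -> C) N : sum_n (fun k => Re (u k)) N = Re (csumn u (S N)).
Proof.
  induction N as [|N IH]; [rewrite sum_O; simpl; unfold Re; ring|].
  rewrite sum_Sn, IH. reflexivity.
Qed.

Lemma sum_n_Im (u : nat -> C) N : sum_n (fun k => Im (u k)) N = Im (csumn u (S N)).
Proof.
  induction N as [|N IH]; [rewrite sum_O; simpl; unfold Im; ring|].
  rewrite sum_Sn, IH. reflexivity.
Qed.

Lemma rder_sub G H t D E : rder G t D -> rder H t E -> rder (fun s => G s - H s)%C t (D - E)%C.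
Proof.
  intros [G1 G2] [H1 H2]; split.
  - exact (is_derive_minus _ _ _ _ _ G1 H1).
  - exact (is_derive_minus _ _ _ _ _ G2 H2).
Qed.

Lemma rder_log_partial (z : C) N t :
  rder (fun s => csumn (fun k => lc k * (s * z) ^ k)%C (S N)) t (csumn (fun k => t ^ k * z ^ S k)%C N).
Proof.
  induction N as [|N IH].
  - apply rder_ext with (fun _ => 0%C); [intros; simpl; ring|apply rder_const].
  - change (rder (fun s => csumn (fun k => lc k * (s * z) ^ k) (S N) + lc (S N) * (s * z) ^ S N)%C t
      (csumn (fun k => t ^ k * z ^ S k) N + t ^ N * z ^ S N)%C).
    assert (M : rder (fun s => lc (S N) * (s * z) ^ S N)%C t (t ^ N * z ^ S N)%C).
    { apply rder_ext with (fun s => (lc (S N) * z ^ S N) * RtoC (s ^ S N))%C.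
      - intros s. rewrite Cpow_mult_l, RtoC_pow. ring.
      - assert (Q : rder (fun s => RtoC (s ^ S N)) t (RtoC (INR (S N) * t ^ N))).
        { split; cbn -[pow INR].
          - evar_last; [apply is_derive_pow; apply (is_derive_id (K := R_AbsRing))|]. unfold one; cbn -[pow INR]. ring.
          - exact (is_derive_const _ _). }
        eapply (eq_rect _ (rder _ t)); [apply (rder_mult _ _ _ _ _ (rder_const (lc (S N) * z ^ S N)%C t) Q)|].
        rewrite RtoC_mult, (RtoC_pow t N). unfold lc.
        assert (HN : INR (S N) <> 0) by (generalize (lt_0_INR (S N) ltac:(lia)); lra).
        assert (HC : RtoC (INR (S N)) <> 0%C) by (intros F; apply HN; now injection F).
        rewrite RtoC_inv by exact HN.
        generalize (RtoC (t ^ S N)), (t ^ N)%C, (z ^ S N)%C. intros A T Z. field. exact HC. }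
    destruct IH as [I1 I2], M as [M1 M2]; split.
    + exact (is_derive_plus _ _ _ _ _ I1 M1).
    + exact (is_derive_plus _ _ _ _ _ I2 M2).
Qed.

Lemma rder_mlog (z : C) t : Cmod z < 1 -> 0 <= t <= 1 -> rder (fun s => mlog (s * z)) t (z / (1 - t * z))%C.
Proof.
  intros Hz Ht.
  assert (Hx : t * Re z < 1).
  { assert (R1 := Re_lt_1 z Hz). assert (Re z <= 0 \/ 0 < Re z) as [H|H] by lra; nra. }
  destruct z as [x y]. simpl in Hx.
  assert (P : 0 < (1 - t * x) ^ 2 + (t * y) ^ 2) by (assert (0 < (1 - t * x) ^ 2) by (apply pow_lt; lra); generalize (pow2_ge_0 (t * y)); lra).
  split.
  - apply is_derive_ext with (fun s => - (1/2) * ln ((1 - s * x) ^ 2 + (s * y) ^ 2)).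
    { intros s. unfold mlog; simpl. do 2 f_equal. ring. }
    auto_derive; [lra|]. unfold Cdiv, Cinv; simpl. field; simpl in P; repeat split; lra.
  - apply is_derive_ext with (fun s => atan ((s * y) / (1 - s * x))).
    { intros s. unfold mlog; simpl. f_equal. f_equal; [ring|f_equal; ring]. }
    auto_derive; [lra|]. unfold Cdiv, Cinv, Rsqr; simpl. field; simpl in P; repeat split; lra.
Qed.

Lemma geom_remainder (z : C) (t : R) N : (1 - t * z)%C <> 0%C ->
  (z / (1 - t * z) - csumn (fun k => t ^ k * z ^ S k) N = t ^ N * z ^ S N / (1 - t * z))%C.
Proof.
  intros H. induction N as [|N IH].
  - simpl. field. exact H.
  - change (csumn ?u (S N)) with (csumn u N + u N)%C. cbv beta.
    transitivity ((z / (1 - t * z) - csumn (fun k => t ^ k * z ^ S k) N) - t ^ N * z ^ S N)%C; [ring|].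
    rewrite IH. rewrite !Cpow_S. field. exact H.
Qed.

Lemma mvt_bound (f df : R -> R) B : (forall t, 0 <= t <= 1 -> is_derive f t (df t)) ->
  (forall t, 0 <= t <= 1 -> Rabs (df t) <= B) -> Rabs (f 1 - f 0) <= B.
Proof.
  intros H HB.
  destruct (MVT_gen f 0 1 df) as [c [Hc E]].
  - intros x Hx. rewrite Rmin_left, Rmax_right in Hx by lra. apply H. lra.
  - intros x Hx. rewrite Rmin_left, Rmax_right in Hx by lra.
    apply continuity_pt_filterlim. apply (ex_derive_continuous f). eexists. now apply H.
  - rewrite Rmin_left, Rmax_right in Hc by lra. rewrite E, Rminus_0_r, Rmult_1_r. now apply HB.
Qed.

(** Along the segment t z the difference between [mlog] and its N-th partial sum has derivative t^N
    z^(N+1) / (1 - t z), the remainder of a geometric series. The mean value theorem bounds each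
    component by q^(N+1) / (1 - q), with q = |z|. *)
Lemma mlog_series (z : C) : Cmod z < 1 -> csum (fun k => lc k * z ^ k)%C (mlog z).
Proof.
  intros Hz. assert (Hz0 := Cmod_ge_0 z).
  set (q := Cmod z) in *.
  set (G := fun N s => (mlog (RtoC s * z) - csumn (fun k => lc k * (s * z) ^ k) (S N))%C).
  assert (D : forall N t, 0 <= t <= 1 -> rder (G N) t (t ^ N * z ^ S N / (1 - t * z))%C).
  { intros N t Ht. rewrite <- geom_remainder.
    - apply rder_sub; [now apply rder_mlog|apply rder_log_partial].
    - apply one_minus_neq_0. rewrite Cmod_mult, Cmod_R, Rabs_pos_eq by lra. fold q. nra. }
  assert (B : forall N t, 0 <= t <= 1 -> Cmod (t ^ N * z ^ S N / (1 - t * z)) <= q / (1 - q) * q ^ N).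
  { intros N t Ht.
    assert (Hq : Cmod (t * z) <= q) by (rewrite Cmod_mult, Cmod_R, Rabs_pos_eq by lra; fold q; nra).
    assert (L : 1 - q <= Cmod (1 - t * z)).
    { assert (T : Cmod 1 <= Cmod (1 - t * z) + Cmod (t * z)).
      { replace (RtoC 1) with ((1 - t * z) + t * z)%C at 1 by ring. apply Cmod_triangle. }
      rewrite Cmod_1 in T. lra. }
    rewrite Cmod_div by (apply one_minus_neq_0; lra).
    rewrite Cmod_mult, !Cmod_pow, Cmod_R, Rabs_pos_eq by lra. fold q.
    apply Rle_div_l; [lra|].
    assert (P1 : t ^ N <= 1) by (rewrite <- (pow1 N); apply pow_incr; lra).
    assert (P2 : 0 <= q ^ S N) by (apply pow_le; lra).
    apply Rle_trans with (q ^ S N).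
    - assert (0 <= t ^ N) by (apply pow_le; lra). nra.
    - replace (q / (1 - q) * q ^ N * Cmod (1 - t * z)) with (q ^ S N * (Cmod (1 - t * z) / (1 - q)))
        by (simpl; field; lra).
      assert (1 <= Cmod (1 - t * z) / (1 - q)) by (apply Rle_div_r; lra). nra. }
  assert (G0 : forall N, G N 0 = 0%C).
  { intros N. unfold G. replace (0 * z)%C with (RtoC 0) by ring.
    replace (mlog 0) with (RtoC 0).
    - assert (E : forall M, csumn (fun k => lc k * 0 ^ k)%C M = 0%C).
      { induction M as [|M IM]; [reflexivity|]. simpl. rewrite IM. destruct M; simpl; ring. }
      rewrite E. ring.
    - unfold mlog; simpl. rewrite Rminus_0_r, !Rmult_1_r, Rmult_0_l, Rplus_0_r, ln_1.
      unfold Rdiv. rewrite Rmult_0_l, atan_0. apply C_ext; simpl; ring. }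
  assert (G1 : forall N, G N 1 = (mlog z - csumn (fun k => lc k * z ^ k) (S N))%C).
  { intros N. unfold G. replace (1 * z)%C with z by ring. reflexivity. }
  split; apply geom_bound_lim with (q / (1 - q)) q; try lra; intros N.
  - rewrite sum_n_Re.
    assert (M := mvt_bound (fun s => Re (G N s)) (fun t => Re (t ^ N * z ^ S N / (1 - t * z))%C) (q / (1 - q) * q ^ N)
      (fun t Ht => proj1 (D N t Ht)) (fun t Ht => Rle_trans _ _ _ (re_le_Cmod _) (B N t Ht))).
    cbv beta in M. rewrite G0, G1 in M. rewrite Rabs_minus_sym.
    replace (Re (mlog z) - Re (csumn (fun k => lc k * z ^ k)%C (S N))) with
      (Re (mlog z - csumn (fun k => lc k * z ^ k)%C (S N)) - Re 0); [exact M|]. unfold Re; simpl; ring.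
  - rewrite sum_n_Im.
    assert (M := mvt_bound (fun s => Im (G N s)) (fun t => Im (t ^ N * z ^ S N / (1 - t * z))%C) (q / (1 - q) * q ^ N)
      (fun t Ht => proj2 (D N t Ht)) (fun t Ht => Rle_trans _ _ _ (Im_le_Cmod _) (B N t Ht))).
    cbv beta in M. rewrite G0, G1 in M. rewrite Rabs_minus_sym.
    replace (Im (mlog z) - Im (csumn (fun k => lc k * z ^ k)%C (S N))) with
      (Im (mlog z - csumn (fun k => lc k * z ^ k)%C (S N)) - Im 0); [exact M|]. unfold Im; simpl; ring.
Qed.

(** * The exponential and the image of the strip map *)

Definition cexp (w : C) : C := (exp (Re w) * cis (Im w))%C.

Lemma cexp_plus u v : cexp (u + v) = (cexp u * cexp v)%C.
Proof.
  unfold cexp. replace (Re (u + v)) with (Re u + Re v) by reflexivity.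
  replace (Im (u + v)) with (Im u + Im v) by reflexivity.
  rewrite exp_plus, cis_plus, RtoC_mult. ring.
Qed.

Lemma cexp_mlog (z : C) : Cmod z < 1 -> (cexp (mlog z) * (1 - z))%C = 1%C.
Proof.
  intros Hz. assert (R1 := Re_lt_1 z Hz). destruct z as [x y]. simpl in R1.
  set (m := (1 - x) ^ 2 + y ^ 2).
  assert (Hm : 0 < m).
  { unfold m. assert (0 < (1 - x) ^ 2) by (apply pow_lt; lra). generalize (pow2_ge_0 y); lra. }
  assert (Ee : exp (- (1/2) * ln m) = / sqrt m).
  { rewrite <- (sqrt_def m) at 1 by lra.
    assert (0 < sqrt m) by now apply sqrt_lt_R0.
    rewrite ln_mult by assumption.
    replace (- (1 / 2) * (ln (sqrt m) + ln (sqrt m))) with (- ln (sqrt m)) by field.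
    now rewrite exp_Ropp, exp_ln. }
  assert (Hs : 0 < sqrt m) by now apply sqrt_lt_R0.
  assert (Es : sqrt m * sqrt m = m) by (apply sqrt_def; lra).
  assert (Eq : sqrt (1 + (y / (1 - x))²) = sqrt m / (1 - x)).
  { rewrite <- (sqrt_Rsqr (1 - x)) at 2 by lra. rewrite <- sqrt_div by (unfold Rsqr; nra).
    f_equal. unfold m, Rsqr. field. lra. }
  change (cexp (mlog (x, y))) with (exp (- (1/2) * ln m) * (cos (atan (y / (1 - x))), sin (atan (y / (1 - x)))))%C.
  rewrite cos_atan, sin_atan, Eq, Ee.
  apply C_ext; simpl.
  - transitivity (((1 - x) ^ 2 + y ^ 2) / (sqrt m * sqrt m)); [field; lra|]. rewrite Es. change ((1 - x) ^ 2 + y ^ 2) with m. field. lra.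
  - field. lra.
Qed.

Section Strip.
Variable th : R.
Hypothesis Hth : 0 < th < PI.

Definition strip_coeff (k : nat) : C := RtoC (lc k * sin (INR k * th) / sin th).

(** A branch of the logarithm of the Moebius map (1 - e^{-i th} z) / (1 - e^{i th} z), which sends
    the disk onto a half-plane; hence the image is a horizontal strip of width pi. *)
Definition strip_log (z : C) : C := (mlog (cis th * z) - mlog (cis (- th) * z))%C.

Definition strip_map (z : C) : C := (/ (2 * Ci * sin th) * strip_log z)%C.

Lemma sin_th_pos : 0 < sin th.
Proof. apply sin_gt_0; lra. Qed.

Lemma strip_denom_neq_0 : (2 * Ci * sin th)%C <> 0%C.
Proof.
  assert (P := sin_th_pos). apply Cmult_neq_0; [apply Cmult_neq_0|].
  - intros F; injection F; lra.
  - intros F; injection F; lra.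
  - intros F; injection F; lra.
Qed.

Lemma strip_series (z : C) : Cmod z < 1 -> csum (fun k => strip_coeff k * z ^ k)%C (strip_map z).
Proof.
  intros Hz. assert (P := sin_th_pos). assert (N := strip_denom_neq_0).
  assert (L : forall t, csum (fun k => lc k * (cis t * z) ^ k)%C (mlog (cis t * z))).
  { intros t. apply mlog_series. rewrite Cmod_mult, Cmod_cis. lra. }
  assert (Q := csum_scal (/ (2 * Ci * sin th)) _ _ (csum_plus _ _ _ _ (L th) (csum_scal (- (1))%C _ _ (L (- th))))).
  unfold strip_map, strip_log.
  replace (mlog (cis th * z) - mlog (cis (- th) * z))%C with (mlog (cis th * z) + - (1) * mlog (cis (- th) * z))%C by ring.
  eapply csum_ext; [|exact Q]. intros k. cbv beta. unfold strip_coeff.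
  rewrite !Cpow_mult_l, !cis_pow. replace (INR k * - th) with (- (INR k * th)) by ring.
  assert (E : (cis (INR k * th) - cis (- (INR k * th)) = 2 * Ci * sin (INR k * th))%C).
  { apply C_ext; simpl; rewrite ?cos_neg, ?sin_neg; ring. }
  transitivity (/ (2 * Ci * sin th) * (lc k * z ^ k * (cis (INR k * th) - cis (- (INR k * th)))))%C; [ring|].
  rewrite E. rewrite RtoC_div, RtoC_mult by lra.
  assert (N1 : RtoC (sin th) <> 0%C) by (intros F; injection F; lra).
  assert (N2 : Ci <> 0%C) by (intros F; injection F; lra).
  generalize (z ^ k)%C. intros w. field. split; assumption.
Qed.

Lemma cexp_strip_log (z : C) : Cmod z < 1 ->
  (cexp (strip_log z) * (1 - cis th * z) = 1 - cis (- th) * z)%C.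
Proof.
  intros Hz.
  assert (L : forall t, (cexp (mlog (cis t * z)) * (1 - cis t * z))%C = 1%C).
  { intros t. apply cexp_mlog. rewrite Cmod_mult, Cmod_cis. lra. }
  assert (S : (cexp (strip_log z) * cexp (mlog (cis (- th) * z)))%C = cexp (mlog (cis th * z))).
  { rewrite <- cexp_plus. f_equal. unfold strip_log. ring. }
  transitivity (cexp (strip_log z) * (cexp (mlog (cis (- th) * z)) * (1 - cis (- th) * z)) * (1 - cis th * z))%C.
  - rewrite L. ring.
  - transitivity ((cexp (strip_log z) * cexp (mlog (cis (- th) * z))) * (1 - cis th * z) * (1 - cis (- th) * z))%C; [ring|].
    rewrite S, L. ring.
Qed.

Lemma Cmod_sq_lt_1 (z : C) : Cmod z < 1 -> Re z ^ 2 + Im z ^ 2 < 1.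
Proof.
  intros H. rewrite <- Cmod_sq. assert (P := Cmod_ge_0 z). nra.
Qed.

(** Multiplied by e^{i th}, the Moebius map becomes (e^{i th} - z) / (1 - e^{i th} z), whose
    imaginary part has the sign of sin th (1 - |z|^2). So sin(U + th) > 0 for U = Im([strip_log] z),
    and the a priori bound |U| < pi from the two arctangents leaves only U + th in (0, pi). *)
Lemma strip_log_range (z : C) : Cmod z < 1 -> - th < Im (strip_log z) < PI - th.
Proof.
  intros Hz. assert (P := sin_th_pos).
  assert (B : - PI < Im (strip_log z) < PI).
  { unfold strip_log, mlog. simpl.
    match goal with |- _ < atan ?p + - atan ?q < _ =>
      generalize (atan_bound p) (atan_bound q) end. intros [] []. lra. }
  assert (Hc : Cmod (cis th * z) < 1) by (rewrite Cmod_mult, Cmod_cis; lra).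
  assert (N0 := proj1 (Cmod_gt_0 _) (one_minus_neq_0 _ Hc)).
  assert (Pos : 0 < Im (cexp (strip_log z) * cis th)%C).
  { set (X := (cexp (strip_log z) * cis th)%C). set (D := (1 - cis th * z)%C) in *.
    assert (E : (X * D)%C = (cis th - z)%C).
    { transitivity (cis th * (cexp (strip_log z) * D))%C; [unfold X; ring|].
      unfold D. rewrite (cexp_strip_log z Hz).
      transitivity (cis th - (cis (- th) * cis th) * z)%C; [ring|]. rewrite cis_opp_mult. ring. }
    assert (F : Im (X * D * Cconj D)%C = sin th * (1 - (Re z ^ 2 + Im z ^ 2))).
    { rewrite E. unfold D. assert (S := sin2_cos2 th). unfold Rsqr in S.
      destruct z as [x y]. simpl.
      transitivity (sin th * (1 - (x * x + y * y)) + ((sin th * sin th + cos th * cos th) - 1) * y); [ring|].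
      rewrite S. ring. }
    assert (G : Im (X * D * Cconj D)%C = Cmod D ^ 2 * Im X).
    { rewrite Cmod_sq. simpl; unfold Re, Im; simpl. ring. }
    rewrite G in F. assert (H := Cmod_sq_lt_1 z Hz).
    assert (0 < Cmod D ^ 2) by now apply pow_lt.
    assert (0 < sin th * (1 - (Re z ^ 2 + Im z ^ 2))) by (apply Rmult_lt_0_compat; lra).
    apply Rnot_le_lt. intros L. nra. }
  set (U := Im (strip_log z)) in *.
  assert (E : Im (cexp (strip_log z) * cis th)%C = exp (Re (strip_log z)) * sin (U + th)).
  { unfold cexp. fold U. rewrite <- Cmult_assoc, <- cis_plus. simpl. ring. }
  rewrite E in Pos.
  assert (S : 0 < sin (U + th)).
  { assert (Q := exp_pos (Re (strip_log z))). apply Rnot_le_lt. intros L. nra. }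
  split; apply Rnot_le_lt; intros L.
  - assert (0 <= sin (- (U + th))) by (apply sin_ge_0; lra). rewrite sin_neg in H. lra.
  - assert (sin (U + th) <= 0) by (apply sin_le_0; lra). lra.
Qed.

Lemma Cmod_cexp w : Cmod (cexp w) = exp (Re w).
Proof.
  unfold cexp. rewrite Cmod_mult, Cmod_cis, Cmod_R, Rabs_pos_eq; [ring|]. left; apply exp_pos.
Qed.

Lemma cexp_inj_strip w w' : cexp w = cexp w' ->
  - th < Im w < PI - th -> - th < Im w' < PI - th -> w = w'.
Proof.
  intros E H H'.
  assert (R : Re w = Re w').
  { apply exp_inv. rewrite <- !Cmod_cexp. now rewrite E. }
  apply C_ext; [exact R|].
  assert (E2 : cis (Im w) = cis (Im w')).
  { assert (N : RtoC (exp (Re w)) <> 0%C) by (intros F; injection F; generalize (exp_pos (Re w)); lra).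
    unfold cexp in E. rewrite <- R in E.
    transitivity (exp (Re w) * cis (Im w) / exp (Re w))%C; [field; exact N|]. rewrite E. field; exact N. }
  (* The shift by th places both arguments in (0, pi), where the cosine is injective. *)
  assert (E3 : cos (Im w + th) = cos (Im w' + th)).
  { change (Re (cis (Im w + th)) = Re (cis (Im w' + th))). now rewrite !cis_plus, E2. }
  apply cos_inj in E3; lra.
Qed.

Lemma cis_diff_neq_0 : (cis (- th) - cis th)%C <> 0%C.
Proof.
  intros F. apply (f_equal Im) in F. simpl in F. rewrite sin_neg in F. generalize sin_th_pos; lra.
Qed.

(** Inverts the Moebius map at M = exp w: z = (1 - M) / D with D = e^{-i th} - M e^{i th}. Here
    |D|^2 - |1 - M|^2 = 4 sin th Im(M e^{i th}) is positive exactly because w lies in the strip. *)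
Lemma strip_log_onto w : - th < Im w < PI - th -> exists z, Cmod z < 1 /\ strip_log z = w.
Proof.
  intros Hw. assert (P := sin_th_pos).
  set (M := cexp w).
  assert (HM : 0 < Im (M * cis th)%C).
  { unfold M, cexp. rewrite <- Cmult_assoc, <- cis_plus. simpl.
    rewrite Rmult_0_l, Rplus_0_r. apply Rmult_lt_0_compat; [apply exp_pos|]. apply sin_gt_0; lra. }
  set (D := (cis (- th) - M * cis th)%C).
  assert (Dist : Cmod D ^ 2 - Cmod (1 - M) ^ 2 = 4 * sin th * Im (M * cis th)%C).
  { rewrite !Cmod_sq. unfold D. destruct M as [m1 m2]. simpl. rewrite cos_neg, sin_neg.
    assert (S := sin2_cos2 th). unfold Rsqr in S.
    match goal with |- ?l = ?r => transitivity (r + ((1 - m1) * (1 - m1) + m2 * m2) * ((sin th * sin th + cos th * cos th) - 1)); [ring|] end.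
    rewrite S. ring. }
  assert (Lt : Cmod (1 - M) < Cmod D).
  { assert (0 < sin th * Im (M * cis th)%C) by now apply Rmult_lt_0_compat.
    assert (A := Cmod_ge_0 (1 - M)). assert (B := Cmod_ge_0 D).
    apply Rnot_le_lt. intros L. nra. }
  assert (HD : 0 < Cmod D) by (generalize (Cmod_ge_0 (1 - M)); lra).
  assert (ND : D <> 0%C) by now apply Cmod_gt_0.
  set (z := ((1 - M) / D)%C).
  assert (Hz : Cmod z < 1).
  { unfold z. rewrite Cmod_div by exact ND. apply Rlt_div_l; lra. }
  exists z. split; [exact Hz|].
  apply cexp_inj_strip; [|now apply strip_log_range|exact Hw].
  assert (E := cexp_strip_log z Hz). assert (I := cis_opp_mult th). assert (K := cis_diff_neq_0).
  assert (E1 : (1 - cis th * z)%C = ((cis (- th) - cis th) / D)%C).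
  { unfold z. transitivity ((D - cis th * (1 - M)) / D)%C; [field; exact ND|]. unfold D at 1. f_equal. ring. }
  assert (E2 : (1 - cis (- th) * z)%C = (M * (cis (- th) - cis th) / D)%C).
  { unfold z. transitivity ((D - cis (- th) * (1 - M)) / D)%C; [field; exact ND|]. unfold D at 1. f_equal. ring. }
  rewrite E1, E2 in E. fold M.
  transitivity (cexp (strip_log z) * ((cis (- th) - cis th) / D) / ((cis (- th) - cis th) / D))%C.
  - field. split; assumption.
  - rewrite E. field. split; assumption.
Qed.

(** Equal logarithms give equal Moebius values; cross-multiplied, their difference is the nonzero
    determinant e^{-i th} - e^{i th} times z - z'. *)
Lemma strip_log_inj (z z' : C) : Cmod z < 1 -> Cmod z' < 1 -> strip_log z = strip_log z' -> z = z'.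
Proof.
  intros Hz Hz' E. assert (E1 := cexp_strip_log z Hz). assert (E2 := cexp_strip_log z' Hz').
  rewrite <- E in E2. set (e := cexp (strip_log z)) in *.
  assert (K := cis_diff_neq_0).
  assert (X : ((cis (- th) - cis th) * (z - z'))%C = 0%C).
  { transitivity ((1 - cis (- th) * z') * (1 - cis th * z) - (1 - cis (- th) * z) * (1 - cis th * z'))%C; [ring|].
    rewrite <- E1, <- E2. ring. }
  assert (Y : (z - z')%C = 0%C).
  { transitivity ((cis (- th) - cis th) * (z - z') / (cis (- th) - cis th))%C; [field; exact K|]. rewrite X. field. exact K. }
  transitivity (z' + (z - z'))%C; [ring|]. rewrite Y. ring.
Qed.

Lemma strip_log_of_map z : strip_log z = (2 * Ci * sin th * strip_map z)%C.
Proof.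
  unfold strip_map. generalize strip_denom_neq_0. generalize (2 * Ci * sin th)%C.
  intros d N. field. exact N.
Qed.

Lemma strip_map_convex (z z' : C) t : Cmod z < 1 -> Cmod z' < 1 -> 0 <= t <= 1 ->
  exists x, Cmod x < 1 /\ strip_map x = ((1 - t)%R * strip_map z + t * strip_map z')%C.
Proof.
  intros Hz Hz' Ht. set (w := ((1 - t)%R * strip_log z + t * strip_log z')%C).
  assert (Hw : - th < Im w < PI - th).
  { replace (Im w) with ((1 - t) * Im (strip_log z) + t * Im (strip_log z')) by (unfold w; simpl; unfold Im; ring).
    assert (R1 := strip_log_range z Hz). assert (R2 := strip_log_range z' Hz').
    destruct (Req_dec t 0) as [->|N]; [lra|]. split; nra. }
  destruct (strip_log_onto w Hw) as [x [Hx Ex]]. exists x. split; [exact Hx|].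
  unfold strip_map. rewrite Ex. unfold w. ring.
Qed.
End Strip.

(** * The class K and the theorem *)

Lemma psum_csumn a z N : psum a z N = csumn (fun k => a k * z ^ k)%C (S N).
Proof.
  induction N as [|N IH].
  - change (Cmul (a O) (Defs.Cpow z 0) = (0 + a O * z ^ 0)%C). apply C_ext; simpl; unfold Re, Im; ring.
  - change (Cadd (psum a z N) (a (S N) * z ^ S N)%C = (csumn (fun k => a k * z ^ k) (S N) + a (S N) * z ^ S N)%C).
    rewrite IH. reflexivity.
Qed.

Lemma series_to_csum a z w : series_to a z w <-> csum (fun k => a k * z ^ k)%C w.
Proof.
  assert (E1 : forall N, fst (psum a z N) = sum_n (fun k => Re (a k * z ^ k)%C) N).
  { intros N. now rewrite psum_csumn, (sum_n_Re (fun k => a k * z ^ k)%C). }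
  assert (E2 : forall N, snd (psum a z N) = sum_n (fun k => Im (a k * z ^ k)%C) N).
  { intros N. now rewrite psum_csumn, (sum_n_Im (fun k => a k * z ^ k)%C). }
  split; intros [H1 H2]; split.
  - apply is_lim_seq_Reals in H1. exact (is_lim_seq_ext _ _ _ E1 H1).
  - apply is_lim_seq_Reals in H2. exact (is_lim_seq_ext _ _ _ E2 H2).
  - apply is_lim_seq_Reals. eapply is_lim_seq_ext; [intros; symmetry; apply E1|exact H1].
  - apply is_lim_seq_Reals. eapply is_lim_seq_ext; [intros; symmetry; apply E2|exact H2].
Qed.

Lemma series_terms_bounded (u : nat -> R) s : is_series u s -> exists M, forall k, Rabs (u k) <= M.
Proof.
  intros H. assert (L : is_lim_seq u 0) by (apply ex_series_lim_0; now exists s).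
  apply is_lim_seq_Reals in L.
  destruct (maj_by_pos u (exist _ 0 L)) as [M [_ HM]]. now exists M.
Qed.

(** Convergence at the real point rho bounds the terms a_k rho^k. *)
Lemma in_K_disk_coeffs a : in_K a -> disk_coeffs a.
Proof.
  intros [_ [_ [Hs _]]] rho Hr.
  destruct (Hs (RtoC rho)) as [w Hw].
  { change (Cmod (RtoC rho) < 1). rewrite Cmod_R, Rabs_pos_eq; lra. }
  apply series_to_csum in Hw. destruct Hw as [H1 H2].
  destruct (series_terms_bounded _ _ H1) as [M1 B1].
  destruct (series_terms_bounded _ _ H2) as [M2 B2].
  exists (M1 + M2). intros k.
  replace (Cmod (a k) * rho ^ k) with (Cmod (a k * rho ^ k)).
  - eapply Rle_trans; [apply Cmod_le_abs|]. apply Rplus_le_compat; auto.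
  - rewrite Cmod_mult, Cmod_pow, Cmod_R, Rabs_pos_eq; lra.
Qed.

Lemma disk_coeffs_series a z : disk_coeffs a -> Cmod z < 1 -> series_to a z (ev a z).
Proof.
  intros Ha Hz. destruct (disk_near z Hz) as [rho [r [d [H1 [H2 [_ [H4 _]]]]]]].
  destruct (Ha rho) as [M HM]; [lra|].
  apply series_to_csum. apply (ev_spec rho M a z HM). lra.
Qed.

Lemma in_K_injective a : in_K a -> disk_injective a.
Proof.
  intros HK z z' Hz Hz' E. assert (Ha := in_K_disk_coeffs a HK).
  destruct HK as [_ [_ [_ [Hi _]]]]. apply (Hi z z' (ev a z)); try assumption.
  - now apply disk_coeffs_series.
  - rewrite E. now apply disk_coeffs_series.
Qed.

Lemma in_K_mid_convex a : in_K a -> mid_convex a.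
Proof.
  intros HK z z' Hz Hz'. assert (Ha := in_K_disk_coeffs a HK).
  destruct HK as [_ [_ [_ [_ Hc]]]].
  destruct (Hc z z' (ev a z) (ev a z') (/ 2)) as [x [Hx Sx]]; try assumption; try lra.
  - now apply disk_coeffs_series.
  - now apply disk_coeffs_series.
  - exists x. split; [exact Hx|]. apply series_to_csum in Sx. rewrite (csum_ev _ _ _ Sx).
    apply C_ext; simpl; unfold Re, Im; field.
Qed.

Lemma strip_in_K th : 0 < th < PI -> in_K (strip_coeff th).
Proof.
  intros Hth. assert (P := sin_th_pos th Hth).
  assert (U : forall z w, Cmod z < 1 -> series_to (strip_coeff th) z w -> w = strip_map th z).
  { intros z w Hz Hw. apply series_to_csum in Hw. exact (csum_unique _ _ _ Hw (strip_series th Hth z Hz)). }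
  split; [|split; [|split; [|split]]].
  - apply C_ext; simpl; unfold Rdiv; ring.
  - apply C_ext; simpl; [|reflexivity]. rewrite !Rmult_1_l. field. lra.
  - intros z Hz. exists (strip_map th z). apply series_to_csum. now apply strip_series.
  - intros z1 z2 w H1 H2 S1 S2. apply (strip_log_inj th Hth); try assumption.
    rewrite !(strip_log_of_map th Hth). now rewrite <- (U _ _ H1 S1), <- (U _ _ H2 S2).
  - intros z1 z2 w1 w2 t H1 H2 S1 S2 Ht.
    destruct (strip_map_convex th Hth z1 z2 t H1 H2 Ht) as [x [Hx Ex]].
    exists x. split; [exact Hx|]. apply series_to_csum.
    rewrite (U _ _ H1 S1), (U _ _ H2 S2).
    replace (Cadd (Cscale (1 - t) (strip_map th z1)) (Cscale t (strip_map th z2))) with (strip_map th x).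
    + now apply strip_series.
    + rewrite Ex. apply C_ext; simpl; unfold Re, Im; ring.
Qed.

(** * Numerical inequalities behind the lower bound *)

Lemma cos_lower x : -2 <= x <= 2 -> 1 - x ^ 2 / 2 <= cos x.
Proof.
  intros H. destruct (pre_cos_bound x 0) as [B _]; [lra|lra|].
  unfold cos_approx, cos_term in B. simpl in B. lra.
Qed.

(** The constant is chosen so that PI^2 < 10, which is what n = 4 requires. Otherwise cos 1.58 >= 0,
    against the quartic upper bound for cos 0.79 and the duplication formula. *)
Lemma PI_lt_316 : PI < 316/100.
Proof.
  apply Rnot_le_lt. intros L.
  assert (H : 0 <= cos (2 * (79/100))) by (apply cos_ge_0; lra).
  rewrite cos_2a_cos in H.
  destruct (pre_cos_bound (79/100) 0) as [B1 B2]; [lra|lra|].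
  unfold cos_approx, cos_term in B1, B2. simpl in B1, B2. nra.
Qed.

(** With N = n + 1, the quadratic lower bound gives N cos(PI/N) >= N - PI^2/(2 N), and PI^2 < 10 <=
    2 N. *)
Lemma cos_pi_div_gt n : (4 <= n)%nat -> INR n < (INR n + 1) * cos (PI / (INR n + 1)).
Proof.
  intros Hn. assert (HN : 4 <= INR n) by (apply le_INR in Hn; simpl in Hn; lra).
  assert (HP := PI_lt_316). assert (HP0 := PI_RGT_0).
  set (N := INR n + 1) in *. assert (5 <= N) by (unfold N; lra).
  assert (X : 0 < PI / N <= 2) by (split; [apply Rdiv_lt_0_compat|apply Rle_div_l]; lra).
  assert (C := cos_lower (PI / N) ltac:(lra)).
  assert (E : N * (1 - (PI / N) ^ 2 / 2) = N - PI ^ 2 / (2 * N)) by (field; lra).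
  assert (Q : PI ^ 2 / (2 * N) < 1) by (apply Rlt_div_l; [lra|nra]).
  assert (N * (1 - (PI / N) ^ 2 / 2) <= N * cos (PI / N)) by (apply Rmult_le_compat_l; lra).
  unfold N in *. lra.
Qed.

Lemma strip_gap n : (4 <= n)%nat -> exists th, 0 < th < PI /\
  1 / INR n < Cmod (strip_coeff th n) - Cmod (strip_coeff th (S n)).
Proof.
  intros Hn. assert (HN : 4 <= INR n) by (apply le_INR in Hn; simpl in Hn; lra).
  assert (HP0 := PI_RGT_0).
  set (N := INR n + 1). set (t0 := PI / N).
  assert (Ht0 : 0 < t0) by (apply Rdiv_lt_0_compat; unfold N; lra).
  assert (EN : N * t0 = PI) by (unfold t0; field; unfold N; lra).
  (* The gap minus 1/n, multiplied by n (n+1) sin t. *)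
  set (g := fun t => N * sin (INR n * t) - INR n * sin (N * t) - N * sin t).
  assert (En : INR n * t0 = PI - t0) by (rewrite <- EN; unfold N; ring).
  assert (G0 : g t0 = 0).
  { unfold g. rewrite EN, En, sin_PI, sin_PI_x. ring. }
  set (l := N * (INR n - N * cos t0)).
  assert (D : is_derive g t0 l).
  { unfold g. auto_derive; [exact I|]. rewrite EN, En, cos_PI, cos_minus, cos_PI, sin_PI. unfold l, N. ring. }
  assert (Hl : l < 0).
  { assert (C := cos_pi_div_gt n Hn). fold N t0 in C. unfold l. assert (0 < N) by (unfold N; lra). nra. }
  (* With half the slope as tolerance, a step h to the left gives g >= -l h / 2 > 0. *)
  destruct (derive_bound g t0 l D (- l / 2)) as [d [Hd B]]; [lra|].
  (* The bound t0/2 keeps the new angle positive. Being below pi/(n+1), it makes the sines of th, n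
     th and (n+1) th positive, so the moduli are the quotients themselves. *)
  set (h := Rmin d (t0 / 2)).
  assert (Hh : 0 < h) by (apply Rmin_glb_lt; lra).
  assert (Hh1 : h <= d) by apply Rmin_l. assert (Hh2 : h <= t0 / 2) by apply Rmin_r.
  specialize (B (- h)). rewrite Rabs_Ropp, (Rabs_pos_eq h) in B by lra. specialize (B Hh1).
  rewrite G0 in B. set (th := t0 + - h) in *.
  assert (Gp : 0 < g th).
  { apply Rabs_le_between in B. nra. }
  assert (Hth : 0 < th < t0) by (unfold th; lra).
  assert (HthN : 0 < N * th < PI) by (rewrite <- EN; split; [apply Rmult_lt_0_compat|apply Rmult_lt_compat_l]; unfold N; lra).
  assert (Hthn : 0 < INR n * th < PI) by (unfold N in HthN; nra).
  assert (HthP : 0 < th < PI) by (unfold N in HthN; nra).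
  exists th. split; [exact HthP|].
  assert (S0 := sin_gt_0 th ltac:(lra) ltac:(lra)).
  assert (S1 := sin_gt_0 (INR n * th) ltac:(lra) ltac:(lra)).
  assert (S2 := sin_gt_0 (N * th) ltac:(lra) ltac:(lra)).
  assert (E : forall k, (1 <= k)%nat -> 0 < sin (INR k * th) ->
     Cmod (strip_coeff th k) = sin (INR k * th) / (INR k * sin th)).
  { intros k Hk Sk. assert (0 < INR k) by (apply lt_0_INR; lia).
    unfold strip_coeff. destruct k as [|k]; [lia|]. unfold lc.
    rewrite Cmod_R, Rabs_pos_eq.
    - field. lra.
    - apply Rdiv_le_0_compat; [|exact S0]. left. apply Rmult_lt_0_compat; [now apply Rinv_0_lt_compat|exact Sk]. }
  rewrite (E n) by (lia || exact S1).
  rewrite (E (S n)) by (lia || (rewrite S_INR; exact S2)).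
  rewrite S_INR. fold N. assert (NP : 0 < N) by (unfold N; lra).
  assert (F : sin (INR n * th) / (INR n * sin th) - sin (N * th) / (N * sin th) - 1 / INR n
    = g th / (INR n * N * sin th)) by (unfold g; field; lra).
  assert (0 < g th / (INR n * N * sin th)).
  { apply Rdiv_lt_0_compat; [exact Gp|]. repeat apply Rmult_lt_0_compat; lra. }
  lra.
Qed.

Import Defs.

Theorem theorem2 (n : nat) (hn : (4 <= n)%nat) :
  exists V : R,
    is_lub (fun v => exists a : nat -> Cx,
                in_K a /\ v = Cmod (a n) - Cmod (a (S n))) V /\
    1 / INR n < V /\ V < 2 / INR (n + 1).
Proof.
  destruct (convex_successive_upper n ltac:(lia)) as [d [Hd Up]].
  destruct (strip_gap n hn) as [th [Hth Low]].
  set (E := fun v => exists a : nat -> Cx, in_K a /\ v = Cmod (a n) - Cmod (a (S n))).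
  assert (HU : is_upper_bound E ((2 - d) / INR (n + 1))).
  { intros v [a [Ha ->]]. destruct (Ha) as [H0 [H1 _]].
    apply Up; [now apply in_K_disk_coeffs|now apply in_K_injective|now apply in_K_mid_convex|exact H0|exact H1]. }
  assert (HE : E (Cmod (strip_coeff th n) - Cmod (strip_coeff th (S n)))).
  { exists (strip_coeff th). split; [now apply strip_in_K|reflexivity]. }
  destruct (completeness E) as [V HV].
  - exists ((2 - d) / INR (n + 1)). exact HU.
  - eexists. exact HE.
  - exists V. split; [exact HV|split].
    + eapply Rlt_le_trans; [exact Low|]. apply HV, HE.
    + apply Rle_lt_trans with ((2 - d) / INR (n + 1)).
      * apply HV, HU.
      * apply Rmult_lt_compat_r; [|lra]. apply Rinv_0_lt_compat, lt_0_INR. lia.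
Qed.
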